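(* Let $\alpha \in (0,1]$ and let $X \subseteq \mathbb{R}^d$ be an $\alpha$-set. Let $p(\alpha) := \lceil 2/\alpha \rceil$ and $q(\alpha) := \lceil 1/\alpha\rceil$. Then: (1) For all $\beta \in (0,1]$ and $n \in \mathbb{N}$ we have $$\mathcal{A}^{np(\alpha),\beta}(X) \subseteq \mathcal{C}^{n,\frac{\alpha\beta}{2q(\alpha)}}(X).$$ More generally, if $\omega$ is a modulus of continuity and $n\in\mathbb{N}$, then $$\mathcal{A}^{np(\alpha),\omega}(X) \subseteq \mathcal{C}^{n,\widetilde\omega}(X), \quad\text{where } \widetilde\omega(t) := \omega\big(t^{\frac{\alpha}{2q(\alpha)}}\big).$$ (2) If $Y$ is any subset of $X$, then, for every modulus of continuity $\omega$ and every $n \in \mathbb{N}$, $\mathcal{A}^{np(\alpha),\omega}_Y(X) \subseteq \mathcal{C}^{n,\widetilde\omega}_Y(X)$ with the same $\widetilde\omega$.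
   Context: $\mathbb{N}=\{0,1,2,\dots\}$; $X^\circ$ is the interior of $X$; a set $X\subseteq \mathbb{R}^d$ is fat if $X\subseteq\overline{X^\circ}$. Truncated open $\alpha$-cusp: for $\alpha\in(0,1]$, $r,h>0$, $\Gamma_d^\alpha(r,h) := \{(x',x_d)\in\mathbb{R}^{d-1}\times\mathbb{R} : |x'|<r,\ h(|x'|/r)^\alpha < x_d < h\}$. An open set $U\subseteq\mathbb{R}^d$ has the uniform $\alpha$-cusp property if for every $x\in\partial U$ there exist $\epsilon>0$, a truncated open $\alpha$-cusp $\Gamma=\Gamma_d^\alpha(r,h)$ and $A\in \mathrm{O}(d)$ such that $y+A\Gamma\subseteq U$ for all $y\in\overline U\cap B(x,\epsilon)$. An $\alpha$-set is a closed fat set $X\subseteq\mathbb{R}^d$ such that $X^\circ$ has the uniform $\alpha$-cusp property. A modulus of continuity is an increasing subadditive function $\omega:[0,\infty)\to[0,\infty)$ with $\lim_{t\to0}\omega(t)=0$. A map $g$ is $\omega$-Hölder on a set $K$ if there is $C>0$ with $\|g(x)-g(y)\|\le C\,\omega(|x-y|)$ for all $x,y\in K$; $\beta$-Hölder means $\omega$-Hölder with $\omega(t)=t^\beta$, and superscripts $\beta$ below mean $\omega(t)=t^\beta$. $\mathcal{C}^\infty(\mathbb{R},X)$ is the set of $\mathcal{C}^\infty$-curves $c:\mathbb{R}\to\mathbb{R}^d$ with $c(\mathbb{R})\subseteq X$. $\mathcal{C}^{k,\omega}(\mathbb{R},\mathbb{R})$ is the set of $k$-times continuously differentiable functions whose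 $k$-th derivative is $\omega$-Hölder on compact sets. $\mathcal{A}^{k,\omega}(X)$ is the set of all $f:X\to\mathbb{R}$ such that $f\circ c\in\mathcal{C}^{k,\omega}(\mathbb{R},\mathbb{R})$ for all $c\in\mathcal{C}^\infty(\mathbb{R},X)$. For $Y\subseteq X$, $\mathcal{A}^{k,\omega}_Y(X)$ is the set of $f\in\mathcal{A}^{k,\omega}(X)$ such that $(f\circ c)^{(j)}(0)=0$ for all $j\le k$ and all $c\in\mathcal{C}^\infty(\mathbb{R},X)$ with $c(0)\in Y$. For $X$ closed and fat, $\mathcal{C}^{k,\omega}(X)$ is the set of $f:X\to\mathbb{R}$ such that $f|_{X^\circ}\in\mathcal{C}^k(X^\circ)$, all Fréchet derivatives $(f|_{X^\circ})^{(j)}:X^\circ\to L^j(\mathbb{R}^d,\mathbb{R})$, $j\le k$, extend continuously to maps $f^{(j)}:X\to L^j(\mathbb{R}^d,\mathbb{R})$ ($L^j$ = space of $j$-linear maps), where $f^{(0)}=f$, and $f^{(k)}$ is $\omega$-Hölder on compact subsets of $X$. $\mathcal{C}^{k,\omega}_Y(X)$ is the set of $f\in\mathcal{C}^{k,\omega}(X)$ with $f^{(j)}|_Y=0$ for all $j\le k$. *)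

(* Defs.v *)
From mathcomp Require Import all_boot all_order all_algebra.
From mathcomp Require Import all_classical all_reals all_analysis.
Set Implicit Arguments.
Unset Strict Implicit.
Unset Printing Implicit Defensive.
Import Order.TTheory GRing.Theory Num.Theory.
Import numFieldNormedType.Exports.
Local Open Scope classical_set_scope.
Local Open Scope ring_scope.

(* The ambient space is 'cV[R]_d.+1, so that the dimension d.+1 is at least 1
   and x = (x', x_last) with x' = row' ord_max x.  The library norm on matrices
   is the sup norm; it induces the same topology as the Euclidean norm, hence
   open, closed, compact sets, interiors and neighbourhoods are the library
   ones, while every metric quantity uses enorm. *)
Section Defs.
Context {R : realType}.

Definition enorm m (x : 'cV[R]_m) : R := Num.sqrt (\sum_i x i 0 ^+ 2).

Section Sets.
Context {d : nat}.
Implicit Types X U : set 'cV[R]_d.+1.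

Definition fat X := X `<=` closure X°.

Definition cusp (alpha r h : R) : set 'cV[R]_d.+1 :=
  [set x | enorm (row' ord_max x) < r /\
           h * (enorm (row' ord_max x) / r) `^ alpha < x ord_max 0 < h].

Definition uniform_cusp_property (alpha : R) U :=
  forall x, (closure U `\` U°) x ->
    exists eps r h (A : 'M[R]_d.+1),
      [/\ 0 < eps, 0 < r, 0 < h, A *m A^T = 1%:M &
          forall y z, closure U y -> enorm (y - x) < eps ->
            cusp alpha r h z -> U (y + A *m z)].

Definition alpha_set (alpha : R) X :=
  [/\ closed X, fat X & uniform_cusp_property alpha X°].

End Sets.

(* A function [0, oo) -> [0, oo) is represented by w : R -> R, of which only
   the values at nonnegative arguments matter.  Increasing is meant in the weak
   sense, the zero function being excluded: for subadditive w this amounts to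
   the last clause, which is automatic for strictly increasing w.  (For w = 0
   a locally constant, nonconstant f on a disconnected X would be w-Hölder
   along every curve in X, but not on the compact subsets of X.) *)
Definition modulus (w : R -> R) :=
  [/\ forall t, 0 <= t -> 0 <= w t,
      forall s t, 0 <= s -> s <= t -> w s <= w t,
      forall s t, 0 <= s -> 0 <= t -> w (s + t) <= w s + w t,
      w t @[t --> 0^'+] --> 0 &
      forall t, 0 < t -> 0 < w t].

Definition Ckw_line (k : nat) (w : R -> R) (g : R -> R) :=
  [/\ forall j, (j < k)%N -> forall t, derivable (derive1n j g) t 1,
      continuous (derive1n k g) &
      forall K : set R, compact K -> exists2 C, 0 < C &
        forall s t, K s -> K t ->
          `|derive1n k g s - derive1n k g t| <= C * w `|s - t|].

Section Spaces.
Context {d : nat}.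
Local Notation E := 'cV[R]_d.+1.
Implicit Types X Y : set E.

Definition smooth_curves X : set (R -> E) :=
  [set c | (forall j t, derivable (derive1n j c) t 1) /\ forall t, X (c t)].

(* Elements f of the spaces below are functions on X, represented by total
   functions; the values of f outside X are irrelevant. *)
Definition Akw (k : nat) (w : R -> R) X : set (E -> R) :=
  [set f : E -> R | forall c, smooth_curves X c -> Ckw_line k w (f \o c)].

Definition Akw_flat (k : nat) (w : R -> R) X Y : set (E -> R) :=
  [set f : E -> R | Akw k w X f /\
    forall c, smooth_curves X c -> Y (c 0) ->
      forall j, (j <= k)%N -> derive1n j (f \o c) 0 = 0].

Definition tset j (v : j.-tuple E) (i : 'I_j) (x : E) : j.-tuple E :=
  [tuple if l == i then x else tnth v l | l < j].

Definition multilinear j (A : j.-tuple E -> R) :=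
  forall v i (a : R) x y,
    A (tset v i (a *: x + y)) = a * A (tset v i x) + A (tset v i y).

(* L^j(R^(d+1), R) *)
Record mlin (j : nat) := MLin {
  mlin_fun :> j.-tuple E -> R;
  mlinP : multilinear mlin_fun }.

(* the operator norm of A is at most c (used with c >= 0) *)
Definition opnorm_le j (A : j.-tuple E -> R) (c : R) :=
  forall v, `|A v| <= c * \prod_(i < j) enorm (tnth v i).

(* G : R^(d+1) -> L^j has Fréchet derivative L at x, where L^(j+1) is
   identified with L(R^(d+1), L^j) through L |-> (h |-> L(h, -)). *)
Definition is_frechet j (G : E -> mlin j) (x : E) (L : mlin j.+1) :=
  forall e, 0 < e -> \forall h \near (0 : E),
    opnorm_le (fun v => G (x + h) v - G x v - L [tuple of h :: v])
              (e * enorm h).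

(* F j, for j <= k, is the continuous extension to X of the j-th Fréchet
   derivative of f on the interior of X.  When X is fat, F j is uniquely
   determined on X. *)
Definition derivatives_on X (k : nat) (f : E -> R)
    (F : forall j, E -> mlin j) :=
  [/\ forall x v, X x -> F 0%N x v = f x,
      forall j x, (j < k)%N -> X° x -> is_frechet (F j) x (F j.+1 x) &
      forall j x, (j <= k)%N -> X x -> forall e, 0 < e ->
        \forall y \near within X (nbhs x),
          opnorm_le (fun v => F j y v - F j x v) e].

Definition holder_on_compacts (w : R -> R) X j (G : E -> mlin j) :=
  forall K : set E, compact K -> K `<=` X -> exists2 C, 0 < C &
    forall x y, K x -> K y ->
      opnorm_le (fun v => G x v - G y v) (C * w (enorm (x - y))).

Definition Ckw (k : nat) (w : R -> R) X : set (E -> R) :=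
  [set f : E -> R | exists2 F, derivatives_on X k f F & holder_on_compacts w X (F k)].

Definition Ckw_flat (k : nat) (w : R -> R) X Y : set (E -> R) :=
  [set f : E -> R | exists F, [/\ derivatives_on X k f F,
                         holder_on_compacts w X (F k) &
    forall j y v, (j <= k)%N -> Y y -> F j y v = 0]].

End Spaces.

Definition p_exp (alpha : R) : nat := absz (Num.ceil (2 / alpha)).
Definition q_exp (alpha : R) : nat := absz (Num.ceil (1 / alpha)).

Definition wtilde (alpha : R) (w : R -> R) : R -> R :=
  fun t => w (t `^ (alpha / (2 * (q_exp alpha)%:R))).

End Defs.

(* Main.v *)
(* Inside a thinner cusp |h'|^2 <= c h_last^p with integer exponent p = p_exp alpha,
   f has Taylor expansions of order m = n p along all polynomial curves
   s |-> y + A gamma(s), with bounds uniform in y near x0 and gamma: if they failed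
   along a sequence of curves, rapidly shrinking pieces of these curves could be
   glued to one smooth curve in X along which f is not C^(m, w).
   The i-th Taylor coefficient along s |-> (s^p u', s^2 u_last) is a function of u;
   expanding f also along curves that move horizontally, vertically or along
   parabolas shows that it is a polynomial in u, homogeneous for the weights (p, 2).
   Hence f has at each y an anisotropic Taylor polynomial, with error s^m w(s) on the
   box dilated by (s^p, s^2).  For two points x, y the dilated boxes with
   s^p comparable to |x - y| overlap, and comparing the two polynomials there
   controls the derivatives of order j <= n up to s^(m - p j) w(s), as in
   Campanato's characterization of Holder spaces; w(s) is of the order of
   w(|x - y|^(1/p)), and 1/p >= alpha/(2 q). *)
Require Import Defs.
From mathcomp Require Import all_boot all_order all_algebra.
From mathcomp Require Import all_classical all_reals all_analysis.
From mathcomp Require Import qpoly ring lra zify.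
Import Order.TTheory GRing.Theory Num.Theory.
Import numFieldNormedType.Exports.
Local Open Scope classical_set_scope.
Local Open Scope ring_scope.
Set Implicit Arguments.
Unset Strict Implicit.
Unset Printing Implicit Defensive.

(** * Smooth functions of one variable *)

(** The curves may not leave X, and this decides their shape. The last coordinate grows like s^2
    rather than s, because Taylor expansions are taken on both sides of s = 0 while the cusp lies on
    one side only. A horizontal line at height t^2 leaves the cusp long before |s| reaches the fixed
    size T on which bounds uniform in t are wanted; a parabola of height about t^2 + s^2 stays
    inside for every s, and polynomiality in the vertical direction then converts statements along
    parabolas into statements along horizontal lines. The pieces to be glued have size 2^-(k^2) but
    occupy time intervals of length about 2^-k, so all derivatives of the glued curve tend to 0 at
    the accumulation point. The loss from rescaling time is a finite factor for each k and is built
    into the constants to be contradicted. Identities between coefficients rest on one fact: a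
    polynomial of degree at most m that is O(s^m w(s)) vanishes. The set Y is carried along from the
    start; Y empty gives the statements without Y. *)

Section Smooth.
Context {R : realType}.
Implicit Types (f g : R -> R) (j k n : nat) (t u : R).

Definition smooth (V : normedModType R) (g : R -> V) :=
  forall j t, derivable (derive1n j g) t 1.

(** Differentiable n + 1 times, by recursion on the derivative instead of on iterated derivatives:
    closure under sums, products and inverses is then an induction on n, and smoothness is [diffn n]
    for all n. *)
Fixpoint diffn n g : Prop :=
  (forall t, derivable g t 1) /\ if n is k.+1 then diffn k (derive1 g) else True.

Lemma diffn_derivable n g t : diffn n g -> derivable g t 1.
Proof. by case: n => [|n] []. Qed.

Lemma smoothP g : smooth g <-> forall n, diffn n g.
Proof.
split=> [sg n|dg j].
  elim: n g sg => [|n IH] g sg; split => //; try exact: (sg 0%N).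
  by apply: IH => j t; have := sg j.+1 t; rewrite derive1Sn.
elim: j g dg => [|j IH] g dg t; first exact: diffn_derivable (dg 0%N).
by rewrite derive1Sn; apply: IH => n; have [] := dg n.+1.
Qed.

Lemma diffnS n g : diffn n.+1 g -> diffn n g.
Proof.
elim: n g => [|n IH] g [dg dg']; split => //; exact: IH.
Qed.

Lemma is_derive1 g t : derivable g t 1 -> is_derive t 1 g ((derive1 g) t).
Proof. by move=> dg; apply: DeriveDef => //; rewrite derive1E. Qed.

Lemma derive1_funE f g : (forall t, is_derive t 1 f (g t)) -> (derive1 f) = g.
Proof. by move=> H; apply/funext => t; rewrite derive1E; have [] := H t. Qed.

Lemma diffn_is_derive n f g :
  (forall t, is_derive t 1 f (g t)) -> diffn n g -> diffn n.+1 f.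
Proof.
move=> H dg; split; first by move=> t; have [] := H t.
by rewrite (derive1_funE H).
Qed.

Lemma diffn_cst n (a : R) : diffn n (fun=> a).
Proof.
elim: n a => [|n IH] a.
  by split=> // t; exact: derivable_cst.
apply: (@diffn_is_derive n _ (fun=> 0)) => // t; exact: is_derive_cst.
Qed.

Lemma diffn_id n : diffn n (fun t => t).
Proof.
case: n => [|n]; first by split => // t; exact: derivable_id.
by apply: (@diffn_is_derive n _ (fun=> 1)); exact: diffn_cst.
Qed.

Lemma diffnD n f g : diffn n f -> diffn n g -> diffn n (fun t => f t + g t).
Proof.
elim: n f g => [|n IH] f g df dg.
  by split=> // t; apply: derivableD; [exact: df.1|exact: dg.1].
have [df0 df1] := df; have [dg0 dg1] := dg.
apply: (@diffn_is_derive n _ (fun t => (derive1 f) t + (derive1 g) t)); last exact: IH.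
move=> t; apply: is_deriveD; exact: is_derive1.
Qed.

Lemma diffnM n f g : diffn n f -> diffn n g -> diffn n (fun t => f t * g t).
Proof.
elim: n f g => [|n IH] f g df dg.
  by split=> // t; apply: derivableM; [exact: df.1|exact: dg.1].
have [df0 df1] := df; have [dg0 dg1] := dg.
apply: (@diffn_is_derive n _ (fun t => f t * (derive1 g) t + g t * (derive1 f) t)).
  move=> t; apply: is_deriveM; exact: is_derive1.
by apply: diffnD; apply: IH => //; exact: diffnS.
Qed.

Lemma diffn_sum n (I : Type) (r : seq I) (F : I -> R -> R) :
  (forall i, diffn n (F i)) -> diffn n (fun t => \sum_(i <- r) F i t).
Proof.
move=> dF; elim: r => [|i r IH].
  by under eq_fun do rewrite big_nil; exact: diffn_cst.
by under eq_fun do rewrite big_cons; exact: diffnD.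
Qed.

Lemma diffnX n f k : diffn n f -> diffn n (fun t => f t ^+ k).
Proof.
move=> df; elim: k => [|k IH].
  by under eq_fun do rewrite expr0; exact: diffn_cst.
by under eq_fun do rewrite exprS; exact: diffnM.
Qed.

Lemma diffnV n f : (forall t, f t != 0) -> diffn n f -> diffn n (fun t => (f t)^-1).
Proof.
move=> f0; elim: n => [|n IH] df.
  by split=> // t; apply: derivableV => //; exact: df.1.
have [df0 df1] := df.
apply: (@diffn_is_derive n _ (fun t => (-1) * ((f t)^-1 * (f t)^-1 * (derive1 f) t))).
  move=> t; have H := is_deriveV (f0 t) (is_derive1 (df0 t)).
  apply: is_derive_eq H _ => /=.
  by rewrite expr2 invfM /GRing.scale /= mulN1r mulNr.
by apply: diffnM; [exact: diffn_cst|apply: diffnM => //; apply: diffnM; apply: IH; exact: diffnS].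
Qed.

Lemma is_derive_affine g (a b : R) t (dg : R) : is_derive (a * t + b) 1 g dg ->
  is_derive t 1 (fun u => g (a * u + b)) (dg * a).
Proof.
move=> H.
have H2 : is_derive t (1 : R) (fun u => a * u + b) a.
  have H1 : is_derive t (1 : R) ( *%R a) a.
    have := @is_deriveZ _ _ _ (@id R) a t 1 1 (is_derive_id t 1).
    by rewrite /GRing.scale /= mulr1.
  have := is_deriveD H1 (is_derive_cst b t 1).
  by rewrite addr0.
exact: (@is_derive1_comp _ g (fun u => a * u + b) t dg a).
Qed.

Lemma diffn_affine n g (a b : R) : diffn n g -> diffn n (fun t => g (a * t + b)).
Proof.
elim: n g => [|n IH] g dg.
  split=> // t; have [dg0 _] := dg.
  by have [] := is_derive_affine (is_derive1 (dg0 (a * t + b))).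
have [dg0 dg1] := dg.
have H t : is_derive t 1 (fun t => g (a * t + b)) ((derive1 g) (a * t + b) * a).
  by apply: is_derive_affine; exact: is_derive1.
by apply: (diffn_is_derive H); apply: diffnM; [exact: IH|exact: diffn_cst].
Qed.

(** Serves at the one point where functions defined by cases have no local formula: the difference
    quotient at 0 is at most C |h|. *)
Lemma is_derive0_sq g (C : R) : (forall t, `|g t| <= C * t ^+ 2) -> is_derive (0 : R) 1 g 0.
Proof.
move=> gC.
have g0 : g 0 = 0 by apply/normr0_eq0/le_anti; rewrite normr_ge0 andbT (le_trans (gC 0))// expr0n mulr0.
have C0 : 0 <= C by have := gC 1; rewrite expr1n mulr1; apply: le_trans.
suff H : h^-1 *: (g (h *: 1 + 0) - g 0) @[h --> 0^'] --> (0 : R).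
  by apply: DeriveDef; [apply/cvg_ex; exists 0|apply/cvg_lim].
apply/cvgrPdist_le => /= e e0.
near=> h.
rewrite sub0r normrN g0 subr0 addr0 /GRing.scale /= mulr1 normrM normfV.
have h0 : h != 0 by near: h; exact: nbhs_dnbhs_neq.
have hh : h ^+ 2 = `|h| * `|h| by rewrite -normrM -expr2 ger0_norm ?sqr_ge0.
rewrite ler_pdivrMl ?normr_gt0// (le_trans (gC h))// hh mulrCA.
rewrite ler_pM2l ?normr_gt0//.
rewrite (@le_trans _ _ ((C + 1) * `|h|))//; first by rewrite ler_wpM2r// lerDl.
rewrite -ler_pdivlMl; last by rewrite ltr_wpDl.
near: h; apply: nbhs_dnbhs; apply/nbhs_ballP; exists ((C + 1)^-1 * e) => /=.
  by rewrite mulr_gt0// invr_gt0 ltr_wpDl.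
by move=> h /=; rewrite /ball /= sub0r normrN => /ltW.
Unshelve. all: by end_near. Qed.

Lemma exprM_expR_le n (x : R) : 0 <= x -> x ^+ n * expR (- x) <= n`!%:R.
Proof.
case: n => [|n] x0; first by rewrite expr0 mul1r -expR0 ler_expR oppr_le0.
rewrite expRN -ler_pdivlMr ?invr_gt0 ?expR_gt0// invrK mulrC -ler_pdivrMr ?ltr0n ?fact_gt0//.
by rewrite (le_trans _ (expR_ge1Dxn n x0))// lerDr.
Qed.

(** The polynomial parameter makes the family closed under differentiation: deriving P(1/t)
    exp(-1/t) replaces P by X^2 (P - P'). *)
Definition flatexp (P : {poly R}) t : R :=
  if 0 < t then P.[t^-1] * expR (- t^-1) else 0.

Lemma flatexp_le P : exists C : R, forall t, `|flatexp P t| <= C * t ^+ 2.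
Proof.
(* Each monomial is bounded through x^(i+2) exp(-x) <= (i+2)! at x = 1/t. *)
exists (\sum_(i < size P) `|P`_i| * (i.+2)`!%:R) => t.
rewrite /flatexp; case: ifPn => t0; last first.
  by rewrite normr0 mulr_ge0 ?sqr_ge0// sumr_ge0// => i _; rewrite mulr_ge0.
rewrite -ler_pdivrMr ?exprn_gt0//.
rewrite normrM (ger0_norm (expR_ge0 _)) horner_coef.
rewrite -mulrA -exprVn.
rewrite (le_trans (ler_wpM2r _ (ler_norm_sum _ _ _)))//.
  by rewrite mulr_ge0 ?expR_ge0 ?exprn_ge0// invr_ge0 ltW.
rewrite mulr_suml ler_sum// => i _.
rewrite normrM normrX normfV (gtr0_norm t0) -mulrA ler_wpM2l//.
rewrite mulrCA mulrC -exprD addn2.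
by rewrite exprM_expR_le// invr_ge0 ltW.
Qed.

Lemma is_derive_flatexp P t :
  is_derive t 1 (flatexp P) (flatexp (('X ^+ 2) * (P - P^`())) t).
Proof.
have [t0|t0|->] := ltgtP t 0.
- rewrite [X in is_derive _ _ _ X]/flatexp ltNge (ltW t0) /=.
  apply: (@near_eq_is_derive _ _ _ (fun=> 0)).
  near=> s; rewrite /flatexp ifF//; apply/negbTE; rewrite -leNgt ltW//.
  by near: s; exact: lt_nbhsl.
- rewrite [X in is_derive _ _ _ X]/flatexp t0.
  suff H : is_derive t 1 (fun s => P.[s^-1] * expR (- s^-1))
      (('X^2 * (P - P^`())).[t^-1] * expR (- t^-1)).
    apply: near_eq_is_derive H.
    near=> s; rewrite /flatexp ifT//.
    by near: s; exact: lt_nbhsr.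
  have t00 : t != 0 by rewrite gt_eqF.
  have H1 : is_derive t 1 (fun s : R => s^-1) (- t ^- 2).
    have := is_deriveV t00 (is_derive_id t 1).
    by rewrite /GRing.scale /= mulr1.
  have H2 : is_derive t 1 (fun s : R => - s^-1) (t ^- 2).
    by have := is_deriveN H1; rewrite opprK.
  have HP : is_derive t^-1 1 (horner P) P^`().[t^-1].
    by have := is_derive1 (@derivable_horner R P t^-1); rewrite -derivE.
  have H3 := is_derive1_comp HP H1.
  have H4 := @is_derive1_comp _ expR (fun s : R => - s^-1) _ _ _ (is_derive_expR (- t^-1)) H2.
  apply: (@is_derive_eq _ _ _ _ _ _ _ _ (is_deriveM H3 H4)).
  rewrite /GRing.scale /= !hornerE /=; rewrite expr2 invfM; ring.
- have [C HC] := flatexp_le P.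
  have -> : flatexp ('X^2 * (P - P^`())) 0 = 0 by rewrite /flatexp ltxx.
  exact: is_derive0_sq HC.
Unshelve. all: by end_near. Qed.

Lemma diffn_flatexp n P : diffn n (flatexp P).
Proof.
elim: n P => [|n IH] P; first by split=> // t; have [] := is_derive_flatexp P t.
exact: diffn_is_derive (is_derive_flatexp P) (IH _).
Qed.

Definition smoothstep t : R := flatexp 1 t / (flatexp 1 t + flatexp 1 (1 - t)).

Lemma flatexp1_ge0 t : 0 <= flatexp 1 t.
Proof. by rewrite /flatexp; case: ifP => // _; rewrite hornerC mul1r expR_ge0. Qed.

Lemma flatexp1_gt0 t : 0 < t -> 0 < flatexp 1 t.
Proof. by rewrite /flatexp => ->; rewrite hornerC mul1r expR_gt0. Qed.

Lemma smoothstep_den_gt0 t : 0 < flatexp 1 t + flatexp 1 (1 - t).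
Proof.
have [t0|t0] := ltP 0 t; first by rewrite ltr_pwDl ?flatexp1_gt0 ?flatexp1_ge0.
by rewrite ltr_wpDl ?flatexp1_ge0// flatexp1_gt0// subr_gt0 (le_lt_trans t0).
Qed.

Lemma diffn_smoothstep n : diffn n smoothstep.
Proof.
apply: diffnM; first exact: diffn_flatexp.
apply: diffnV => [t|]; first by rewrite gt_eqF ?smoothstep_den_gt0.
apply: diffnD; first exact: diffn_flatexp.
have := diffn_affine (-1) 1 (diffn_flatexp n 1).
by under eq_fun do rewrite mulN1r addrC.
Qed.

Lemma smoothstep0 t : t <= 0 -> smoothstep t = 0.
Proof. by rewrite /smoothstep {1}/flatexp ltNge => -> /=; rewrite mul0r. Qed.

Lemma smoothstep1 t : 1 <= t -> smoothstep t = 1.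
Proof.
move=> t1; rewrite /smoothstep [flatexp 1 (1 - t)]/flatexp subr_gt0 ltNge t1 /=.
by rewrite addr0 divff// gt_eqF// flatexp1_gt0// (lt_le_trans _ t1).
Qed.

Lemma smoothstep_ge0 t : 0 <= smoothstep t.
Proof. by rewrite divr_ge0 ?flatexp1_ge0// ltW ?smoothstep_den_gt0. Qed.

Lemma smoothstep_le1 t : smoothstep t <= 1.
Proof. by rewrite ler_pdivrMr ?smoothstep_den_gt0// mul1r lerDl flatexp1_ge0. Qed.

End Smooth.

(** * Superposition of rapidly decreasing pieces near the points 2^-k *)

Section Dyadic.
Context {R : realType}.
Implicit Types (g : nat -> R -> R) (j k : nat) (t u : R).

(* Equal to g k (2 ^ k t) near t = 2 ^- k; if g is rapid, the result is smooth also at 0. *)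
Definition dyadic g t : R :=
  if pselect (exists k, `|2 ^+ k * t - 1| < 1/4) is left e
  then g (sval (cid e)) (2 ^+ sval (cid e) * t) else 0.

(** If 2^k t lies in (3/4, 5/4), then doubling it at least once gives more than 3/2, outside that
    interval. *)
Lemma zone_uniq k l t :
  `|2 ^+ k * t - 1| < 1/4 -> `|2 ^+ l * t - 1| < 1/4 -> k = l.
Proof.
wlog kl : k l / (k <= l)%N.
  by move=> H hk hl; have [/H->//|/ltnW/H->] := leqP k l.
move=> hk hl; apply/eqP; rewrite eqn_leq kl /= leqNgt; apply/negP => lk.
have [m lE] : exists m, l = (m.+1 + k)%N by exists (l - k).-1; lia.
move: hk hl; rewrite lE exprD exprS !ltr_norml -!mulrA; set x := _ ^+ k * t.
set y := _ ^+ m => hx hy.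
have y1 : 1 <= y by apply: exprn_ege1; lra.
clearbody x y; clear -hx hy y1; nra.
Qed.

Lemma dyadicE g k t : `|2 ^+ k * t - 1| < 1/4 -> dyadic g t = g k (2 ^+ k * t).
Proof.
move=> hk; rewrite /dyadic; case: pselect => [e|[]]; last by exists k.
by case: cid => l hl /=; rewrite (zone_uniq hk hl).
Qed.

Lemma dyadic0 g t : (forall k, 1/4 <= `|2 ^+ k * t - 1|) -> dyadic g t = 0.
Proof.
move=> ht; rewrite /dyadic; case: pselect => // -[k hk].
by have := ht k; rewrite leNgt hk.
Qed.

Lemma dyadic_le0 g t : t <= 0 -> dyadic g t = 0.
Proof.
move=> t0; apply: dyadic0 => k; have : 2 ^+ k * t <= 0 by rewrite mulr_ge0_le0// exprn_ge0.
set x := _ * _ => x0; rewrite ler0_norm; lra.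
Qed.

(** The supports have radius 1/5 inside zones of radius 1/4, so the superposition vanishes near the
    ends of each zone; the last clause is decay of every derivative faster than any power of
    2^-k. *)
Definition rapid g := [/\ forall k n, diffn n (g k),
  forall k u, 1/5 < `|u - 1| -> g k u = 0 &
  forall j i, exists C, forall k u, `|derive1n j (g k) u| * 2 ^+ (k * i) <= C].

Lemma dyadic_out g t : rapid g -> (forall k, 1/5 < `|2 ^+ k * t - 1|) -> dyadic g t = 0.
Proof.
case=> _ g0 _ ht; rewrite /dyadic; case: pselect => // e.
by apply: g0.
Qed.

(** Decay with exponent i = 2 gives |g k| <= C 4^-k, and 1 <= 2 (2^k t)^2 in the zone because 2^k t
    > 3/4. *)
Lemma dyadic_sq g : rapid g -> exists C, forall t, `|dyadic g t| <= C * t ^+ 2.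
Proof.
move=> [_ _ /(_ 0%N 2%N)[C HC]]; exists (2 * C) => t.
have C0 : 0 <= C by apply: le_trans (HC 0%N 0); rewrite mulr_ge0.
have [[k hk]|H] := pselect (exists k, `|2 ^+ k * t - 1| < 1/4); last first.
  rewrite dyadic0 ?normr0; first by rewrite mulr_ge0 ?sqr_ge0// mulr_ge0.
  by move=> k; rewrite leNgt; apply/negP => hk; apply: H; exists k.
rewrite (dyadicE _ hk); have := HC k (2 ^+ k * t); rewrite /= => H.
move: hk; rewrite ltr_norml => hk.
have x0 : 0 < 2 ^+ k :> R by rewrite exprn_gt0.
move: H; rewrite exprM; set x := 2 ^+ k in hk x0 *; set y := `|_| => H.
have H2 : 1 <= 2 * (x * t) ^+ 2 by nra.
have y0 : 0 <= y by rewrite normr_ge0.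
have : y * x ^+ 2 <= (2 * C * t ^+ 2) * x ^+ 2.
  apply: (le_trans H); rewrite [leRHS](_ : _ = C * (2 * (x * t) ^+ 2)); last by ring.
  by rewrite ler_peMr.
by rewrite ler_pM2r// exprn_gt0.
Qed.

(** The pieces of the derivative of [dyadic g]; the chain rule factor 2^k costs one exponent i of
    the decay, so rapidity is preserved. *)
Definition ddyadic g : nat -> R -> R := fun k u => derive1 (g k) u * 2 ^+ k.

Lemma is_derive_dyadic g t : rapid g -> is_derive t 1 (dyadic g) (dyadic (ddyadic g) t).
Proof.
move=> rg; have [dg g0 _] := rg.
have [t0|t0|->] := ltgtP t 0.
- rewrite [X in is_derive _ _ _ X]dyadic_le0 ?(ltW t0)//.
  apply: (@near_eq_is_derive _ _ _ (fun=> 0)).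
  near=> s; rewrite dyadic_le0// ltW//; near: s; exact: lt_nbhsl.
- have [[k hk]|H] := pselect (exists k, `|2 ^+ k * t - 1| < 1/4).
    rewrite [X in is_derive _ _ _ X](dyadicE _ hk) /ddyadic.
    have H : is_derive t 1 (fun s => g k (2 ^+ k * s + 0)) (derive1 (g k) (2 ^+ k * t) * 2 ^+ k).
      apply: is_derive_affine; rewrite addr0; apply: is_derive1.
      exact: diffn_derivable (dg k 0%N).
    apply: near_eq_is_derive H.
    have x0 : 0 < 2 ^+ k :> R by rewrite exprn_gt0.
    apply/nbhs_ballP; exists ((1/4 - `|2 ^+ k * t - 1|) / 2 ^+ k) => /=.
      by rewrite divr_gt0// subr_gt0.
    move=> s; rewrite /ball /= ltr_pdivlMr// => hs; rewrite addr0 (@dyadicE _ k)//.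
    rewrite -(ltr_pM2r x0) in hs.
    have -> : 2 ^+ k * s - 1 = 2 ^+ k * t - 1 - (2 ^+ k) * (t - s) by ring.
    rewrite (le_lt_trans (ler_normB _ _))// normrM (gtr0_norm x0).
    move: hs; rewrite ltr_pM2r// => hs.
    by rewrite -ltrBrDl mulrC.
  have H4 k : 1/4 <= `|2 ^+ k * t - 1| by rewrite leNgt; apply/negP => hk; apply: H; exists k.
  rewrite [X in is_derive _ _ _ X]dyadic0//.
  apply: (@near_eq_is_derive _ _ _ (fun=> 0)).
  (* Changing t by at most one percent changes each 2^k t by at most one percent, which keeps a
     point at distance 1/4 from 1 at distance more than 1/5, for all k simultaneously. *)
  apply/nbhs_ballP; exists (t / 100) => /=; first by rewrite divr_gt0.
  move=> s; rewrite /ball /= => hs; rewrite dyadic_out// => k.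
  have x0 : 0 < 2 ^+ k :> R by rewrite exprn_gt0.
  have := H4 k; have : `|2 ^+ k * t - 2 ^+ k * s| < 2 ^+ k * t / 100.
    by rewrite -mulrBr normrM (gtr0_norm x0) -mulrA ltr_pM2l.
  have : 0 < 2 ^+ k * t by rewrite mulr_gt0.
  set x := _ * t; set y := _ * s => xp.
  rewrite ltr_norml => /andP[h1 h2]; rewrite ler_normr => h3.
  by rewrite ltr_normr; move/orP : h3 => [h3|h3]; apply/orP; [left|right]; lra.
- rewrite [X in is_derive _ _ _ X]dyadic_le0//.
  by have [C HC] := dyadic_sq rg; exact: is_derive0_sq HC.
Unshelve. all: by end_near. Qed.

Lemma derive1n_out0 (g : R -> R) (O : set R) : open O -> (forall u, O u -> g u = 0) ->
  forall j u, O u -> derive1n j g u = 0.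
Proof.
move=> oO; move=> + j; elim: j g => [//|j IH] g g0 u Ou.
rewrite derive1Sn; apply: IH => // v Ov.
have H : is_derive v 1 g 0.
  apply: (@near_eq_is_derive _ _ _ (fun=> 0)).
  near=> s; rewrite g0//; near: s; exact: open_nbhs_nbhs.
by rewrite derive1E; have [_ ->] := H.
Unshelve. all: by end_near. Qed.

Lemma open_far : open [set u : R | 1/5 < `|u - 1|].
Proof.
have -> : [set u : R | 1/5 < `|u - 1|] = (fun u => `|u - 1|) @^-1` [set x | 1/5 < x] by [].
apply: open_comp; last exact: open_gt.
by move=> u _; apply: cvg_norm; apply: cvgB; [exact: cvg_id|exact: cvg_cst].
Qed.

Lemma derive1nMr j (f : R -> R) (a : R) : (forall n, diffn n f) ->
  derive1n j (fun u => f u * a) = (fun u => derive1n j f u * a).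
Proof.
elim: j f => [//|j IH] f df; rewrite !derive1Sn.
rewrite -IH; last by move=> n; have [] := df n.+1.
congr (derive1n j _); apply: derive1_funE => t.
have := is_deriveM (is_derive1 (diffn_derivable (df 0%N))) (is_derive_cst a t 1).
by rewrite scaler0 add0r /GRing.scale /= [a * _]mulrC.
Qed.

Lemma derive1nD j (f1 f2 : R -> R) : (forall n, diffn n f1) -> (forall n, diffn n f2) ->
  derive1n j (fun u => f1 u + f2 u) = (fun u => derive1n j f1 u + derive1n j f2 u).
Proof.
elim: j f1 f2 => [//|j IH] f1 f2 df1 df2; rewrite !derive1Sn.
rewrite -IH; [|by move=> n; have [] := df1 n.+1|by move=> n; have [] := df2 n.+1].
congr (derive1n j _); apply: derive1_funE => t.
exact: is_deriveD (is_derive1 (diffn_derivable (df1 0%N))) (is_derive1 (diffn_derivable (df2 0%N))).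
Qed.

Lemma rapid_ddyadic g : rapid g -> rapid (ddyadic g).
Proof.
move=> [dg g0 rg]; split.
- by move=> k n; apply: diffnM; [have [] := dg k n.+1|exact: diffn_cst].
- move=> k u hu; rewrite /ddyadic.
  by have := derive1n_out0 open_far (g0 k) 1%N hu; rewrite /= => ->; rewrite mul0r.
move=> j i; have [C HC] := rg j.+1 i.+1; exists C => k u.
rewrite /ddyadic derive1nMr; last by move=> n; have [] := dg k n.+1.
by have := HC k u; rewrite derive1Sn mulnS exprD mulrA normrM [`|2 ^+ k|]ger0_norm// exprn_ge0.
Qed.

Lemma diffn_dyadic n g : rapid g -> diffn n (dyadic g).
Proof.
elim: n g => [|n IH] g rg; first by split=> // t; have [] := is_derive_dyadic t rg.
apply: (@diffn_is_derive _ n _ (dyadic (ddyadic g))); last by apply: IH; exact: rapid_ddyadic.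
by move=> t; exact: is_derive_dyadic.
Qed.

Lemma rapidD g1 g2 : rapid g1 -> rapid g2 -> rapid (fun k u => g1 k u + g2 k u).
Proof.
move=> [d1 z1 r1] [d2 z2 r2]; split.
- by move=> k n; exact: diffnD.
- by move=> k u hu; rewrite z1// z2// addr0.
move=> j i; have [C1 H1] := r1 j i; have [C2 H2] := r2 j i; exists (C1 + C2) => k u.
rewrite derive1nD//; apply: le_trans (lerD (H1 k u) (H2 k u)).
by rewrite -mulrDl ler_wpM2r ?exprn_ge0// ler_normD.
Qed.

Lemma rapid0 : rapid (fun _ _ => 0).
Proof.
split=> //; first by move=> k n; exact: diffn_cst.
move=> j i; exists 0 => k u.
rewrite (@derive1n_out0 _ setT)//; last exact: openT.
by rewrite normr0 mul0r.
Qed.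

Lemma rapid_sum (I : Type) (r : seq I) (F : I -> nat -> R -> R) :
  (forall i, rapid (F i)) -> rapid (fun k u => \sum_(i <- r) F i k u).
Proof.
move=> H; elim: r => [|i r IH].
  by under eq_fun do under eq_fun do rewrite big_nil; exact: rapid0.
by under eq_fun do under eq_fun do rewrite big_cons; exact: rapidD.
Qed.

(** One fixed profile of compact support has bounded derivatives of each order, so only the
    amplitudes have to decay. *)
Lemma rapid_scale (Psi : R -> R) (a : nat -> R) :
  (forall n, diffn n Psi) -> (forall u, 1/5 < `|u - 1| -> Psi u = 0) ->
  (forall i, exists C, forall k, `|a k| * 2 ^+ (k * i) <= C) ->
  rapid (fun k u => Psi u * a k).
Proof.
move=> dP P0 ra; split.
- by move=> k n; apply: diffnM => //; exact: diffn_cst.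
- by move=> k u hu; rewrite P0// mul0r.
move=> j i; have [C HC] := ra i.
have [B HB] : exists B, forall u, `|derive1n j Psi u| <= B.
  have cP : continuous (derive1n j Psi).
    by move=> t; apply/differentiable_continuous/derivable1_diffP; have /smoothP := dP; apply.
  have cP' : {within `[0, 2]%classic, continuous (fun u => `|derive1n j Psi u|)}.
    apply: continuous_subspaceT => t; apply: (@continuous_comp _ _ _ (derive1n j Psi)); first exact: cP.
    exact: norm_continuous.
  have [//|c _ Hc] := @EVT_max R _ 0 2 _ cP'.
  exists `|derive1n j Psi c| => u.
  have [hu|hu] := ltP (1/5) `|u - 1|.
    by rewrite (derive1n_out0 open_far P0 j hu) normr0.
  apply: Hc; rewrite in_itv /=; move: hu; rewrite ler_norml => hu.
  by apply/andP; lra.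
exists (B * C) => k u; rewrite derive1nMr// normrM -mulrA.
by apply: ler_pM => //; rewrite mulr_ge0 ?exprn_ge0.
Qed.

End Dyadic.

(** * Moduli of continuity and Taylor polynomials *)

Section Modulus.
Context {R : realType}.
Variable w : R -> R.
Hypothesis wm : modulus w.
Implicit Types s t a : R.

Lemma modulus_ge0 t : 0 <= t -> 0 <= w t.
Proof. by have [H _ _ _ _] := wm; apply: H. Qed.

Lemma modulus_le s t : 0 <= s -> s <= t -> w s <= w t.
Proof. by have [_ H _ _ _] := wm; apply: H. Qed.

Lemma modulus_gt0 t : 0 < t -> 0 < w t.
Proof. by have [_ _ _ _ H] := wm; apply: H. Qed.

Lemma modulus_small (e : R) : 0 < e -> exists2 T, 0 < T & forall t, 0 <= t -> t <= T -> w t <= e.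
Proof.
have [w0 wle _ /cvgrPdist_le H _] := wm => /H [T /= T0 HT].
exists (T / 2) => [|t t0 tT]; first by rewrite divr_gt0.
have T2 : 0 < T / 2 by rewrite divr_gt0.
have := HT (T / 2); rewrite /ball_ /= sub0r normrN gtr0_norm// => /(_ _ T2).
rewrite sub0r normrN ger0_norm ?w0 ?(ltW T2)// => HH.
by apply: (le_trans (wle _ _ t0 tT)); apply: HH; rewrite ltr_pdivrMr// ltr_pMr// ltr1n.
Qed.

Lemma modulus0 : w 0 = 0.
Proof.
apply/le_anti; rewrite modulus_ge0// andbT; apply/ler_addgt0Pl => e /modulus_small[T T0 /(_ 0)].
by rewrite addr0; apply => //; exact: ltW.
Qed.

(** Subadditivity is applied n times, with n the integer part of a plus one. *)
Lemma modulus_scale a t : 0 <= a -> 0 <= t -> w (a * t) <= (a + 1) * w t.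
Proof.
move=> a0 t0; have [_ wle wD _ _] := wm.
have wn n : w (n%:R * t) <= n%:R * w t.
  elim: n => [|n IH]; first by rewrite !mul0r modulus0.
  rewrite -natr1 !mulrDl !mul1r (le_trans (wD _ _ _ _))// ?lerD// mulr_ge0//.
have /andP[h1 h2] := Num.Theory.truncn_itv a0.
apply: (@le_trans _ _ (w ((Num.truncn a).+1%:R * t))).
  by apply: wle; [rewrite mulr_ge0|rewrite ler_wpM2r// ltW].
by apply: le_trans (wn _) _; rewrite ler_wpM2r ?modulus_ge0// -natr1 lerD2r.
Qed.

(** Uniqueness of Taylor polynomials with error s^m w(s). Write E = X^k Q with Q(0) nonzero; then k
    <= m, hence |Q(s)| <= C w(s) for small s, which contradicts w(s) -> 0. *)
Lemma poly_vanish m (E : {poly R}) (C T : R) : (size E <= m.+1)%N -> 0 < T ->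
  (forall s, 0 < s -> s < T -> `|E.[s]| <= C * (s ^+ m * w s)) -> E = 0.
Proof.
move=> sE T0 HE; apply/eqP/negP => /negP E0.
have C0 : 0 <= C.
  have h : 0 < T / 2 < T by apply/andP; lra.
  have := HE (T/2); move/andP: h => [h1 h2] /(_ h1 h2).
  move/(le_trans (normr_ge0 _)); rewrite pmulr_lge0//.
  by rewrite mulr_gt0 ?exprn_gt0 ?modulus_gt0.
have [k [Q]] := multiplicity_XsubC E 0; rewrite E0 /= subr0 => Q0 EQ.
have km : (k <= m)%N.
  have Qn0 : Q != 0 by apply: contraNneq Q0 => ->; rewrite root0.
  move: sE; rewrite EQ size_Mmonic ?monicXn// size_polyXn addnS /=.
  have : (0 < size Q)%N by rewrite size_poly_gt0.
  by case: (size Q) => // n _; rewrite addSn ltnS; apply: leq_trans; rewrite leq_addl.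
rewrite /root in Q0; have e0 : 0 < `|Q.[0]| / 2 by rewrite divr_gt0// normr_gt0.
have C1 : 0 < C + 1 by rewrite ltr_wpDl.
have [T1 T10 HT1] := modulus_small (divr_gt0 e0 C1).
have /cvgrPdist_lt /(_ _ e0) [T2 /= T20 HT2] := continuous_horner (p := Q) (x := 0).
pose s := Num.min 1 (Num.min T (Num.min T1 T2)) / 2.
have m0 : 0 < Num.min 1 (Num.min T (Num.min T1 T2)) by rewrite !lt_min ltr01 T0 T10 T20.
have s0 : 0 < s by rewrite divr_gt0.
have : s < Num.min 1 (Num.min T (Num.min T1 T2)) by rewrite /s ltr_pdivrMr// ltr_pMr// ltr1n.
rewrite !lt_min => /and4P[s1 sT sT1 sT2].
have := HT2 s; rewrite /ball_ /= sub0r normrN gtr0_norm// => /(_ sT2) HQ.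
have := HE s s0 sT; rewrite EQ hornerM hornerXn normrM (ger0_norm (exprn_ge0 _ (ltW s0))).
rewrite -(subnK km) exprD => HE'.
have : `|Q.[s]| <= C * (s ^+ (m - k) * w s).
  rewrite -(ler_pM2r (exprn_gt0 k s0)); apply: le_trans HE' _.
  by rewrite [s ^+ _ * s ^+ k]mulrC -!mulrA mulrA [C * s ^+ k]mulrC -!mulrA mulrC -!mulrA.
have w1 : w s <= `|Q.[0]| / 2 / (C + 1) by apply: HT1; exact: ltW.
have sm : s ^+ (m - k) <= 1 by rewrite exprn_ile1 ?ltW.
have ws : 0 < w s by exact: modulus_gt0.
have h3 : C * (s ^+ (m - k) * w s) <= C * w s.
  by rewrite ler_wpM2l// ler_piMl// ltW.
have h4 : C * w s < `|Q.[0]| / 2.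
  rewrite (@lt_le_trans _ _ ((C + 1) * w s)) ?ltr_pM2r ?ltrDl//.
  by rewrite mulrC -ler_pdivlMr.
have := ler_normB Q.[0] (Q.[0] - Q.[s]); rewrite subKr.
have := ler_distD Q.[s] Q.[0] 0; rewrite !subr0 => h5 _ h6.
move: h5 h6 h3 h4 HQ; lra.
Qed.

End Modulus.

Section Taylor.
Context {R : realType}.

Lemma mvt0 (F F' : R -> R) (x : R) : (forall t : R, is_derive t 1 F (F' t)) ->
  exists2 y, `|y| <= `|x| & F x - F 0 = F' y * x.
Proof.
move=> dF.
have cF (A : set R) : {within A, continuous F}.
  apply: continuous_subspaceT => t; apply/differentiable_continuous/derivable1_diffP.
  by have [] := dF t.
have [x0|x0] := leP 0 x.
  have [y] := MVT_segment x0 (fun t _ => dF t) (cF _).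
  rewrite in_itv /= => /andP[y0 yx] H; exists y; last by rewrite H subr0.
  by rewrite !ger0_norm// (le_trans y0).
have [y] := MVT_segment (ltW x0) (fun t _ => dF t) (cF _).
rewrite in_itv /= => /andP[y0 yx] H; exists y.
  by rewrite !ler0_norm ?lerN2// ltW.
by rewrite -opprB H sub0r mulrN opprK.
Qed.

Definition taylor m (g : R -> R) (a : R) : {poly R} :=
  \poly_(i < m.+1) (derive1n i g a / (i`!)%:R).

Lemma deriv_taylor m g a : (taylor m.+1 g a)^`() = taylor m (derive1 g) a.
Proof.
apply/polyP => i; rewrite coef_deriv !coef_poly ltnS.
case: ifP => _; last by rewrite mul0rn.
rewrite -[_ *+ i.+1]mulr_natr derive1Sn -mulrA; congr (_ * _).
by rewrite factS natrM invfM -mulrA mulrCA mulVf ?mulr1.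
Qed.

Lemma horner_taylor0 m g a : (taylor m g a).[0] = g a.
Proof.
by rewrite horner_coef0 coef_poly /= fact0 divr1.
Qed.

(** Induction on m: the derivative of the remainder of g is the remainder of g', and the mean value
    theorem gains one factor |s|. *)
Lemma taylor_le (w : R -> R) m (g : R -> R) (a rho C : R) :
  modulus w -> 0 <= C ->
  (forall j, (j < m)%N -> forall t, derivable (derive1n j g) t 1) ->
  (forall s, `|s| <= rho -> `|derive1n m g (a + s) - derive1n m g a| <= C * w `|s|) ->
  forall s, `|s| <= rho -> `|g (a + s) - (taylor m g a).[s]| <= C * (`|s| ^+ m * w `|s|).
Proof.
move=> wm C0; elim: m g => [|m IH] g dg Hg s hs.
  rewrite expr0 mul1r; have -> : (taylor 0 g a).[s] = g a; last exact: Hg.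
  by rewrite /taylor horner_poly big_ord1 expr0 mulr1 /= fact0 divr1.
have dg' j : (j < m)%N -> forall t, derivable (derive1n j (derive1 g)) t 1.
  by move=> jm t; rewrite -derive1Sn; apply: dg.
have := IH (derive1 g) dg'; rewrite -derive1Sn => /(_ Hg) {}IH.
pose F s := g (a + s) - (taylor m.+1 g a).[s].
pose F' s := derive1 g (a + s) - (taylor m (derive1 g) a).[s].
have dF (t : R) : is_derive t 1 F (F' t).
  apply: is_deriveB.
    have := @is_derive_affine _ g 1 a t (derive1 g (a + t)); rewrite mulr1.
    under eq_fun do rewrite mul1r addrC.
    by apply; rewrite mul1r addrC; apply: is_derive1; exact: (dg 0%N).
  rewrite -deriv_taylor derivE; apply: is_derive1; exact: derivable_horner.
have [y ys] := mvt0 s dF.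
have -> : F 0 = 0 by rewrite /F addr0 horner_taylor0 subrr.
rewrite subr0 -[g (a + s) - _]/(F s) => ->.
rewrite normrM exprSr -mulrA [`|s| * w _]mulrC !mulrA ler_wpM2r// -mulrA.
apply: le_trans (IH y (le_trans ys hs)) _.
rewrite ler_wpM2l//.
apply: (@le_trans _ _ (`|y| ^+ m * w `|s|)).
  by rewrite ler_wpM2l ?exprn_ge0// modulus_le.
rewrite ler_wpM2r ?(modulus_ge0 wm)//; apply: lerXn2r => //; rewrite nnegrE.
Qed.

End Taylor.

(** * Cut-off functions *)

Section Bump.
Context {R : realType}.
Implicit Types u v : R.

(** The two cut-offs are staggered: [annulus] equals 1 on 2 <= |u| <= 3, where [plateau] descends
    from 1 to 0, and vanishes for |u| <= 1, where the prescribed curve must appear unchanged, and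
    for |u| >= 4. *)
Definition plateau u : R := smoothstep (3 - u) * smoothstep (3 + u).
Definition annulus u : R :=
  smoothstep (4 - u) * smoothstep (4 + u) * (1 - smoothstep (2 - u) * smoothstep (2 + u)).

Lemma diffn_bump n (a : R) : diffn n (fun u => smoothstep (a - u) * smoothstep (a + u)).
Proof.
apply: diffnM.
  have := diffn_affine (-1) a (diffn_smoothstep n).
  by under eq_fun do rewrite mulN1r addrC.
have := diffn_affine 1 a (diffn_smoothstep n).
by under eq_fun do rewrite mul1r addrC.
Qed.

Lemma bump1 (a u : R) : `|u| <= a - 1 -> smoothstep (a - u) * smoothstep (a + u) = 1.
Proof. by rewrite ler_norml => /andP[h1 h2]; rewrite !smoothstep1 ?mulr1//; lra. Qed.

Lemma bump0 (a u : R) : a <= `|u| -> smoothstep (a - u) * smoothstep (a + u) = 0.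
Proof.
rewrite ler_normr => /orP[h|h].
  by rewrite smoothstep0 ?mul0r//; lra.
by rewrite [X in _ * X]smoothstep0 ?mulr0//; lra.
Qed.

Lemma bump_ge0 (a u : R) : 0 <= smoothstep (a - u) * smoothstep (a + u) :> R.
Proof. by rewrite mulr_ge0 ?smoothstep_ge0. Qed.

Lemma bump_le1 (a u : R) : smoothstep (a - u) * smoothstep (a + u) <= 1.
Proof. by rewrite mulr_ile1 ?smoothstep_ge0 ?smoothstep_le1. Qed.

Lemma plateau1 u : `|u| <= 2 -> plateau u = 1.
Proof. by move=> h; apply: bump1; lra. Qed.

Lemma annulus0 u : `|u| <= 1 -> annulus u = 0.
Proof. by move=> h; rewrite /annulus (@bump1 2) ?subrr ?mulr0//; lra. Qed.

Lemma annulus1 u : 2 <= `|u| -> `|u| <= 3 -> annulus u = 1.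
Proof. by move=> h h'; rewrite /annulus (@bump0 2)// subr0 (@bump1 4) ?mulr1//; lra. Qed.

Lemma annulus_out u : 4 <= `|u| -> annulus u = 0.
Proof. by move=> h; rewrite /annulus (@bump0 4)// mul0r. Qed.

Lemma annulus_ge0 u : 0 <= annulus u.
Proof. by rewrite mulr_ge0 ?bump_ge0// subr_ge0 bump_le1. Qed.

Lemma annulus_le1 u : annulus u <= 1.
Proof. by rewrite mulr_ile1 ?bump_ge0 ?bump_le1 ?subr_ge0 ?bump_le1// gerBl bump_ge0. Qed.

Lemma diffn_annulus n : diffn n annulus.
Proof.
apply: diffnM; first exact: (diffn_bump n 4).
apply: diffnD; first exact: diffn_cst.
by under eq_fun do rewrite -mulN1r; apply: diffnM; [exact: diffn_cst|exact: (diffn_bump n 2)].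
Qed.

End Bump.

(** * Smoothness of vector-valued curves by coordinates, and translation of the parameter *)

Section VectorCurves.
Context {R : realType}.

Lemma derive1n_col m (c : R -> 'cV[R]_m) :
  (forall i n, diffn n (fun t => c t i 0)) ->
  forall j, derive1n j c = (fun t => \col_i derive1n j (fun t => c t i 0) t).
Proof.
move=> dc; elim=> [|j IH].
  by apply/funext => t; apply/matrixP => i k; rewrite ord1 mxE.
rewrite derive1nS IH; apply/funext => t.
have H : derivable (fun t => \col_i derive1n j (fun t => c t i 0) t) t 1.
  apply/derivable_mxP => i k; rewrite (_ : (fun x => _) = derive1n j (fun t => c t i 0)).
    by have /smoothP := dc i; apply.
  by apply/funext => x; rewrite mxE.
rewrite derive1E derive_mx//; apply/matrixP => i k; rewrite !mxE derive1nS derive1E.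
by congr ('D_1 _ t); apply/funext => x; rewrite mxE.
Qed.

Lemma smooth_col m (c : R -> 'cV[R]_m) :
  (forall i n, diffn n (fun t => c t i 0)) -> smooth c.
Proof.
move=> dc j t; rewrite derive1n_col//; apply/derivable_mxP => i k.
rewrite (_ : (fun x => _) = derive1n j (fun t => c t i 0)).
  by have /smoothP := dc i; apply.
by apply/funext => x; rewrite mxE.
Qed.

Lemma derive1n_shift (V : normedModType R) (g : R -> V) (b : R) j t :
  derive1n j (fun s => g (s + b)) t = derive1n j g (t + b).
Proof.
elim: j t => [//|j IH] t; rewrite !derive1nS /derive1.
by under eq_fun do rewrite !IH -addrA.
Qed.

Lemma derivable_shift (V : normedModType R) (g : R -> V) (b : R) t :
  derivable g (t + b) 1 -> derivable (fun s => g (s + b)) t 1.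
Proof.
by rewrite /derivable /=; under eq_fun do rewrite addrA.
Qed.

Lemma smooth_shift (V : normedModType R) (g : R -> V) (b : R) :
  smooth g -> smooth (fun s => g (s + b)).
Proof.
move=> sg j t; have -> : derive1n j (fun s => g (s + b)) = (fun s => derive1n j g (s + b)).
  by apply/funext => s; exact: derive1n_shift.
exact: derivable_shift.
Qed.

End VectorCurves.

(** * Gluing curves in cusps *)

Section GluedCurve.
Context {R : realType} {d : nat}.
Local Notation E := 'cV[R]_d.+1.
Implicit Types (X : set E) (A : 'M[R]_d.+1) (p : nat) (G : nat -> E) (s : R) (l : 'I_d.+1).

Definition in_cusp p (c : R) (h : E) :=
  0 <= h ord_max 0 /\
  \sum_(i < d.+1 | i != ord_max) h i 0 ^+ 2 <= c * h ord_max 0 ^+ p.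

(* The cusp at 0 given by |h'| <= sqrt c h_last^(p/2) fits into an alpha-cusp as p alpha >= 2;
   its exponent makes membership polynomial in h. *)
Definition cusp_at X p (c e B : R) (x0 : E) A :=
  forall y h, X y -> `|y - x0| <= e -> in_cusp p c h -> h ord_max 0 <= B ->
    X (y + A *m h).

Definition pcurve p (G : nat -> E) (s : R) : E := \sum_(i < p.+1) s ^+ i *: G i.

Lemma pcurveE p G s l : pcurve p G s l 0 = \sum_(i < p.+1) s ^+ i * G i l 0.
Proof. by rewrite /pcurve summxE; apply: eq_bigr => i _; rewrite mxE. Qed.

Lemma pcurve_le p G s l (M e : R) : 0 <= M -> 0 <= e -> e <= 1 -> `|s| <= 3 * e ->
  (forall i, (i <= p)%N -> `|G i l 0| <= M) -> `|G 0%N l 0| <= e ->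
  `|pcurve p G s l 0| <= (1 + p%:R * (M * 3 ^+ p)) * e.
Proof.
move=> M0 e0 e1 hs hG hG0; rewrite pcurveE big_ord_recl expr0 mul1r mulrDl mul1r.
apply: (le_trans (ler_normD _ _)); apply: lerD => //.
rewrite -mulrA -[p in X in _ <= X]card_ord mulr_natl -sumr_const.
apply: (le_trans (ler_norm_sum _ _ _)); apply: ler_sum => i _.
rewrite normrM normrX mulrC -mulrA; apply: ler_pM; rewrite ?exprn_ge0//.
  by apply: hG; rewrite lift0.
rewrite lift0; apply: (@le_trans _ _ ((3 * e) ^+ i.+1)).
  by apply: lerXn2r; rewrite ?nnegrE// mulr_ge0.
rewrite exprMn; apply: ler_pM; rewrite ?exprn_ge0//.
  by rewrite card_ord; apply: ler_weXn2l => //; rewrite ler1n.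
by rewrite exprS ler_piMr// exprn_ile1.
Qed.

Lemma in_cusp_le p (c c' : R) (h h' : E) : 0 <= c -> c <= c' -> in_cusp p c h ->
  h ord_max 0 <= h' ord_max 0 -> (forall i, i != ord_max -> h' i 0 = h i 0) ->
  in_cusp p c' h'.
Proof.
move=> c0 cc [h0 hc] hl hE; split; first exact: le_trans hl.
under eq_bigr => i hi do rewrite hE//.
apply: (le_trans hc); apply: ler_pM; rewrite ?exprn_ge0//.
by apply: lerXn2r; rewrite ?nnegrE// (le_trans h0).
Qed.

Lemma in_cusp0 p (c : R) : 0 <= c -> in_cusp p c 0.
Proof.
move=> c0; split; first by rewrite mxE.
rewrite big1 => [|i _]; last by rewrite mxE expr0n.
by rewrite mxE mulr_ge0// exprn_ge0.
Qed.

(* Multiplying by a cut-off a alone could leave the cusp; the shift by b along the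
   axis compensates for it. *)
Definition blend (a b eta : R) (dlt g : E) : E :=
  \col_l (a * (dlt l 0 + g l 0) + b * ((l == ord_max)%:R * (2 * eta))).

(** With the full shift 2 eta, the last coordinate is at least eta however small the cut-off a is.
    The squared horizontal part is at most the sum of 2 D^2 and 2 g_i^2: the hypothesis on D bounds
    the first by c eta^p / 2, and membership of g in the cusp with constant c / 4 bounds the second
    by the same. *)
Lemma in_cusp_blend p (c a D eta : R) (dlt g : E) :
  in_cusp p (c / 4) g -> g ord_max 0 <= eta -> (forall l, `|dlt l 0| <= D) ->
  D <= eta -> 0 <= a <= 1 -> 4 * d.+1%:R * D ^+ 2 <= c * eta ^+ p -> 0 < c ->
  in_cusp p c (blend a 1 eta dlt g).
Proof.
move=> [g0 gc] ge hd De /andP[a0 a1] hD c0.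
have D0 : 0 <= D by apply: le_trans (hd ord_max).
have e0 : 0 <= eta by apply: le_trans D0 De.
have hl : eta <= blend a 1 eta dlt g ord_max 0.
  rewrite mxE eqxx !mul1r mulrDr.
  have h1 : - D <= a * dlt ord_max 0.
    have := hd ord_max; rewrite ler_norml => /andP[h1 h2].
    by apply: (@le_trans _ _ (a * - D)); [rewrite mulrN lerN2 ler_piMl|rewrite ler_wpM2l].
  have h2 : 0 <= a * g ord_max 0 by rewrite mulr_ge0.
  by lra.
split; first exact: le_trans hl.
apply: (@le_trans _ _ (c * eta ^+ p)); last first.
  by rewrite ler_pM2l//; apply: lerXn2r; rewrite ?nnegrE//; apply: le_trans hl.
apply: (@le_trans _ _ (\sum_(i < d.+1 | i != ord_max) (2 * D ^+ 2 + 2 * g i 0 ^+ 2))).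
  apply: ler_sum => i hi; rewrite mxE (negPf hi) mul0r mulr0 addr0.
  rewrite exprMn; apply: (@le_trans _ _ ((dlt i 0 + g i 0) ^+ 2)).
    by rewrite ler_piMl ?sqr_ge0// exprn_ile1.
  have : dlt i 0 ^+ 2 <= D ^+ 2.
    by rewrite -ler_sqrt ?sqr_ge0// !sqrtr_sqr (ger0_norm D0).
  have : 0 <= (dlt i 0 - g i 0) ^+ 2 by exact: sqr_ge0.
  by rewrite sqrrB sqrrD; lra.
rewrite big_split /= -big_distrr /= -[X in _ + X]mulr_sumr.
have h1 : \sum_(i < d.+1 | i != ord_max) D ^+ 2 <= d.+1%:R * D ^+ 2.
  rewrite sumr_const -[leLHS]mulr_natl ler_wpM2r ?sqr_ge0// ler_nat.
  by rewrite (leq_trans (max_card _))// card_ord.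
have h2 : g ord_max 0 ^+ p <= eta ^+ p by apply: lerXn2r; rewrite ?nnegrE.
have h3 : c / 4 * g ord_max 0 ^+ p <= c / 4 * eta ^+ p by rewrite ler_pM2l// divr_gt0.
move: h1 h3 gc hD; set S1 := \sum_(i < _ | _) D ^+ 2; set S2 := \sum_(i < _ | _) _.
set T1 := c * eta ^+ p; have -> : c / 4 * eta ^+ p = T1 / 4 by rewrite /T1; field.
rewrite -[4 * _ * _]mulrA; set U := _%:R * D ^+ 2; set V := c / 4 * _; lra.
Qed.

Lemma blend_le (a b eta D : R) (dlt g : E) :
  `|g ord_max 0| <= eta -> `|dlt ord_max 0| <= D -> D <= eta -> 0 <= a <= 1 ->
  0 <= b <= 1 -> blend a b eta dlt g ord_max 0 <= 4 * eta.
Proof.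
move=> hg hd De /andP[a0 a1] /andP[b0 b1].
have e0 : 0 <= eta by apply: le_trans hg.
rewrite mxE eqxx mul1r.
have h1 : a * (dlt ord_max 0 + g ord_max 0) <= 2 * eta.
  rewrite ler_norml in hg; rewrite ler_norml in hd; move/andP: hg => [? ?]; move/andP: hd => [? ?].
  have [h|h] := leP 0 (dlt ord_max 0 + g ord_max 0).
    apply: (@le_trans _ _ (dlt ord_max 0 + g ord_max 0)); first by rewrite ler_piMl.
    lra.
  apply: (@le_trans _ _ 0); last lra.
  by rewrite mulr_ge0_le0// ltW.
have h2 : b * (2 * eta) <= 2 * eta by rewrite ler_piMl// mulr_ge0.
lra.
Qed.

(** The reason for sizes 2^-(k^2): up to a constant depending on i they absorb every factor 2^(k
    i). *)
Lemma pow_sq_le (k i : nat) : 2 ^+ (k * i) <= 2 ^+ (i * i) * 2 ^+ (k * k) :> R.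
Proof.
rewrite -exprD; apply: ler_weXn2l; first by rewrite ler1n.
nia.
Qed.

(** The substitution v = 20 (u - 1) carries the support |v| <= 4 of the cut-offs to the radius 1/5
    required by [rapid]. *)
Lemma rapid_bump (Psi : R -> R) (a : nat -> R) (e0 C : R) : 0 <= e0 ->
  (forall n, diffn n Psi) -> (forall v, 4 < `|v| -> Psi v = 0) ->
  (forall k, `|a k| <= C * (e0 / 2 ^+ (k * k))) ->
  rapid (fun k u => Psi (20 * u - 20) * a k).
Proof.
move=> e00 dP P0 ha; apply: (@rapid_scale R (fun u => Psi (20 * u - 20))).
- by move=> n; apply: diffn_affine.
- move=> u hu; apply: P0; have -> : 20 * u - 20 = 20 * (u - 1) by ring.
  by rewrite normrM ger0_norm//; lra.
move=> i; exists (C * e0 * 2 ^+ (i * i)) => k.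
have k0 : 0 < 2 ^+ (k * k) :> R by rewrite exprn_gt0.
have C0 : 0 <= C * (e0 / 2 ^+ (k * k)) by apply: le_trans (ha k).
apply: (@le_trans _ _ (C * (e0 / 2 ^+ (k * k)) * (2 ^+ (i * i) * 2 ^+ (k * k)))).
  by apply: ler_pM => //; exact: pow_sq_le.
rewrite le_eqVlt; apply/orP; left; apply/eqP; field.
by rewrite gt_eqF.
Qed.

Lemma coord_le m (x : 'cV[R]_m) i : `|x i 0| <= `|x|.
Proof.
rewrite -[`|x|]/(mx_norm x) mx_normE.
apply: (@le_trans _ _ (`|x (i, ord0).1 (i, ord0).2|%:nng%:num)) => //.
by rewrite num_le; apply: (le_bigmax _ (fun i => `|x i.1 i.2|%:nng)).
Qed.

Variables (X : set E) (p : nat) (c e B M : R) (x0 : E) (A : 'M[R]_d.+1).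
Hypotheses (p_gt0 : (0 < p)%N) (c0 : 0 < c) (e_gt0 : 0 < e) (B0 : 0 < B) (M0 : 0 <= M).
Hypotheses (AAT : A *m A^T = 1%:M) (Xx0 : X x0) (XC : cusp_at X p c e B x0 A).

Let KA : R := \sum_i \sum_j `|A i j|.
Let M' : R := 1 + p%:R * (M * 3 ^+ p).
(** In [scale], the bound 1/20 keeps the time scale 20 2^k [es k] at most 1, the bound e keeps the
    base points in the ball where the cusp is available, and the last bound keeps the height 4 M'
    [es k] of the shifted curve below B. In [margin], division by KA + 1 pays for passing to the
    coordinates of A, and c / (4 (d + 1)) is what [in_cusp_blend] asks for. *)
Let scale : R := Num.min (1 / 20) (Num.min e (B / (4 * M'))).
Let margin : R := Num.min 1 (c / (4 * d.+1%:R)) / (KA + 1).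
Let es (k : nat) : R := scale / 2 ^+ (k * k).

Let KA0 : 0 <= KA. Proof. by rewrite sumr_ge0// => i _; rewrite sumr_ge0. Qed.
Let M'1 : 1 <= M'. Proof. by rewrite lerDl mulr_ge0// mulr_ge0// exprn_ge0. Qed.
Let M'0 : 0 < M'. Proof. exact: lt_le_trans M'1. Qed.
Let scale0 : 0 < scale.
Proof. by rewrite !lt_min divr_gt0//= e_gt0 /= divr_gt0// mulr_gt0. Qed.
Let margin0 : 0 < margin.
Proof. by rewrite divr_gt0 ?ltr_wpDl// lt_min ltr01 divr_gt0// mulr_gt0. Qed.
Let es0 k : 0 < es k. Proof. by rewrite divr_gt0// exprn_gt0. Qed.
Let es_scale k : es k <= scale.
Proof. by rewrite ler_pdivrMr ?exprn_gt0// ler_peMr ?(ltW scale0)// exprn_ege1// ler1n. Qed.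
Let scale20 : scale <= 1 / 20. Proof. by rewrite ge_min lexx. Qed.
Let es1 k : es k <= 1. Proof. have := es_scale k; move: scale20; lra. Qed.
Let margin1 : margin <= 1.
Proof.
rewrite ler_pdivrMr ?ltr_wpDl// mul1r; apply: (@le_trans _ _ 1); last by rewrite lerDr.
by rewrite ge_min lexx.
Qed.
Let esp k : margin * es k ^+ p <= es k.
Proof.
apply: (@le_trans _ _ (es k ^+ p)); first by rewrite ler_piMl ?exprn_ge0// ?(ltW (es0 k)).
by rewrite -[leRHS]expr1; apply: ler_wiXn2l => //; rewrite ltW.
Qed.

(** Near time 2^-k put v = 20 (2^k t - 1). For |v| <= 1 the curve runs through the k-th prescribed
    piece; for 1 <= |v| <= 2 it is pushed up along the axis of the cusp at y k; for 2 <= |v| <= 3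
    piece and base point are faded out to x0 under the full shift; for 3 <= |v| <= 4 the shift is
    withdrawn along the axis at x0. Elsewhere the curve rests at x0. *)
Lemma glued_curve : exists e0 c2 : R, [/\ 0 < e0, e0 <= 1 / 20, 0 < c2, c2 <= 1 &
  forall (y : nat -> E) (G : nat -> nat -> E),
  (forall k, X (y k)) ->
  (forall k, `|y k - x0| <= c2 * (e0 / 2 ^+ (k * k)) ^+ p) ->
  (forall k i l, (i <= p)%N -> `|G k i l 0| <= M) ->
  (forall k l, `|G k 0%N l 0| <= c2 * (e0 / 2 ^+ (k * k)) ^+ p) ->
  (forall k s, in_cusp p (c / 4) (pcurve p (G k) s)) ->
  exists2 cv, smooth_curves X cv & forall k s, `|s| <= e0 / 2 ^+ (k * k) ->
    cv (2 ^- k + s / (20 * 2 ^+ k * (e0 / 2 ^+ (k * k)))) = y k + A *m pcurve p (G k) s].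
Proof.
exists scale, margin; split => // y G Xy hy hG hG0 hc.
pose dl k := A^T *m (y k - x0).
have hdl k l : `|dl k l 0| <= KA * (margin * es k ^+ p).
  rewrite mxE; apply: (le_trans (ler_norm_sum _ _ _)); rewrite mulr_suml.
  apply: (@le_trans _ _ (\sum_j `|A j l| * (margin * es k ^+ p))).
    apply: ler_sum => j _; rewrite mxE normrM ler_wpM2l//.
    by apply: le_trans (hy k); exact: coord_le.
  have h0 : 0 <= margin * es k ^+ p by rewrite mulr_ge0 ?exprn_ge0 ?(ltW margin0) ?(ltW (es0 k)).
  apply: ler_sum => j _; rewrite ler_wpM2r//.
  by rewrite (bigD1 l)//= lerDl sumr_ge0.
pose eta k := M' * es k.
pose D k := KA * (margin * es k ^+ p).
have Km : KA * margin <= Num.min 1 (c / (4 * d.+1%:R)).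
  rewrite /margin mulrCA ler_piMr//; first by rewrite le_min ler01 ltW// divr_gt0// mulr_gt0.
  by rewrite ler_pdivrMr ?ltr_wpDl// mul1r lerDl.
have /andP[Km1 Kmc] : (KA * margin <= 1) && (KA * margin <= c / (4 * d.+1%:R)) by rewrite -le_min.
have es0' k : 0 <= es k := ltW (es0 k).
have ep k : es k ^+ p <= es k by rewrite -[leRHS]expr1; apply: ler_wiXn2l.
have De' k : D k <= es k.
  by rewrite /D mulrA (le_trans _ (ep k))// ler_piMl ?exprn_ge0// ltW.
have De k : D k <= eta k.
  by apply: (le_trans (De' k)); rewrite ler_peMl// ltW.
have D0 k : 0 <= D k by apply: le_trans (hdl k ord_max).
have eta0 k : 0 <= eta k by rewrite mulr_ge0// ltW.
have hD k : 4 * d.+1%:R * D k ^+ 2 <= c * eta k ^+ p.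
  have h1 : D k ^+ 2 <= c / (4 * d.+1%:R) * es k ^+ p.
    rewrite expr2; apply: (@le_trans _ _ (D k * 1)).
      by rewrite ler_wpM2l ?D0// (le_trans (De' k)).
    by rewrite mulr1 /D mulrA ler_wpM2r// exprn_ge0.
  have h2 : es k ^+ p <= eta k ^+ p.
    by apply: lerXn2r; rewrite ?nnegrE ?eta0// /eta ler_peMl.
  have h3 : 0 < 4 * d.+1%:R :> R by rewrite mulr_gt0.
  apply: (@le_trans _ _ (c * es k ^+ p)); last by rewrite ler_pM2l.
  by rewrite mulrC -ler_pdivlMr// mulrAC.
have etaB k : 4 * eta k <= B.
  have : es k <= B / (4 * M').
    by apply: (le_trans (es_scale k)); rewrite /scale !ge_min lexx !orbT.
  rewrite ler_pdivlMr ?mulr_gt0// /eta; lra.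
pose g k (v : R) := pcurve p (G k) (es k * v).
have hg k (v : R) l : `|v| <= 3 -> `|g k v l 0| <= eta k.
  move=> hv; apply: pcurve_le => //; rewrite ?(ltW (es0 k))//.
  - by rewrite normrM gtr0_norm// mulrC ler_pM2r.
  - by move=> i; exact: hG.
  - by apply: le_trans (hG0 k l) _; exact: esp.
pose wl l k (u : R) : R := blend (plateau (20 * u - 20)) (annulus (20 * u - 20)) (eta k) (dl k) (g k (20 * u - 20)) l 0.
have rw l : rapid (wl l).
  (* Each coordinate is a finite sum of fixed profiles, [plateau] v times v^i and [annulus] v, with
     amplitudes O([es k]): a positive power of s brings a factor [es k], and the constant term and
     the base point displacement are small by hypothesis. *)
  pose a (i : 'I_p.+1) k := es k ^+ i * G k i l 0 + (i == ord0)%:R * dl k l 0.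
  pose b k := (l == ord_max)%:R * (2 * eta k).
  have -> : wl l = fun k u => \sum_(i < p.+1) (plateau (20 * u - 20) * (20 * u - 20) ^+ i) * a i k +
               annulus (20 * u - 20) * b k.
    apply/funext => k; apply/funext => u; rewrite /wl mxE; congr (_ + _).
    under [RHS]eq_bigr do rewrite -mulrA.
    rewrite -mulr_sumr; congr (_ * _).
    under [RHS]eq_bigr do rewrite mulrDr.
    rewrite big_split /= addrC; congr (_ + _).
      rewrite (bigD1 ord0)//= expr0 !mul1r big1 ?addr0// => i /negPf ->.
      by rewrite mul0r mulr0.
    by rewrite pcurveE; apply: eq_bigr => i _; rewrite exprMn; ring.
  apply: rapidD.
    apply: rapid_sum => i; apply: (@rapid_bump (fun v => plateau v * v ^+ i) (a i) scale (M + 1 + 1)).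
    - exact: ltW.
    - by move=> n; apply: diffnM; [exact: (diffn_bump n 3)|apply: diffnX; exact: diffn_id].
    - by move=> v hv; rewrite /plateau bump0 ?mul0r//; lra.
    move=> k; rewrite -/(es k) mulrDl mul1r; apply: (le_trans (ler_normD _ _)); apply: lerD.
      rewrite normrM normrX gtr0_norm// mulrC.
      have [i0|i0] := eqVneq i ord0.
        rewrite i0 expr0 mulr1; apply: le_trans (hG0 k l) _.
        by apply: (le_trans (esp k)); rewrite ler_peMl// lerDr.
      apply: ler_pM; rewrite ?exprn_ge0//.
        by apply: (le_trans (hG k i l _)); [rewrite -ltnS|rewrite lerDl].
      rewrite -[leRHS]expr1; apply: ler_wiXn2l => //.
      by rewrite lt0n; apply: contra i0 => /eqP i0; apply/eqP/val_inj.
    rewrite normrM; apply: (@le_trans _ _ `|dl k l 0|).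
      by rewrite ler_piMl//; case: eqP => _; rewrite ?normr0 ?normr1.
    exact: le_trans (hdl k l) (De' k).
  apply: (@rapid_bump annulus b scale (2 * M')).
  - exact: ltW.
  - by move=> n; exact: diffn_annulus.
  - by move=> v hv; rewrite annulus_out//; lra.
  move=> k; rewrite -/(es k) /b normrM -mulrA -/(eta k).
  have e2 : 0 <= 2 * eta k by rewrite mulr_ge0.
  rewrite (ger0_norm e2) ler_piMl//.
  by case: eqP => _; rewrite ?normr0 ?normr1.
pose cv t := x0 + A *m \col_l dyadic (wl l) t.
have cvE k t : `|2 ^+ k * t - 1| < 1 / 4 -> let v := 20 * (2 ^+ k * t) - 20 in
    cv t = x0 + A *m blend (plateau v) (annulus v) (eta k) (dl k) (g k v).
  move=> ht v; congr (_ + _ *m _); apply/matrixP => i j; rewrite ord1 mxE (dyadicE _ ht).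
  by [].
have cv0 t : (forall k, 1 / 4 <= `|2 ^+ k * t - 1|) -> cv t = x0.
  move=> ht; rewrite /cv; have -> : \col_l dyadic (wl l) t = 0.
    by apply/matrixP => i j; rewrite ord1 !mxE dyadic0.
  by rewrite mulmx0 addr0.
have Ady k : A *m dl k = y k - x0 by rewrite mulmxA AAT mul1mx.
have cve k : 0 <= e /\ `|y k - x0| <= e.
  split; first exact: ltW.
  apply: (le_trans (hy k)); apply: (le_trans (esp k)); apply: (le_trans (es_scale k)).
  by rewrite /scale !ge_min lexx !orbT.
have cvX t : X (cv t).
  have [[k hk]|H] := pselect (exists k, `|2 ^+ k * t - 1| < 1/4); last first.
    by rewrite cv0// => k; rewrite leNgt; apply/negP => hk; apply: H; exists k.
  rewrite (cvE k t hk); set v := 20 * _ - 20.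
  have [v2|v2] := leP `|v| 2.
    (* The piece is uncut here, so the cusp at y k applies: h differs from a point of the thinner
       cusp only by a move up the axis. *)
    rewrite (plateau1 v2); pose h := g k v + (annulus v * (2 * eta k)) *: delta_mx ord_max 0.
    have -> : x0 + A *m blend 1 (annulus v) (eta k) (dl k) (g k v) = y k + A *m h.
      have -> : blend 1 (annulus v) (eta k) (dl k) (g k v) = dl k + h.
        apply/matrixP => i j; rewrite ord1 !mxE mul1r eqxx andbT -addrA; congr (_ + (_ + _)).
        by rewrite [in RHS]mulrC; ring.
      by rewrite mulmxDr Ady addrA addrCA subrr addr0.
    have [_ ye] := cve k.
    have hh : h ord_max 0 = g k v ord_max 0 + annulus v * (2 * eta k).
      by rewrite !mxE !eqxx mulr1.
    have a0 : 0 <= annulus v * (2 * eta k) by rewrite mulr_ge0 ?annulus_ge0// mulr_ge0.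
    apply: XC => //.
    - apply: (@in_cusp_le p (c / 4) c (g k v)) => //.
      + by rewrite divr_ge0// ltW.
      + by move: c0; lra.
      + exact: hc.
      + by rewrite hh lerDl.
      + by move=> i /negPf hi; rewrite !mxE hi /= !mulr0 addr0.
    apply: le_trans (etaB k).
    have h1 : g k v ord_max 0 <= eta k.
      by apply: (le_trans (ler_norm _)); apply: hg; apply: (le_trans v2); rewrite ler_nat.
    have h2 : annulus v * (2 * eta k) <= 2 * eta k by rewrite ler_piMl ?annulus_le1// mulr_ge0.
    by rewrite hh; have := eta0 k; lra.
  have [v3|v3] := leP `|v| 3.
    rewrite (annulus1 (ltW v2) v3).
    (* From here on the point is viewed from x0, and y k - x0 becomes part of the displacement
       inside the cusp at x0. *)
    have g0 : 0 <= g k v ord_max 0 by have [] := hc k (es k * v).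
    have gle : `|g k v ord_max 0| <= eta k by exact: hg.
    have pl : 0 <= plateau v <= 1 by rewrite /plateau bump_ge0 bump_le1.
    apply: XC; rewrite ?subrr ?normr0 ?(ltW e_gt0)//.
      apply: (in_cusp_blend (D := D k)) => //; first exact: hc.
      by rewrite -(ger0_norm g0).
    by apply: le_trans (etaB k); apply: (blend_le (D := D k)); rewrite ?ler01 ?lexx.
  have -> : plateau v = 0 by rewrite /plateau bump0// ltW.
  apply: XC; rewrite ?subrr ?normr0 ?(ltW e_gt0)//.
    have -> : blend 0 (annulus v) (eta k) (dl k) (g k v) = (annulus v * (2 * eta k)) *: delta_mx ord_max 0.
      by apply/matrixP => i j; rewrite ord1 !mxE eqxx andbT mul0r add0r; ring.
    apply: (@in_cusp_le p 0 c 0) => //; first exact: ltW.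
    - exact: in_cusp0.
    - by rewrite !mxE !eqxx mulr1 mulr_ge0 ?annulus_ge0// mulr_ge0.
    - by move=> i /negPf hi; rewrite !mxE hi /= mulr0.
  rewrite mxE eqxx mul1r mul0r add0r; apply: le_trans (etaB k).
  have h2 : annulus v * (2 * eta k) <= 2 * eta k by rewrite ler_piMl ?annulus_le1// mulr_ge0.
  by have := eta0 k; lra.
exists cv.
  split => //; apply: smooth_col => i n.
  have -> : (fun t => cv t i 0) = fun t => x0 i 0 + \sum_l A i l * dyadic (wl l) t.
    by apply/funext => t; rewrite !mxE; congr (_ + _); apply: eq_bigr => l _; rewrite mxE.
  apply: diffnD; first exact: diffn_cst.
  apply: diffn_sum => l; apply: diffnM; first exact: diffn_cst.
  exact: diffn_dyadic.
move=> k s; rewrite -/(es k) => hs.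
have k0 : 2 ^+ k != 0 :> R by rewrite gt_eqF// exprn_gt0.
have ek0 : es k != 0 by rewrite gt_eqF.
set t := 2 ^- k + _.
have tE : 2 ^+ k * t - 1 = s / es k / 20 by rewrite /t; field; rewrite k0 ek0.
have u1 : `|s / es k| <= 1 by rewrite normrM normfV (gtr0_norm (es0 k)) ler_pdivrMr// mul1r.
have ht : `|2 ^+ k * t - 1| < 1 / 4.
  rewrite tE normrM normfV [`|20|]ger0_norm//; move: u1; set q := `|_|; lra.
rewrite (cvE k t ht).
have -> : 20 * (2 ^+ k * t) - 20 = s / es k.
  have -> : 20 * (2 ^+ k * t) - 20 = 20 * (2 ^+ k * t - 1) by ring.
  by rewrite tE mulrC divfK.
rewrite plateau1; last by lra.
rewrite annulus0//.
have -> : blend 1 0 (eta k) (dl k) (g k (s / es k)) = dl k + pcurve p (G k) s.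
  apply/matrixP => i j; rewrite ord1 !mxE mul1r mul0r addr0; congr (_ + _).
  by rewrite /g mulrC divfK.
by rewrite mulmxDr Ady addrA addrCA subrr addr0.
Qed.

End GluedCurve.

(** * Taylor expansions uniform over curves in the cusp *)

Section UniformTaylor.
Context {R : realType} {d : nat}.
Local Notation E := 'cV[R]_d.+1.

Lemma continuous_bounded_itv (g : R -> R) (a b : R) : a <= b -> continuous g ->
  exists C, forall t, a <= t -> t <= b -> `|g t| <= C.
Proof.
move=> ab cg.
have cg' : {within `[a, b]%classic, continuous (fun u => `|g u|)}.
  apply: continuous_subspaceT => t; apply: (@continuous_comp _ _ _ g); first exact: cg.
  exact: norm_continuous.
have [c _ Hc] := EVT_max ab cg'.
by exists `|g c| => t ta tb; apply: Hc; rewrite in_itv /= ta.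
Qed.

Lemma Ckw_line_taylor (m : nat) (w : R -> R) (F : R -> R) (a b : R) :
  modulus w -> Ckw_line m w F -> a <= b -> exists2 C, 0 <= C &
    (forall t i, a <= t -> t <= b -> `|(taylor m F t)`_i| <= C) /\
    forall t s, a <= t -> t <= b -> a <= t - `|s| -> t + `|s| <= b ->
      `|F (t + s) - (taylor m F t).[s]| <= C * (`|s| ^+ m * w `|s|).
Proof.
move=> wm [dF cF hF] ab.
have /hF[C1 C10 HC1] := @segment_compact R a b.
have cF' i : (i <= m)%N -> continuous (derive1n i F).
  rewrite leq_eqVlt => /orP[/eqP->//|im] t.
  by apply/differentiable_continuous/derivable1_diffP/dF.
have [B HB] : exists B, forall i t, (i <= m)%N -> a <= t -> t <= b -> `|derive1n i F t| <= B.
  elim: {-2}m (leqnn m) => [|k IH] km.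
    by have [B HB] := continuous_bounded_itv ab (cF' 0%N isT); exists B => i t; rewrite leqn0 => /eqP ->; apply: HB.
  have [B1 HB1] := IH (ltnW km); have [B2 HB2] := continuous_bounded_itv ab (cF' _ km).
  exists (Num.max B1 B2) => i t; rewrite leq_eqVlt => /orP[/eqP->|ik] ta tb.
    by rewrite le_max HB2// orbT.
  by rewrite le_max HB1.
have B0 : 0 <= B by apply: le_trans (HB 0%N a _ _ ab).
exists (B + C1); first by rewrite addr_ge0// ltW.
split=> [t i ta tb|t s ta tb sa sb].
  rewrite coef_poly; case: ifP => [im|_]; last by rewrite normr0 addr_ge0// ltW.
  rewrite normrM; apply: (@le_trans _ _ `|derive1n i F t|).
    rewrite ler_piMr// normfV normr_nat invf_le1 ?ltr0n ?fact_gt0//.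
    by rewrite ler1n fact_gt0.
  by apply: (le_trans (HB i t im ta tb)); rewrite lerDl ltW.
have C1' : 0 <= C1 by exact: ltW.
have : `|F (t + s) - (taylor m F t).[s]| <= C1 * (`|s| ^+ m * w `|s|).
  apply: (@taylor_le _ w m F t `|s|) => // r hr.
  have -> : `|r| = `|t + r - t| by rewrite addrAC subrr add0r.
  apply: HC1; rewrite /= in_itv /=; last by rewrite ta.
  move: hr; rewrite ler_norml => /andP[h1 h2].
  by apply/andP; split; lra.
move/le_trans; apply; rewrite ler_wpM2r ?lerDr//.
by rewrite mulr_ge0 ?exprn_ge0// (modulus_ge0 wm).
Qed.

Lemma uniform_taylor (X Y : set E) (m p : nat) (w : R -> R) (f : E -> R)
    (c e B M : R) (x0 : E) (A : 'M[R]_d.+1) :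
  (0 < p)%N -> 0 < c -> 0 < e -> 0 < B -> 0 <= M -> A *m A^T = 1%:M -> X x0 ->
  cusp_at X p c e B x0 A -> modulus w -> Akw_flat m w X Y f ->
  exists T C : R, [/\ 0 < T, 0 < C &
    forall (y : E) (G : nat -> E), X y -> `|y - x0| <= T ->
      (forall i l, (i <= p)%N -> `|G i l 0| <= M) -> (forall l, `|G 0%N l 0| <= T) ->
      (forall s, in_cusp p (c / 4) (pcurve p G s)) ->
      exists P : {poly R}, [/\ (size P <= m.+1)%N, forall i, `|P`_i| <= C,
        forall s, `|s| <= T ->
          `|f (y + A *m pcurve p G s) - P.[s]| <= C * (`|s| ^+ m * w `|s|) &
        Y (y + A *m G 0%N) -> P = 0]].
Proof.
move=> p0 c0 e_gt0 B0 M0 AAT Xx0 XC wm [fA fY].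
have [e0 [c2 [e00 e020 c20 c21 Hgl]]] := glued_curve p0 c0 e_gt0 B0 M0 AAT Xx0 XC.
apply: contrapT => bad.
pose es k := e0 / 2 ^+ (k * k).
pose rho k := 20 * 2 ^+ k * es k.
pose T k := c2 * es k ^+ p.
(* Rescaling time by [rho k] multiplies the i-th coefficient by [rho k] to the power -i with i <= m;
   one more power and the factor 2 come from w(s / rho) <= (1 / rho + 1) w(s) <= (2 / rho) w(s). The
   factor k + 1 will exceed the constant of the single glued curve. *)
pose C k := (2 * k.+1%:R) * (rho k) ^- m.+1.
have es0 k : 0 < es k by rewrite divr_gt0// exprn_gt0.
have rho0 k : 0 < rho k by rewrite !mulr_gt0// exprn_gt0.
have rho1 k : rho k <= 1.
  rewrite /rho /es mulrA -(mulrA 20) (mulrC _ e0) !mulrA.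
  rewrite ler_pdivrMr ?exprn_gt0// mul1r.
  apply: (@le_trans _ _ (1 * 2 ^+ k)); first by rewrite ler_pM2r ?exprn_gt0//; lra.
  rewrite mul1r; apply: ler_weXn2l; first by rewrite ler1n.
  nia.
have T0 k : 0 < T k by rewrite mulr_gt0// exprn_gt0.
have C0 k : 0 < C k by rewrite mulr_gt0 ?invr_gt0 ?exprn_gt0// mulr_gt0.
pose good k (y : E) (G : nat -> E) := [/\ X y, `|y - x0| <= T k, (forall i l, (i <= p)%N -> `|G i l 0| <= M),
  (forall l, `|G 0%N l 0| <= T k) & forall s, in_cusp p (c / 4) (pcurve p G s)].
pose concl k (y : E) (G : nat -> E) := exists P : {poly R}, [/\ (size P <= m.+1)%N, forall i, `|P`_i| <= C k,
        forall s, `|s| <= T k ->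
          `|f (y + A *m pcurve p G s) - P.[s]| <= C k * (`|s| ^+ m * w `|s|) &
        Y (y + A *m G 0%N) -> P = 0].
have /choice[yG HyG] : forall k, exists yG, good k yG.1 yG.2 /\ ~ concl k yG.1 yG.2.
  move=> k; apply: contrapT => H; apply: bad; exists (T k), (C k); split => // y G h1 h2 h3 h4 h5.
  by apply: contrapT => H'; apply: H; exists (y, G).
have [|||||cv [scv Xcv] cvE] := Hgl (fun k => (yG k).1) (fun k => (yG k).2).
- by move=> k; have [[]] := HyG k.
- by move=> k; have [[]] := HyG k.
- by move=> k i l ip; have [[_ _ H _ _] _] := HyG k; exact: H.
- by move=> k l; have [[_ _ _ H _] _] := HyG k; exact: H.
- by move=> k s; have [[_ _ _ _ H] _] := HyG k; exact: H.
pose F := f \o cv.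
have FC : Ckw_line m w F by apply: fA.
(* The interval [-1, 2] contains the unit neighbourhoods of all times 2^-k, so one constant C1
   serves all pieces. *)
have [C1 C10 [HC1 HF]] := @Ckw_line_taylor m w F (-1) 2 wm FC ltac:(lra).
(* At an index with C1 <= k + 1 the Taylor polynomial of the glued curve, rescaled, satisfies
   exactly the bounds that the k-th piece was chosen to violate. *)
pose k := (Num.truncn C1).
have kC : C1 <= k.+1%:R by rewrite ltW// truncnS_gt.
have [_ []] := HyG k.
pose b : R := 2 ^- k.
have b0 : 0 < b by rewrite invr_gt0 exprn_gt0.
have b1 : b <= 1 by rewrite invf_le1 ?exprn_gt0// exprn_ege1// ler1n.
pose P := \poly_(i < m.+1) ((taylor m F b)`_i / rho k ^+ i).
have PE s : P.[s] = (taylor m F b).[s / rho k].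
  rewrite horner_poly (horner_coef_wide _ (size_poly _ _)).
  by apply: eq_bigr => i _; rewrite [(s / _) ^+ i]exprMn exprVn mulrAC mulrA.
have rm0 i : 0 < rho k ^+ i by rewrite exprn_gt0.
exists P; split.
- exact: size_poly.
- move=> i; rewrite coef_poly; case: ifP => [im|_]; last by rewrite normr0 ltW.
  rewrite normrM normfV (gtr0_norm (rm0 _)) ler_pdivrMr// /C.
  apply: (@le_trans _ _ k.+1%:R).
    by apply: le_trans kC; apply: HC1; clear -b0 b1; lra.
  rewrite mulrAC ler_pdivlMr//; apply: ler_pM => //; first by rewrite ltW.
    by rewrite ler_peMl// ler1n.
  by apply: ler_wiXn2l => //; [rewrite ltW|rewrite ltnW].
- move=> s hs; rewrite PE.
  have hs' : `|s| <= es k.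
    apply: (le_trans hs); rewrite /T; apply: (@le_trans _ _ (es k ^+ p)).
      by rewrite ler_piMl ?exprn_ge0// ltW.
    rewrite -[leRHS]expr1; apply: ler_wiXn2l => //; first exact: ltW.
    rewrite /es ler_pdivrMr ?exprn_gt0// mul1r; apply: (@le_trans _ _ 1); first lra.
    by rewrite exprn_ege1// ler1n.
  rewrite -(cvE k s hs') -/(es k) -/(rho k) -/b -[f _]/(F _).
  have sr : `|s / rho k| <= 1.
    rewrite normrM normfV (gtr0_norm (rho0 _)) ler_pdivrMr// mul1r (le_trans hs')//.
    rewrite /rho ler_peMl ?(ltW (es0 k))//.
    have : 1 <= 2 ^+ k :> R by rewrite exprn_ege1// ler1n.
    lra.
  have := HF b (s / rho k); set q := s / rho k => H.
  have {}H : `|F (b + q) - (taylor m F b).[q]| <= C1 * (`|q| ^+ m * w `|q|).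
    have [h1 h2] : -1 <= b - `|q| /\ b + `|q| <= 2.
      by clear -sr b0 b1; rewrite -/q in sr; split; lra.
    by apply: H => //; clear -b0 b1; lra.
  apply: (le_trans H); rewrite /q normrM normfV (gtr0_norm (rho0 k)).
  have ir1 : 1 <= (rho k)^-1 by rewrite invf_ge1.
  have wq : w (`|s| / rho k) <= 2 * (rho k)^-1 * w `|s|.
    rewrite mulrC; apply: (le_trans (modulus_scale wm _ _)) => //; first by rewrite invr_ge0 ltW.
    by rewrite ler_wpM2r ?(modulus_ge0 wm)//; clear -ir1; lra.
  rewrite [(`|s| / _) ^+ m]exprMn exprVn.
  apply: (@le_trans _ _ (k.+1%:R * (`|s| ^+ m / rho k ^+ m * (2 * (rho k)^-1 * w `|s|)))).
    apply: ler_pM => //.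
      apply: mulr_ge0; last by rewrite (modulus_ge0 wm)// divr_ge0// ltW.
      by rewrite divr_ge0 ?exprn_ge0// ltW.
    by rewrite ler_wpM2l// divr_ge0 ?exprn_ge0// ltW.
  rewrite le_eqVlt; apply/orP; left; apply/eqP.
  rewrite /C exprS; field; by rewrite !gt_eqF.
- move=> YG; apply/polyP => i; rewrite coef_poly coef0.
  case: ifP => // im; rewrite coef_poly im.
  suff -> : derive1n i F b = 0 by rewrite mul0r mul0r.
  (* Flatness is only assumed at parameter 0, so the curve is translated to start at time 2^-k. *)
  have sc : smooth_curves X (fun t => cv (t + b)).
    by split=> [|t]; [exact: smooth_shift scv|exact: Xcv].
  have Y0 : Y (cv (0 + b)).
    have := cvE k 0; rewrite normr0 mul0r addr0 add0r => -> //; last exact: ltW (es0 k).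
    suff -> : pcurve p (yG k).2 0 = (yG k).2 0%N by [].
    rewrite /pcurve big_ord_recl expr0 scale1r big1 ?addr0// => j _.
    by rewrite lift0 expr0n scale0r.
  have := fY _ sc Y0 i im; rewrite -[X in derive1n i X]/(fun t => F (t + b)) derive1n_shift.
  by rewrite add0r.
Qed.

End UniformTaylor.

(** * Interpolation *)

Section Interpolation.
Context {R : realType}.
Implicit Types (S : set R) (x : nat -> R).

Definition lagr (N : nat) x (k : 'I_N.+1) : {poly R} := (lagrange N.+1 x)`_k.

Lemma lagr_sample N x (k l : 'I_N.+1) : injective x -> (lagr x k).[x l] = (k == l)%:R.
Proof. by move=> xi; rewrite /lagr nth_lagrange lagrange_sample. Qed.

Lemma size_lagr N x (k : 'I_N.+1) : injective x -> (size (lagr x k) <= N.+1)%N.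
Proof. by move=> xi; rewrite /lagr nth_lagrange size_lagrange_. Qed.

Lemma lagr_gen N x (P : {poly R}) : injective x -> (size P <= N.+1)%N ->
  P = \sum_(k < N.+1) P.[x k] *: lagr x k.
Proof.
move=> xi sP; rewrite {1}(lagrange_gen (isT : 0 < N.+1)%N xi sP).
by apply: eq_bigr => k _; rewrite mul_polyC /lagr nth_lagrange.
Qed.

Definition poly_on N S (phi : R -> R) :=
  exists2 P : {poly R}, (size P <= N.+1)%N & forall r, S r -> phi r = P.[r].

Lemma poly_on_le N N' S phi : (N <= N')%N -> poly_on N S phi -> poly_on N' S phi.
Proof. by move=> NN' [P sP HP]; exists P => //; apply: leq_trans sP _. Qed.

(** The approximating polynomial Pi may depend on t. Interpolation at the nodes reproduces Pi, so at
    each r the sum of the phi i r t^i differs from its interpolant in r by O(t^m w(t)). This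
    difference is a polynomial in t of degree at most m, hence zero. *)
Lemma poly_on_limit (w : R -> R) (m N : nat) S x (phi : nat -> R -> R) (C T : R) :
  modulus w -> injective x -> (forall k, (k <= N)%N -> S (x k)) -> 0 < T -> 0 <= C ->
  (forall t, 0 < t -> t < T -> exists2 Pi : {poly R}, (size Pi <= N.+1)%N &
     forall r, S r -> `|\sum_(i < m.+1) phi i r * t ^+ i - Pi.[r]| <= C * (t ^+ m * w t)) ->
  forall i, (i <= m)%N -> poly_on N S (phi i).
Proof.
move=> wm xi Sx T0 C0 H i im.
pose P i := \sum_(k < N.+1) phi i (x k) *: lagr x k.
exists (P i).
  apply: (big_ind (fun Q : {poly R} => (size Q <= N.+1)%N)); first by rewrite size_poly0.
    by move=> p q hp hq; apply: (leq_trans (size_polyD _ _)); rewrite geq_max hp.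
  by move=> k _; apply: (leq_trans (size_scale_leq _ _)); exact: size_lagr.
move=> r Sr.
pose E := \poly_(j < m.+1) (phi j r - (P j).[r]).
suff E0 : E = 0.
  by have := coef_poly m.+1 (fun j => phi j r - (P j).[r]) i; rewrite -/E E0 coef0 ltnS im => /esym/subr0_eq.
(* One plus the Lebesgue function of the nodes at r: the factor lost by interpolating the error. *)
pose La := 1 + \sum_(k < N.+1) `|(lagr x k).[r]|.
apply: (@poly_vanish _ w wm m E (C * La) T) => //; first exact: size_poly.
move=> t t0 tT; have [Pi sPi HPi] := H t t0 tT.
have -> : E.[t] = (\sum_(i < m.+1) phi i r * t ^+ i - Pi.[r]) -
    \sum_(k < N.+1) (\sum_(i < m.+1) phi i (x k) * t ^+ i - Pi.[x k]) * (lagr x k).[r].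
  rewrite horner_poly; under eq_bigr do rewrite mulrBl.
  rewrite sumrB -addrA; congr (_ + _).
  rewrite {1}(lagr_gen xi sPi) horner_sum -opprD; congr (- _).
  under [X in _ + X]eq_bigr do rewrite mulrBl.
  rewrite sumrB addrC; under [X in _ - X + _]eq_bigr do rewrite -hornerZ.
  rewrite subrK; under [RHS]eq_bigr do rewrite mulr_suml.
  rewrite exchange_big /=; apply: eq_bigr => j _.
  rewrite /P horner_sum mulr_suml; apply: eq_bigr => k _.
  by rewrite hornerZ mulrAC.
apply: (le_trans (ler_normB _ _)); rewrite /La mulrDr mulr1 mulrDl.
apply: lerD; first exact: HPi.
apply: (le_trans (ler_norm_sum _ _ _)); rewrite mulrAC mulr_sumr.
apply: ler_sum => k _; rewrite normrM ler_wpM2r//.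
by apply: HPi; apply: Sx; rewrite -ltnS.
Qed.

Lemma even_poly_on (m : nat) (r0 : R) (phi : R -> R) : 0 <= r0 ->
  poly_on m [set r | `|r| <= r0] (fun r => phi (r ^+ 2)) ->
  poly_on m [set b | 0 <= b /\ b <= r0 ^+ 2] phi.
Proof.
move=> r00 [P sP HP]; exists (even_poly P).
  apply: (leq_trans (size_even_poly _)); apply: leq_trans sP.
  by rewrite leq_uphalf_double -addnn leq_addr.
move=> b /= [b0 bR].
have rb : Num.sqrt b <= r0 by rewrite -(ger0_norm r00) -sqrtr_sqr ler_wsqrtr.
have sb : `|Num.sqrt b| <= r0 by rewrite ger0_norm ?sqrtr_ge0.
have H1 := HP _ sb.
have H2 : phi ((- Num.sqrt b) ^+ 2) = P.[- Num.sqrt b] by apply: HP; rewrite /= normrN.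
move: H1 H2; rewrite sqrrN sqr_sqrtr// -(poly_even_odd P) !hornerE !horner_comp !hornerE sqrrN.
rewrite sqr_sqrtr// poly_even_odd; lra.
Qed.

Lemma poly_on_shift (m : nat) (S : set R) (phi : R -> R) (a : R) :
  poly_on m S (fun r => phi (r + a)) -> poly_on m [set b | S (b - a)] phi.
Proof.
move=> [P sP HP]; exists (P \Po ('X - a%:P)); first by rewrite size_comp_poly2// size_XsubC.
by move=> b /= /HP; rewrite horner_comp !hornerE subrK.
Qed.

Lemma poly_on_scale (m : nat) (S : set R) (phi : R -> R) (a : R) : a != 0 ->
  poly_on m S (fun r => phi (r * a)) -> poly_on m [set b | S (b / a)] phi.
Proof.
move=> a0 [P sP HP]; exists (P \Po (a^-1 *: 'X)).
  by rewrite size_comp_poly2// size_scale ?invr_eq0// size_polyX.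
by move=> b /= /HP; rewrite horner_comp !hornerE divfK// mulrC.
Qed.

(* From polynomiality along the parabolas [r |-> (r, b + r ^ 2)] and along the
   lines [r = const] to polynomiality along the lines [b = const]. *)
Lemma poly_on_parabola (m : nat) (phi : R -> R -> R) (S B : set R) x (b : R) :
  injective x -> B b ->
  (forall r k, S r -> (k <= m)%N -> B (x k + r ^+ 2)) ->
  (forall r, S r -> poly_on m B (phi r)) ->
  (forall k, (k <= m)%N -> poly_on m S (fun r => phi r (x k + r ^+ 2))) ->
  poly_on (3 * m) S (fun r => phi r b).
Proof.
move=> xi Bb BS Hb Hp.
have /choice[W HW] : forall k, exists W : {poly R}, (k <= m)%N ->
    (size W <= m.+1)%N /\ forall r, S r -> phi r (x k + r ^+ 2) = W.[r].
  move=> k; have [km|km] := leqP k m; last by exists 0.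
  by have [W sW HW] := Hp k km; exists W.
(* For fixed r the polynomial tau |-> phi r (tau + r^2) is recovered from its values W k (r) at tau
   = x k and evaluated at tau = b - r^2. The degree is at most m from W k plus 2 m from the Lagrange
   factor. *)
exists (\sum_(k < m.+1) W k * (lagr x k \Po (b%:P - 'X^2))).
  apply: (big_ind (fun Q : {poly R} => (size Q <= (3 * m).+1)%N)); first by rewrite size_poly0.
    by move=> p q hp hq; apply: (leq_trans (size_polyD _ _)); rewrite geq_max hp.
  move=> k _; apply: (leq_trans (size_polyMleq _ _)).
  have sW : (size (W k) <= m.+1)%N by have [] := HW k; rewrite -ltnS.
  have h2 : (size (b%:P - 'X^2)%R <= 3)%N.
    apply: (leq_trans (size_polyD _ _)); rewrite size_polyN size_polyXn geq_max andbT.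
    by apply: leq_trans (size_polyC_leq1 _) _.
  have sL := size_lagr k xi.
  have : (size (lagr x k \Po (b%:P - 'X^2))%R <= (2 * m).+1)%N.
    apply: (leq_trans (size_comp_poly_leq _ _)); rewrite ltnS mulnC; apply: leq_mul.
      by move: h2; case: (size _).
    by move: sL; case: (size _).
  lia.
move=> r Sr; have [Q sQ HQ] := Hb r Sr; rewrite (HQ _ Bb).
pose Q' := Q \Po ('X + (r ^+ 2)%:P).
have sQ' : (size Q' <= m.+1)%N by rewrite size_comp_poly2// size_XaddC.
have -> : Q.[b] = Q'.[b - r ^+ 2] by rewrite horner_comp !hornerE subrK.
rewrite {1}(lagr_gen xi sQ') !horner_sum; apply: eq_bigr => k _.
rewrite !hornerE !horner_comp !hornerE; congr (_ * _).
have km : (k <= m)%N by rewrite -ltnS.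
by rewrite -HQ; [have [_ <-] := HW k km|exact: BS].
Qed.

End Interpolation.

(** * Interpolation on a grid in several variables *)

Section Tensor.
Context {R : realType} {I : finType} {N : nat}.
Variable x : I -> nat -> R.
Hypothesis xi : forall i, injective (x i).
Implicit Types (u : I -> R) (phi : (I -> R) -> R) (kap : I -> nat).

Definition upd u (j : I) (r : R) : I -> R := fun i => if i == j then r else u i.

Definition grid (nu : {ffun I -> 'I_N.+1}) : I -> R := fun i => x i (nu i).

(** The coefficient of the monomial kap in the tensor-product Lagrange interpolant of phi. As a
    linear functional of the values on the grid, it turns bounds and identities on finitely many
    points into bounds and identities of coefficients. *)
Definition coefs phi kap : R :=
  \sum_(nu : {ffun I -> 'I_N.+1}) (\prod_i (lagr (x i) (nu i))`_(kap i)) * phi (grid nu).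

Definition monom u kap : R := \prod_i u i ^+ kap i.

Definition peval (a : {ffun I -> 'I_N.+1} -> R) u : R := \sum_mu a mu * monom u (fun i => mu i).

Lemma coefs0 phi kap : (forall nu, phi (grid nu) = 0) -> coefs phi kap = 0.
Proof. by move=> H; rewrite /coefs big1// => nu _; rewrite H mulr0. Qed.

Lemma coefsB phi psi kap : coefs (fun u => phi u - psi u) kap = coefs phi kap - coefs psi kap.
Proof. by rewrite /coefs -sumrB; apply: eq_bigr => nu _; rewrite mulrBr. Qed.

Lemma coefs_sum (J : finType) (b : J -> R) (phi : J -> (I -> R) -> R) kap :
  coefs (fun u => \sum_j b j * phi j u) kap = \sum_j b j * coefs (phi j) kap.
Proof.
rewrite /coefs; under eq_bigr do rewrite mulr_sumr.
rewrite exchange_big /=; apply: eq_bigr => j _; rewrite mulr_sumr.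
by apply: eq_bigr => nu _; rewrite mulrCA.
Qed.

Definition lebesgue_cst : R :=
  \sum_(nu : {ffun I -> 'I_N.+1}) \prod_i \sum_(k < N.+1) `|(lagr (x i) (nu i))`_k|.

Lemma lebesgue_cst_ge0 : 0 <= lebesgue_cst.
Proof. by rewrite sumr_ge0// => nu _; rewrite prodr_ge0// => i _; rewrite sumr_ge0. Qed.

Lemma coefs_le phi kap (M : R) : (forall nu, `|phi (grid nu)| <= M) ->
  `|coefs phi kap| <= lebesgue_cst * M.
Proof.
move=> HM; rewrite /coefs /lebesgue_cst mulr_suml.
apply: (le_trans (ler_norm_sum _ _ _)); apply: ler_sum => nu _.
rewrite normrM; apply: ler_pM => //; rewrite normr_prod.
apply: ler_prod => i _; rewrite normr_ge0 /=.
have [kN|kN] := ltnP (kap i) N.+1.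
  by rewrite (bigD1 (Ordinal kN))//= lerDl sumr_ge0.
rewrite nth_default ?normr0 ?sumr_ge0//.
by apply: leq_trans kN; exact: size_lagr.
Qed.

Lemma coefs_prod (P : I -> {poly R}) kap : (forall i, (size (P i) <= N.+1)%N) ->
  coefs (fun u => \prod_i (P i).[u i]) kap = \prod_i (P i)`_(kap i).
Proof.
move=> sP; rewrite /coefs.
have PE i : (P i)`_(kap i) = \sum_(k < N.+1) (lagr (x i) k)`_(kap i) * (P i).[x i k].
  rewrite {1}(lagr_gen (@xi i) (sP i)) coef_sum; apply: eq_bigr => k _.
  by rewrite coefZ mulrC.
under [RHS]eq_bigr do rewrite PE.
rewrite bigA_distr_bigA /=; apply: eq_bigr => nu _.
by rewrite -big_split.
Qed.

Lemma coefs_monom (mu : {ffun I -> 'I_N.+1}) kap :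
  coefs (fun u => monom u (fun i => mu i)) kap = \prod_i ((mu i : nat) == kap i)%:R.
Proof.
have -> : (fun u => monom u (fun i => mu i)) = fun u => \prod_i ('X^(mu i) : {poly R}).[u i].
  by apply/funext => u; apply: eq_bigr => i _; rewrite hornerXn.
rewrite coefs_prod; last by move=> i; rewrite size_polyXn ltnS -ltnS.
by apply: eq_bigr => i _; rewrite coefXn eq_sym.
Qed.

Lemma prod_delta (mu nu : {ffun I -> 'I_N.+1}) :
  \prod_i ((mu i : nat) == nu i)%:R = (mu == nu)%:R :> R.
Proof.
case: eqP => [->|/eqP mn]; first by rewrite big1// => i _; rewrite eqxx.
have [i Hi] : exists i, mu i != nu i.
  apply/existsP; rewrite -negb_forall; apply: contra mn => /forallP H.
  by apply/eqP/ffunP => i; apply/eqP.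
have Hi' : ((mu i : nat) == nu i) = false by apply: negbTE Hi.
by rewrite (bigD1 i)//= Hi' mul0r.
Qed.

Lemma coefs_peval (a : {ffun I -> 'I_N.+1} -> R) (mu : {ffun I -> 'I_N.+1}) :
  coefs (peval a) (fun i => mu i) = a mu.
Proof.
rewrite /peval coefs_sum (bigD1 mu)//= coefs_monom prod_delta eqxx mulr1 big1 ?addr0//.
by move=> nu /negPf nm; rewrite coefs_monom prod_delta nm mulr0.
Qed.

Lemma peval_coefs phi u : peval (fun mu => coefs phi (fun i => mu i)) u =
  \sum_(nu : {ffun I -> 'I_N.+1}) (\prod_i (lagr (x i) (nu i)).[u i]) * phi (grid nu).
Proof.
rewrite /peval /coefs; under eq_bigr do rewrite mulr_suml.
rewrite exchange_big /=; apply: eq_bigr => nu _.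
have -> : \prod_i (lagr (x i) (nu i)).[u i] =
    \prod_i \sum_(k < N.+1) (lagr (x i) (nu i))`_k * u i ^+ k.
  by apply: eq_bigr => i _; rewrite (horner_coef_wide _ (size_lagr _ (@xi i))).
rewrite bigA_distr_bigA /= mulr_suml; apply: eq_bigr => mu _.
by rewrite mulrAC -big_split.
Qed.

Lemma peval_poly_on a u j S : poly_on N S (fun r => peval a (upd u j r)).
Proof.
exists (\sum_mu ((a mu * \prod_(i | i != j) u i ^+ mu i) *: 'X^(mu j))).
  apply: (big_ind (fun Q : {poly R} => (size Q <= N.+1)%N)); first by rewrite size_poly0.
    by move=> p q hp hq; apply: (leq_trans (size_polyD _ _)); rewrite geq_max hp.
  by move=> mu _; apply: (leq_trans (size_scale_leq _ _)); rewrite size_polyXn ltnS -ltnS.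
move=> r _; rewrite horner_sum; apply: eq_bigr => mu _.
rewrite hornerZ hornerXn /monom (bigD1 j)//= /upd eqxx mulrCA mulrC; congr (_ * _ * _).
by apply: eq_bigr => i /negPf ->.
Qed.

(** Separate polynomiality suffices. The coordinates are released from the grid one at a time: along
    a line in direction j, phi and its interpolant are polynomials of degree at most N that agree at
    N + 1 nodes. *)
Lemma tensor_interpolation (S : I -> set R) phi :
  (forall i k, (k <= N)%N -> S i (x i k)) ->
  (forall u j, (forall i, S i (u i)) -> poly_on N (S j) (fun r => phi (upd u j r))) ->
  forall u, (forall i, S i (u i)) -> phi u = peval (fun mu => coefs phi (fun i => mu i)) u.
Proof.
move=> Sx Hphi u0 Su0; set a := fun mu => _.
have grid_eq nu : phi (grid nu) = peval a (grid nu).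
  rewrite peval_coefs (bigD1 nu)//= [X in _ + X]big1 => [|mu nm].
    by rewrite addr0 big1 ?mul1r// => i _; rewrite lagr_sample// eqxx.
  have [i Hi] : exists i, mu i != nu i.
    apply/existsP; rewrite -negb_forall; apply: contra nm => /forallP H.
    by apply/eqP/ffunP => i; apply/eqP.
  by rewrite (bigD1 i)//= lagr_sample// (negPf Hi) !mul0r.
have main (s : seq I) : forall u, (forall i, S i (u i)) ->
    (forall i, i \notin s -> exists k : 'I_N.+1, u i = x i k) -> phi u = peval a u.
  elim: s => [|j s IH] u Su Hu.
    have /choice[nu Hnu] : forall i, exists k : 'I_N.+1, u i = x i k by move=> i; exact: Hu.
    have -> : u = grid [ffun i => nu i] by apply/funext => i; rewrite /grid ffunE.
    exact: grid_eq.
  have [P sP HP] := Hphi u j Su.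
  have [Q sQ HQ] := peval_poly_on a u j (S j).
  have PQ : P = Q.
    rewrite (lagr_gen (@xi j) sP) (lagr_gen (@xi j) sQ); apply: eq_bigr => k _.
    have kN : (k <= N)%N by rewrite -ltnS.
    have Sk := Sx j k kN.
    rewrite -(HP _ Sk) -(HQ _ Sk); congr (_ *: _); apply: IH => i.
      by rewrite /upd; case: eqP => [->|_]; [exact: Sx|exact: Su].
    rewrite /upd; case: eqP => [-> _|/eqP ij is_]; first by exists k.
    by apply: Hu; rewrite inE negb_or ij.
  have uE : u = upd u j (u j) by apply/funext => i; rewrite /upd; case: eqP => [->|].
  by rewrite uE (HP _ (Su j)) (HQ _ (Su j)) PQ.
apply: (main (enum I)) => // i; by rewrite mem_enum.
Qed.

End Tensor.

(** * Anisotropic Taylor polynomials *)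

Section Anisotropic.
Context {R : realType} {d : nat}.
Local Notation E := 'cV[R]_d.+1.
Local Notation I := 'I_d.+1.
Local Notation last := (@ord_max d).
Implicit Types (u v : I -> R) (kap : I -> nat) (G : nat -> E).

Definition vec u : E := \col_i u i.

(** The conclusion of [uniform_taylor] at a fixed base point y, for g(h) = f(y + A h); the
    proposition b stands for y being in Y. *)
Definition uniform_jets m p (w : R -> R) (c M T C : R) (g : E -> R) (b : Prop) :=
  forall G, (forall i l, (i <= p)%N -> `|G i l 0| <= M) -> (forall l, `|G 0%N l 0| <= T) ->
    (forall s, in_cusp p c (pcurve p G s)) ->
    exists P : {poly R}, [/\ (size P <= m.+1)%N, forall i, `|P`_i| <= C,
      forall s, `|s| <= T -> `|g (pcurve p G s) - P.[s]| <= C * (`|s| ^+ m * w `|s|) &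
      b -> G 0%N = 0 -> P = 0].

Lemma sum_ord3 (p : nat) (F : nat -> R) : (2 <= p)%N ->
  (forall k, (2 < k)%N -> F k = 0) -> \sum_(k < p.+1) F k = F 0%N + F 1%N + F 2%N.
Proof.
case: p => [//|[//|q]] _ F0; rewrite 3!big_ord_recl big1 ?addr0 ?addrA// => k _.
exact: F0.
Qed.

Variables (m p : nat) (w : R -> R) (c T C : R).
Hypotheses (p2 : (2 <= p)%N) (c0 : 0 < c) (T0 : 0 < T) (C0 : 0 < C) (wm : modulus w).

Definition wt (i : I) : nat := if i == last then 2%N else p.
Definition dil (t : R) u : I -> R := fun i => t ^+ wt i * u i.
Definition wdeg kap : nat := \sum_i wt i * kap i.

Lemma wt_le i : (wt i <= p)%N. Proof. by rewrite /wt; case: ifP. Qed.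
Lemma wt_gt0 i : (0 < wt i)%N. Proof. by rewrite /wt; case: ifP => // _; apply: leq_trans p2. Qed.

Lemma monom_dil t u kap : monom (dil t u) kap = t ^+ wdeg kap * monom u kap.
Proof.
rewrite /monom /dil; under eq_bigr do rewrite exprMn -exprM.
by rewrite big_split /= prodrXr.
Qed.

(** Chosen so that 8 (d + 1) rho^2 <= c, the inequality that keeps the curves [radial] and [shear]
    in the cusp. *)
Definition box_radius : R := Num.min 1 (c / (8 * d.+1%:R)).
Local Notation rho := box_radius.

Lemma box_radius_gt0 : 0 < rho.
Proof. by rewrite lt_min ltr01 divr_gt0// mulr_gt0. Qed.

Lemma box_radius_le1 : rho <= 1. Proof. by rewrite ge_min lexx. Qed.

Lemma box_radius_sq : 8 * d.+1%:R * rho ^+ 2 <= c.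
Proof.
have h : 0 < 8 * d.+1%:R :> R by rewrite mulr_gt0.
rewrite mulrC -ler_pdivlMr// expr2; apply: (@le_trans _ _ (1 * rho)).
  by rewrite ler_wpM2r ?(ltW box_radius_gt0)// box_radius_le1.
by rewrite mul1r ge_min lexx orbT.
Qed.

(** Radial expansions exist for all wide u. The smaller [box] leaves room for horizontal
    displacements up to rho; its upper bound 10 is 1 + 3^2, reached by the vertical parabolas with
    |r| <= 3. *)
Definition wide u := (forall i, i != last -> `|u i| <= 2 * rho) /\ 1 <= u last <= 20.

Definition box (i : I) : set R :=
  if i == last then [set r | 1 <= r /\ r <= 10] else [set r | `|r| <= rho].

Definition radial u (k : nat) : E := \col_i (if k == wt i then u i else 0).

(* At s = t r this curve passes through the t-dilate of (u' + r v', u_last + r^2). *)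
Definition shear t u v (k : nat) : E :=
  \col_i (match k with 0%N => dil t u i | 1%N => t ^+ p.-1 * v i
          | 2%N => (i == last)%:R | _ => 0 end).

Definition parab u v (r : R) : I -> R := fun i => u i + r * v i + (i == last)%:R * r ^+ 2.

Lemma pcurve_radial u s : pcurve p (radial u) s = vec (dil s u).
Proof.
apply/matrixP => i j; rewrite ord1 pcurveE !mxE.
rewrite (bigD1 (Ordinal (wt_le i : wt i < p.+1)%N))//= mxE eqxx big1 ?addr0//.
move=> k /negPf ki; rewrite mxE; case: eqP => [kE|]; last by rewrite mulr0.
by move: ki; rewrite -val_eqE /= kE eqxx.
Qed.

Lemma pcurve_shearE t u v s i : pcurve p (shear t u v) s i 0 =
  dil t u i + s * (t ^+ p.-1 * v i) + s ^+ 2 * (i == last)%:R.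
Proof.
rewrite pcurveE (@sum_ord3 p (fun k => s ^+ k * shear t u v k i 0))//.
  by rewrite !mxE /= expr0 expr1 mul1r.
by move=> [|[|[|k]]]// _; rewrite mxE mulr0.
Qed.

Lemma pcurve_shear t u v r : v last = 0 ->
  pcurve p (shear t u v) (t * r) = vec (dil t (parab u v r)).
Proof.
move=> v0; apply/matrixP => i j; rewrite ord1 pcurve_shearE mxE /dil /parab /wt.
case: eqP => [->|_] /=; first by rewrite v0; ring.
rewrite mulr0 addr0 mul0r addr0 mulrDr; congr (_ + _).
by rewrite -{2}(@prednK p) ?(leq_trans _ p2)// exprS; ring.
Qed.

Lemma sum_sq_le u (K : R) : 0 <= K -> (forall i, i != last -> u i ^+ 2 <= K) ->
  \sum_(i < d.+1 | i != last) u i ^+ 2 <= d.+1%:R * K.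
Proof.
move=> K0 HK; apply: (@le_trans _ _ (\sum_(i < d.+1 | i != last) K)).
  exact: ler_sum.
rewrite sumr_const -[leLHS]mulr_natl ler_wpM2r// ler_nat.
by rewrite (leq_trans (max_card _))// card_ord.
Qed.

Lemma sq_le_norm (a K : R) : 0 <= K -> `|a| <= K -> a ^+ 2 <= K ^+ 2.
Proof. by move=> K0 h; rewrite -real_normK ?num_real// lerXn2r ?nnegrE. Qed.

Lemma radial_in_cusp u s : wide u -> in_cusp p c (pcurve p (radial u) s).
Proof.
move=> [hu /andP[u1 u20]]; rewrite pcurve_radial; split.
  by rewrite mxE /dil /wt eqxx mulr_ge0 ?sqr_ge0// (le_trans _ u1).
rewrite mxE [dil s u last]/dil /wt eqxx.
have r0 := ltW box_radius_gt0.
apply: (@le_trans _ _ (\sum_(i < d.+1 | i != last) (s ^+ 2) ^+ p * u i ^+ 2)).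
  rewrite le_eqVlt; apply/orP; left; apply/eqP; apply: eq_bigr => i /negPf hi.
  by rewrite mxE /dil /wt hi exprMn -!exprM mulnC.
have sp : 0 <= (s ^+ 2) ^+ p by apply: exprn_ge0; exact: sqr_ge0.
rewrite -mulr_sumr [(_ * u last) ^+ p]exprMn [c * _]mulrCA; apply: ler_wpM2l => //.
apply: (@le_trans _ _ (d.+1%:R * (2 * rho) ^+ 2)).
  apply: sum_sq_le; first exact: sqr_ge0.
  by move=> i hi; apply: sq_le_norm; [rewrite mulr_ge0|exact: hu].
apply: (@le_trans _ _ c); last by rewrite ler_peMr ?(ltW c0)// exprn_ege1.
apply: le_trans box_radius_sq; rewrite exprMn mulrCA mulrA; rewrite ler_wpM2r ?sqr_ge0//.
by rewrite ler_wpM2r ?ler0n// -natrX ler_nat.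
Qed.

(** It holds for every s, not only for s comparable to t, as [uniform_jets] demands. The factor
    t^(p-1) in the velocity makes a horizontal coordinate t^(p-1) (t u + s v), whose square is at
    most 8 rho^2 (t^2 + s^2)^p, while the height is at least t^2 + s^2. *)
Lemma shear_in_cusp t u v s : 0 <= t -> v last = 0 -> (forall i, i != last -> `|u i| <= 2 * rho) ->
  (forall i, `|v i| <= rho) -> 1 <= u last -> in_cusp p c (pcurve p (shear t u v) s).
Proof.
move=> t0 v0 hu hv u1.
have r0 := ltW box_radius_gt0.
have El : pcurve p (shear t u v) s last 0 = t ^+ 2 * u last + s ^+ 2.
  by rewrite pcurve_shearE v0 eqxx /dil /wt eqxx !mulr0 addr0 mulr1.
have h1 : t ^+ 2 + s ^+ 2 <= pcurve p (shear t u v) s last 0.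
  by rewrite El lerD2r ler_peMr ?sqr_ge0.
have h0 : 0 <= t ^+ 2 + s ^+ 2 by rewrite addr_ge0 ?sqr_ge0.
split; first exact: le_trans h1.
apply: (@le_trans _ _ (c * (t ^+ 2 + s ^+ 2) ^+ p)); last first.
  by rewrite ler_pM2l//; apply: lerXn2r; rewrite ?nnegrE// (le_trans h0).
pose K := 8 * rho ^+ 2 * (t ^+ 2 + s ^+ 2) ^+ p.
have K0 : 0 <= K by rewrite mulr_ge0 ?exprn_ge0// mulr_ge0 ?sqr_ge0.
apply: (@le_trans _ _ (d.+1%:R * K)); last first.
  rewrite /K mulrA ler_wpM2r ?exprn_ge0//; apply: le_trans box_radius_sq.
  by rewrite mulrA [_ * 8]mulrC.
apply: sum_sq_le => // i hi; rewrite pcurve_shearE (negPf hi) mulr0 addr0 /dil /wt (negPf hi).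
have -> : t ^+ p = t ^+ p.-1 * t by rewrite -exprSr prednK// (leq_trans _ p2).
have -> : (t ^+ p.-1 * t * u i + s * (t ^+ p.-1 * v i)) ^+ 2 =
    (t * u i + s * v i) ^+ 2 * (t ^+ 2) ^+ p.-1 by rewrite -[in RHS]exprM mulnC exprM; ring.
have -> : K = 8 * rho ^+ 2 * (t ^+ 2 + s ^+ 2) * (t ^+ 2 + s ^+ 2) ^+ p.-1.
  by rewrite /K -[RHS]mulrA -exprS prednK// (leq_trans _ p2).
apply: ler_pM; rewrite ?sqr_ge0//; first by apply: exprn_ge0; exact: sqr_ge0.
  have hu' : u i ^+ 2 <= (2 * rho) ^+ 2 by apply: sq_le_norm; [rewrite mulr_ge0|exact: hu].
  have hv' : v i ^+ 2 <= rho ^+ 2 by apply: sq_le_norm.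
  have hs : 0 <= (t * u i - s * v i) ^+ 2 by exact: sqr_ge0.
  have ht2 : t ^+ 2 * u i ^+ 2 <= t ^+ 2 * (2 * rho) ^+ 2 by rewrite ler_wpM2l ?sqr_ge0.
  have hs2 : s ^+ 2 * v i ^+ 2 <= s ^+ 2 * rho ^+ 2 by rewrite ler_wpM2l ?sqr_ge0.
  have hs3 : 0 <= s ^+ 2 * rho ^+ 2 by rewrite mulr_ge0 ?sqr_ge0.
  clear -hs ht2 hs2 hs3; nra.
by apply: lerXn2r; rewrite ?nnegrE ?sqr_ge0// lerDl sqr_ge0.
Qed.

Definition jet_spec (g : E -> R) (b : Prop) (q : (I -> R) -> {poly R}) :=
  forall u, wide u -> [/\ (size (q u) <= m.+1)%N, forall i, `|(q u)`_i| <= C,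
    forall s, `|s| <= T -> `|g (vec (dil s u)) - (q u).[s]| <= C * (`|s| ^+ m * w `|s|) &
    b -> q u = 0].

Lemma radial_jet g b : uniform_jets m p w c 20 T C g b -> exists q, jet_spec g b q.
Proof.
move=> gj; suff /choice[q Hq] : forall u, exists P : {poly R}, wide u ->
    [/\ (size P <= m.+1)%N, forall i, `|P`_i| <= C,
    forall s, `|s| <= T -> `|g (vec (dil s u)) - P.[s]| <= C * (`|s| ^+ m * w `|s|) &
    b -> P = 0] by exists q.
move=> u.
have [wu|nwu] := pselect (wide u); last by exists 0.
have [hu /andP[u1 u20]] := wu.
have G0 : radial u 0%N = 0.
  by apply/matrixP => i j; rewrite !mxE ltn_eqF ?wt_gt0.
have [|||P [sP HP1 HP2 HP3]] := gj (radial u).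
- move=> k i _; rewrite mxE; case: eqP => _; last by rewrite normr0.
  have [->|il] := eqVneq i last; first by rewrite ger0_norm// (le_trans _ u1).
  by apply: (le_trans (hu i il)); have := box_radius_le1; lra.
- by move=> l; rewrite G0 mxE normr0 ltW.
- by move=> s; exact: radial_in_cusp.
exists P => _; split => // [s hs|hb]; first by rewrite -pcurve_radial HP2.
exact: HP3.
Qed.

Lemma dil_comp s t u : dil s (dil t u) = dil (s * t) u.
Proof. by apply/funext => i; rewrite /dil mulrA exprMn. Qed.

Lemma unit_nodes n : injective (fun k : nat => k%:R / n.+1%:R : R).
Proof.
move=> k l /mulIf H; apply/eqP; rewrite -(eqr_nat R); apply/eqP/H.
by rewrite invr_eq0 pnatr_eq0.
Qed.

Lemma unit_nodes_le n k : (k <= n)%N -> 0 <= k%:R / n.+1%:R :> R /\ k%:R / n.+1%:R <= 1 :> R.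
Proof.
by move=> kn; rewrite divr_ge0// ler_pdivrMr// mul1r ler_nat leqW.
Qed.

Section Jet.
Variables (g : E -> R) (b : Prop) (q : (I -> R) -> {poly R}).
Hypotheses (gj : uniform_jets m p w c 20 T C g b) (hq : jet_spec g b q).

(** The point at parameter t of the radial curve of [parab u v r] is the point at parameter t r of
    one shear curve. Expanding along the latter gives, for each t, a polynomial in r of degree at
    most m, so [poly_on_limit] applies. *)
Lemma jet_parab u v (r0 : R) i : (i <= m)%N -> 1 <= r0 -> r0 <= 3 -> v last = 0 ->
  (forall i, `|v i| <= rho) -> (forall i, i != last -> `|u i| <= 2 * rho) ->
  1 <= u last -> u last <= 20 -> (forall r, `|r| <= r0 -> wide (parab u v r)) ->
  poly_on m [set r | `|r| <= r0] (fun r => (q (parab u v r))`_i).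
Proof.
move=> im r01 r03 v0 hv hu u1 u20 hw.
apply: (@poly_on_limit _ w m m _ (fun k => k%:R / m.+1%:R) (fun i r => (q (parab u v r))`_i)
  (* The factor 3^m 4 comes from |t r| <= 3 t and w(3 t) <= 4 w(t); the range T / 20 makes the
     starting point, of size at most 20 t, and 3 t at most T. *)
  (C + C * (3 ^+ m * 4)) (Num.min 1 (T / 20))) => //.
- exact: unit_nodes.
- move=> k km /=; have [h1 h2] := unit_nodes_le km.
  by rewrite ger0_norm// (le_trans h2).
- by rewrite lt_min ltr01 divr_gt0.
- by rewrite addr_ge0 ?mulr_ge0 ?exprn_ge0// ltW.
move=> t t0; rewrite lt_min => /andP[t1 tT].
have rl := box_radius_le1.
have dille i' : `|dil t u i'| <= t * 20.
  rewrite /dil normrM normrX (gtr0_norm t0); apply: ler_pM; rewrite ?exprn_ge0// ?(ltW t0)//.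
    by rewrite -[leRHS]expr1; apply: ler_wiXn2l; rewrite ?(ltW t0) ?(ltW t1)// wt_gt0.
  have [->|il] := eqVneq i' last; first by rewrite ger0_norm// (le_trans _ u1).
  by apply: (le_trans (hu _ il)); lra.
have [|||P [sP _ HP _]] := gj (G := shear t u v).
- move=> [|[|[|k]]] l _; rewrite mxE ?normr0//.
  + by apply: (le_trans (dille l)); rewrite ler_piMl// ltW.
  + rewrite normrM normrX (gtr0_norm t0); apply: (@le_trans _ _ (1 * 1)); last by rewrite mulr1 ler1n.
    apply: ler_pM; rewrite ?exprn_ge0 ?(ltW t0)//; last exact: le_trans (hv l) _.
    by rewrite exprn_ile1// ltW.
  + by case: eqP => _; rewrite ?normr1 ?normr0// ler1n.
- by move=> l; rewrite mxE; apply: (le_trans (dille l)); rewrite -ler_pdivlMr// ltW.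
- by move=> s; apply: shear_in_cusp => //; exact: ltW.
exists (P \Po (t *: 'X)).
  by rewrite size_comp_poly2// size_scale ?gt_eqF// size_polyX.
move=> r /= hr; rewrite horner_comp hornerZ hornerX.
have [sq _ Hq _] := hq (hw r hr).
have -> : \sum_(i0 < m.+1) (q (parab u v r))`_i0 * t ^+ i0 = (q (parab u v r)).[t].
  by rewrite (horner_coef_wide _ sq).
have tr3 : `|t * r| <= 3 * t.
  by rewrite normrM (gtr0_norm t0) mulrC ler_pM2r// (le_trans hr).
have trT : `|t * r| <= T by apply: (le_trans tr3); move: tT; rewrite ltr_pdivlMr//; lra.
have h1 := HP _ trT; rewrite pcurve_shear// in h1.
have tT' : `|t| <= T by rewrite gtr0_norm//; move: tT; rewrite ltr_pdivlMr//; lra.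
have h2 := Hq _ tT'; rewrite (gtr0_norm t0) in h2.
set G := g _ in h1 h2.
have -> : (q (parab u v r)).[t] - P.[t * r] = (G - P.[t * r]) - (G - (q (parab u v r)).[t]) by ring.
apply: (le_trans (ler_normB _ _)); rewrite addrC mulrDl; apply: lerD => //.
apply: (le_trans h1); rewrite -mulrA ler_pM2l//.
have w3 : w `|t * r| <= 4 * w t.
  apply: (le_trans (modulus_le wm (normr_ge0 _) tr3)).
  by apply: (le_trans (modulus_scale wm _ (ltW t0))) => //; rewrite ler_wpM2r ?(modulus_ge0 wm) ?(ltW t0)//; lra.
rewrite mulrACA -exprMn; apply: ler_pM => //.
- exact: (modulus_ge0 wm).
- by apply: lerXn2r; rewrite ?nnegrE// mulr_ge0// ltW.
Qed.

(** A parabola with v = 0 runs along the axis with height 1 + r^2; polynomiality in r of an even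
    function gives polynomiality in r^2. *)
Lemma jet_vertical u i : (i <= m)%N -> (forall i, i != last -> `|u i| <= 2 * rho) ->
  poly_on m [set r | 1 <= r /\ r <= 10] (fun r => (q (upd u last r))`_i).
Proof.
move=> im hu.
have E1 r : parab (upd u last 1) (fun=> 0) r = upd u last (r ^+ 2 + 1).
  apply/funext => j; rewrite /parab /upd mulr0 addr0; case: eqP => _ /=; last by rewrite mul0r addr0.
  by rewrite mul1r addrC.
have : poly_on m [set r | `|r| <= 3] (fun r => (q (upd u last (r ^+ 2 + 1)))`_i).
  have -> : (fun r : R => (q (upd u last (r ^+ 2 + 1)))`_i) =
      (fun r => (q (parab (upd u last 1) (fun=> 0) r))`_i) by apply/funext => r; rewrite E1.
  apply: jet_parab => //; rewrite ?ler1n//.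
  - by move=> _; rewrite normr0 ltW// box_radius_gt0.
  - by move=> j jl; rewrite /upd (negPf jl); exact: hu.
  - by rewrite /upd eqxx.
  - by rewrite /upd eqxx ler1n.
  move=> r hr; rewrite E1; split; first by move=> j jl; rewrite /upd (negPf jl); exact: hu.
  rewrite /upd eqxx lerDr sqr_ge0 /=.
  have := sq_le_norm (ler0n R 3) hr; lra.
move=> /(@even_poly_on _ m 3 (fun r => (q (upd u last (r + 1)))`_i) (ler0n R 3)).
move=> /(@poly_on_shift _ m _ (fun r => (q (upd u last r))`_i) 1)[P sP HP].
exists P => // r [r1 r10]; apply: HP => /=; lra.
Qed.

Lemma jet_horizontal u v (t : R) i : (i <= m)%N -> v last = 0 ->
  (forall i, `|v i| <= rho) -> (forall i, i != last -> `|u i| <= rho) ->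
  1 <= t -> t <= 10 ->
  poly_on (3 * m) [set r | `|r| <= 1] (fun r => (q (upd (fun j => u j + r * v j) last t))`_i).
Proof.
move=> im v0 hv hu t1 t10.
have r0 := box_radius_gt0.
have huv r j : `|r| <= 1 -> j != last -> `|u j + r * v j| <= 2 * rho.
  move=> hr jl; apply: (le_trans (ler_normD _ _)).
  have : `|r * v j| <= 1 * rho by rewrite normrM ler_pM.
  have := hu j jl; lra.
apply: (@poly_on_parabola _ m (fun r t => (q (upd (fun j => u j + r * v j) last t))`_i)
  _ [set r | 1 <= r /\ r <= 10] (fun k => 1 + k%:R / m.+1%:R)) => //.
- by move=> k l /addrI; exact: unit_nodes.
- move=> r k /= hr km; have [h1 h2] := unit_nodes_le km.
  have h3 : r ^+ 2 <= 1 by rewrite -[leRHS](expr1n _ 2); exact: sq_le_norm.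
  have h4 : 0 <= r ^+ 2 by exact: sqr_ge0.
  by move: h1 h2; set K := k%:R / _ => h1 h2; split; lra.
- move=> r /= hr; apply: jet_vertical => // j jl; exact: huv.
move=> k km; have [h1 h2] := unit_nodes_le km.
have E1 r : parab (upd u last (1 + k%:R / m.+1%:R)) v r =
    upd (fun j => u j + r * v j) last (1 + k%:R / m.+1%:R + r ^+ 2).
  apply/funext => j; rewrite /parab /upd; case: eqP => [->|_] /=; last by rewrite mul0r addr0.
  by rewrite v0 mulr0 addr0 mul1r.
have -> : (fun r : R => (q (upd (fun j => u j + r * v j) last (1 + k%:R / m.+1%:R + r ^+ 2)))`_i) =
    (fun r => (q (parab (upd u last (1 + k%:R / m.+1%:R)) v r))`_i) by apply/funext => r; rewrite E1.
apply: jet_parab => //; rewrite ?ler1n//.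
- move=> j jl; rewrite /upd (negPf jl); apply: (le_trans (hu j jl)); lra.
- by rewrite /upd eqxx lerDl.
- by rewrite /upd eqxx; move: h2; set K := k%:R / _ => h2; lra.
move=> r hr; rewrite E1; split; first by move=> j jl; rewrite /upd (negPf jl); exact: huv.
have h3 : r ^+ 2 <= 1 by rewrite -[leRHS](expr1n _ 2); exact: sq_le_norm.
have h4 : 0 <= r ^+ 2 by exact: sqr_ge0.
rewrite /upd eqxx; move: h1 h2; set K := k%:R / _ => h1 h2.
by apply/andP; split; lra.
Qed.

Lemma jet_box u j i : (i <= m)%N -> (forall k, box k (u k)) ->
  poly_on (3 * m) (box j) (fun r => (q (upd u j r))`_i).
Proof.
move=> im ub; have r0 := box_radius_gt0.
have ub' k : k != last -> `|u k| <= rho by move=> /negPf kl; have := ub k; rewrite /box kl.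
have [jl|jl] := eqVneq j last.
  rewrite jl /box eqxx; apply: (@poly_on_le _ m); first by rewrite leq_pmull.
  by apply: jet_vertical => // k /ub'; lra.
have [u1 u10] : 1 <= u last /\ u last <= 10 by have := ub last; rewrite /box eqxx.
have E1 r : upd (fun k => upd u j 0 k + r * upd (fun=> 0) j rho k) last (u last) = upd u j (r * rho).
  apply/funext => k; rewrite /upd; case: (eqVneq k last) => [->|kl].
    by rewrite eq_sym (negPf jl).
  by case: eqP => _; rewrite ?add0r ?mulr0 ?addr0.
have H : poly_on (3 * m) [set r | `|r| <= 1] (fun r => (q (upd u j (r * rho)))`_i).
  have -> : (fun r : R => (q (upd u j (r * rho)))`_i) =
      (fun r => (q (upd (fun k => upd u j 0 k + r * upd (fun=> 0) j rho k) last (u last)))`_i).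
    by apply/funext => r; rewrite E1.
  apply: jet_horizontal => //.
  - by rewrite /upd eq_sym (negPf jl).
  - by move=> k; rewrite /upd; case: eqP => _; rewrite ?normr0 ?(ltW r0)// gtr0_norm.
  - by move=> k kl; rewrite /upd; case: eqP => _; rewrite ?normr0 ?(ltW r0)//; exact: ub'.
have [P sP HP] := @poly_on_scale _ _ _ (fun r => (q (upd u j r))`_i) rho (lt0r_neq0 r0) H.
exists P => // r; rewrite /box (negPf jl) /= => hr; apply: HP => /=.
by rewrite normrM normfV (gtr0_norm r0) ler_pdivrMr// mul1r.
Qed.

End Jet.

Local Notation N := (3 * m)%N.

(** Nodes well inside the box: both the dilation by 2, which multiplies coordinates by 2^p or 4, and
    a perturbation by rho / 2 keep them in the box. *)
Definition node (i : I) (k : nat) : R :=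
  if i == last then 2 + k%:R / N.+1%:R / 4 else rho / 2 ^+ p * (k%:R / N.+1%:R).

Lemma node_inj i : injective (node i).
Proof.
move=> k l; rewrite /node; case: ifP => _.
  by move=> /addrI /mulIf H; apply: (@unit_nodes N); apply: H; rewrite invr_eq0.
move=> /mulfI H; apply: (@unit_nodes N); apply: H.
by rewrite mulf_neq0 ?invr_eq0 ?lt0r_neq0 ?box_radius_gt0 ?exprn_gt0.
Qed.

Lemma node_last k : (k <= N)%N -> 2 <= node last k /\ node last k <= 9 / 4.
Proof.
move=> kN; rewrite /node eqxx; have [h1 h2] := unit_nodes_le kN.
by move: h1 h2; set K := k%:R / _ => h1 h2; split; lra.
Qed.

Lemma node_other i k : i != last -> (k <= N)%N -> `|node i k| <= rho / 2 ^+ p.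
Proof.
move=> /negPf il kN; rewrite /node il; have [h1 h2] := unit_nodes_le kN.
have h : 0 < rho / 2 ^+ p by rewrite divr_gt0 ?box_radius_gt0 ?exprn_gt0.
by rewrite normrM (gtr0_norm h) (ger0_norm h1) ler_piMr// ltW.
Qed.

Lemma pow2p : 2 <= 2 ^+ p :> R.
Proof. by rewrite -[leLHS]expr1; apply: ler_weXn2l; rewrite ?ler1n// (leq_trans _ p2). Qed.

Lemma node_half i k : i != last -> (k <= N)%N -> `|node i k| <= rho / 2.
Proof.
move=> il kN; apply: (le_trans (node_other il kN)).
rewrite ler_pM2l ?box_radius_gt0// lef_pV2 ?posrE ?exprn_gt0//; exact: pow2p.
Qed.

Lemma box_node i k : (k <= N)%N -> box i (node i k).
Proof.
move=> kN; rewrite /box; have [->|il] := eqVneq i last; rewrite /=.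
  have [h1 h2] := node_last kN; split; lra.
by apply: (le_trans (node_half il kN)); have := box_radius_gt0; lra.
Qed.

Lemma box_wide u : (forall i, box i (u i)) -> wide u.
Proof.
move=> ub; split=> [i /negPf il|].
  by have := ub i; rewrite /box il /= => h; apply: (le_trans h); have := box_radius_gt0; lra.
by have := ub last; rewrite /box eqxx /= => -[h1 h2]; apply/andP; split; lra.
Qed.

Lemma box_grid (nu : {ffun I -> 'I_N.+1}) i : box i (grid node nu i).
Proof. by apply: box_node; rewrite -ltnS. Qed.

Lemma box_dil2_grid (nu : {ffun I -> 'I_N.+1}) i : box i (dil 2 (grid node nu) i).
Proof.
have kN : (nu i <= N)%N by rewrite -ltnS.
rewrite /box /dil /grid /wt; have [->|il] := eqVneq i last; rewrite /=.
  have kN' : (nu last <= N)%N by rewrite -ltnS.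
  by have [h1 h2] := node_last kN'; split; lra.
rewrite normrM normrX ger0_norm//.
have := node_other il kN; rewrite ler_pdivlMr ?exprn_gt0// mulrC => h.
exact: h.
Qed.

Section JetPolynomial.
Variables (g : E -> R) (b : Prop) (q : (I -> R) -> {poly R}).
Hypotheses (gj : uniform_jets m p w c 20 T C g b) (hq : jet_spec g b q).

Lemma jet_peval u i : (i <= m)%N -> (forall j, box j (u j)) ->
  (q u)`_i = peval (fun mu : {ffun I -> 'I_N.+1} => coefs (N := N) node (fun u => (q u)`_i) (fun i => mu i)) u.
Proof.
move=> im ub.
apply: (@tensor_interpolation _ _ N node node_inj box (fun u => (q u)`_i)) => //.
- by move=> j k; exact: box_node.
- by move=> v j vb; exact: (jet_box gj hq j im vb).
Qed.

(** The radial curve of [dil 2 u] is that of u run at double speed, and Taylor polynomials are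
    unique. *)
Lemma jet_dil u i : wide u -> wide (dil 2 u) -> (q (dil 2 u))`_i = 2 ^+ i * (q u)`_i.
Proof.
move=> wu wu2; have [s1 _ H1 _] := hq wu; have [s2 _ H2 _] := hq wu2.
have t2 : size ((2 : R) *: 'X) = 2 by rewrite size_scale ?size_polyX// pnatr_eq0.
suff /subr0_eq -> : q (dil 2 u) - (q u \Po (2 *: 'X)) = 0.
  rewrite comp_polyE coef_sum.
  under eq_bigr do rewrite exprZn coefZ coefZ coefXn.
  have [iq|iq] := ltnP i (size (q u)).
    rewrite (bigD1 (Ordinal iq))//= eqxx mulr1 mulrC big1 ?addr0// => j ji.
    case: eqP => [ij|]; last by rewrite !mulr0.
    by move: ji; rewrite -val_eqE /= ij eqxx.
  rewrite nth_default// mulr0 big1// => j _; case: eqP => [ij|]; last by rewrite !mulr0.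
  by have := ltn_ord j; rewrite -ij ltnNge iq.
apply: (@poly_vanish _ w wm m _ (C + C * (2 ^+ m * 3)) (T / 2)).
- apply: (leq_trans (size_polyD _ _)); rewrite size_polyN geq_max s2.
  by rewrite size_comp_poly2.
- by rewrite divr_gt0.
move=> s s0 sT; rewrite hornerD hornerN horner_comp hornerZ hornerX.
have h2 := H2 s; rewrite (gtr0_norm s0) dil_comp in h2.
have h1 := H1 (s * 2); rewrite gtr0_norm ?mulr_gt0// in h1.
have {}h2 := h2 ltac:(lra); have {}h1 := h1 ltac:(lra).
set G := g _ in h1 h2.
have -> : (q (dil 2 u)).[s] - (q u).[2 * s] = (G - (q u).[s * 2]) - (G - (q (dil 2 u)).[s]).
  by rewrite [2 * s]mulrC; ring.
apply: (le_trans (ler_normB _ _)); rewrite addrC mulrDl; apply: lerD => //.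
apply: (le_trans h1); rewrite -mulrA ler_pM2l// exprMn [s ^+ m * 2 ^+ m]mulrC -!mulrA.
rewrite ler_pM2l ?exprn_gt0// mulrCA ler_pM2l ?exprn_gt0// mulrC.
by apply: (le_trans (modulus_scale wm _ (ltW s0))) => //; rewrite ler_wpM2r ?(modulus_ge0 wm) ?(ltW s0)//; lra.
Qed.

(** Comparing u with [dil 2 u] on the grid gives a mu (2^(wdeg mu) - 2^i) = 0 for each coefficient;
    this single dilation is enough, as powers of 2 are distinct. *)
Lemma jet_coefs_wdeg i (mu : {ffun I -> 'I_N.+1}) : (i <= m)%N -> wdeg (fun j => mu j) != i ->
  coefs (N := N) node (fun u => (q u)`_i) (fun j => mu j) = 0.
Proof.
move=> im mi; set a := fun nu : {ffun I -> 'I_N.+1} => coefs (N := N) node (fun u => (q u)`_i) (fun j => nu j).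
rewrite -/(a mu).
pose a' := fun nu : {ffun I -> 'I_N.+1} => a nu * (2 ^+ wdeg (fun j => nu j) - 2 ^+ i).
have h : a' mu = 0.
  rewrite -(coefs_peval node_inj a' mu); apply: coefs0 => nu.
  have := jet_dil i (box_wide (box_grid nu)) (box_wide (box_dil2_grid nu)).
  rewrite (jet_peval im (box_dil2_grid nu)) (jet_peval im (box_grid nu)) -/a => /eqP.
  rewrite -subr_eq0 => /eqP <-; rewrite /peval mulr_sumr -sumrB.
  by apply: eq_bigr => ka _; rewrite monom_dil /a'; ring.
move/eqP : h; rewrite mulf_eq0 => /orP[/eqP//|].
rewrite subr_eq0 => /eqP h; suff : wdeg (fun j => mu j) == i by rewrite (negPf mi).
apply/eqP; move: h; apply: ieexprIn => //; by rewrite pnatr_eq1.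
Qed.

End JetPolynomial.

Definition tracks (a : {ffun I -> 'I_N.+1} -> R) (g : E -> R) :=
  forall u s, (forall j, box j (u j)) -> 0 <= s -> s <= T ->
    `|g (vec (dil s u)) - peval a (dil s u)| <= C * (s ^+ m * w s).

Lemma dil0 u : dil 0 u = fun=> 0.
Proof. by apply/funext => i; rewrite /dil expr0n gtn_eqF ?wt_gt0// mul0r. Qed.

Lemma vec0 : vec (fun=> 0) = 0.
Proof. by apply/matrixP => i j; rewrite !mxE. Qed.

(** The error bound is read at s = 0; since s^m is 1 there when m = 0, it is w(0) = 0 that makes it
    vanish. *)
Lemma peval0 a g : tracks a g -> peval a (fun=> 0) = g 0.
Proof.
move=> /(_ (grid node [ffun=> ord0]) 0 (box_grid _) (lexx _) (ltW T0)).
rewrite dil0 vec0 (modulus0 wm) !mulr0 normr_le0 subr_eq0 => /eqP ->; by [].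
Qed.

Lemma anisotropic_polynomial g b : uniform_jets m p w c 20 T C g b ->
  exists a, [/\ forall mu, `|a mu| <= lebesgue_cst (N := N) node * C, tracks a g &
    b -> forall mu, a mu = 0].
Proof.
move=> gj; have [q hq] := radial_jet gj.
(* By homogeneity a monomial can only occur in the Taylor coefficient whose index is its weighted
   degree; for weighted degree above m that coefficient is 0. *)
pose a (mu : {ffun I -> 'I_N.+1}) :=
  coefs (N := N) node (fun u => (q u)`_(wdeg (fun j => mu j))) (fun j => mu j).
exists a; split.
- move=> mu; apply: (coefs_le node_inj) => nu.
  by have [_ H _ _] := hq _ (box_wide (box_grid nu)).
- move=> u s ub s0 sT; have [sq _ H _] := hq _ (box_wide ub).
  have := H s; rewrite ger0_norm// => /(_ sT).
  suff -> : (q u).[s] = peval a (dil s u) by [].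
  rewrite (horner_coef_wide _ sq) /peval.
  under eq_bigr => i _.
    have im : (i <= m)%N by rewrite -ltnS.
    rewrite (jet_peval gj hq im ub) /peval mulr_suml; over.
  rewrite exchange_big /=; apply: eq_bigr => mu _; rewrite monom_dil.
  have [mm|mm] := leqP (wdeg (fun j => mu j)) m.
    rewrite (bigD1 (Ordinal (mm : wdeg (fun j => mu j) < m.+1)%N))//= big1 ?addr0.
      by rewrite /a mulrAC mulrA.
    move=> i /negPf im; rewrite (jet_coefs_wdeg gj hq) ?mul0r//; first by rewrite -ltnS.
    by apply/negbT; rewrite eq_sym; move: im; rewrite -val_eqE.
  have -> : a mu = 0.
    apply: coefs0 => nu; have [sn _ _ _] := hq _ (box_wide (box_grid nu)).
    by rewrite nth_default// (leq_trans sn).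
  rewrite mul0r big1// => i _; rewrite (jet_coefs_wdeg gj hq) ?mul0r//; first by rewrite -ltnS.
  by rewrite gtn_eqF// (leq_trans _ mm).
- move=> hb mu; apply: coefs0 => nu.
  by have [_ _ _ ->] := hq _ (box_wide (box_grid nu)); rewrite ?coef0.
Qed.

(** The partial derivative of order kap of [peval a] at dl. Where mu i < kap i the truncated
    difference is harmless, the falling factorial being 0. *)
Definition dpeval (a : {ffun I -> 'I_N.+1} -> R) kap (dl : I -> R) : R :=
  \sum_mu a mu * \prod_i (((mu i) ^_ (kap i))%:R * dl i ^+ (mu i - kap i)).

Lemma coef_affine_exp (x y : R) n k : ((x *: 'X + y%:P) ^+ n)`_k = 'C(n, k)%:R * (x ^+ k * y ^+ (n - k)).
Proof.
rewrite addrC exprDn coef_sum.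
under eq_bigr do rewrite coefMn exprZn -rmorphXn /= mul_polyC coefZ coefZ coefXn.
have [kn|kn] := ltnP k n.+1.
  rewrite (bigD1 (Ordinal kn))//= eqxx mulr1 big1 ?addr0.
    by rewrite -[LHS]mulr_natl [x ^+ k * _]mulrC.
  move=> i /negPf ik; case: eqP => [ki|]; last by rewrite !mulr0 mul0rn.
  by move: ik; rewrite -val_eqE /= ki eqxx.
rewrite bin_small// mul0r big1// => i _; case: eqP => [ki|]; last by rewrite !mulr0 mul0rn.
by have := ltn_ord i; rewrite -ki ltnNge kn.
Qed.

(** Expansion about dl in dilated variables: the functional [coefs] picks out the derivative divided
    by kap!, with the scaling factor of its weight. *)
Lemma coefs_peval_affine (a : {ffun I -> 'I_N.+1} -> R) kap t (dl : I -> R) :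
  coefs (N := N) node (fun u => peval a (fun i => dil t u i + dl i)) kap * \prod_i (kap i)`!%:R =
  t ^+ wdeg kap * dpeval a kap dl.
Proof.
have -> : (fun u => peval a (fun i => dil t u i + dl i)) =
    fun u => \sum_mu a mu * \prod_i ((t ^+ wt i *: 'X + (dl i)%:P) ^+ mu i).[u i].
  apply/funext => u; apply: eq_bigr => mu _; congr (_ * _); apply: eq_bigr => i _.
  by rewrite horner_exp hornerD hornerZ hornerX hornerC.
rewrite coefs_sum mulr_suml /dpeval mulr_sumr; apply: eq_bigr => mu _.
rewrite (coefs_prod node_inj); last first.
  move=> i; apply: (leq_trans (size_poly_exp_leq _ _)); rewrite ltnS.
  have h : ((size (t ^+ wt i *: 'X + (dl i)%:P)%R).-1 <= 1)%N.
    have : (size (t ^+ wt i *: 'X + (dl i)%:P)%R <= 2)%N.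
      apply: (leq_trans (size_polyD _ _)); rewrite geq_max.
      rewrite (leq_trans (size_scale_leq _ _)) ?size_polyX//=.
      by apply: (leq_trans (size_polyC_leq1 _)).
    by case: (size _).
  by apply: (leq_trans (leq_mul h (leqnn _))); rewrite mul1n -ltnS.
rewrite [in RHS]mulrCA -mulrA; congr (_ * _).
rewrite /wdeg -prodrXr -!big_split /=; apply: eq_bigr => i _.
by rewrite coef_affine_exp exprM -bin_ffact natrM; ring.
Qed.

(** Both polynomials approximate the same function on the dilated grid up to C t^m w(t), so their
    values there differ by at most 2 C t^m w(t), and [coefs_le] passes this on to the
    derivatives. *)
Lemma tracks_compare g1 g2 a1 a2 (dl : I -> R) t kap : tracks a1 g1 -> tracks a2 g2 ->
  (forall h, g2 h = g1 (h + vec dl)) -> 0 < t -> t <= 1 -> t <= T ->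
  (forall i, `|dl i| <= rho / 2 * t ^+ p) ->
  t ^+ wdeg kap * `|dpeval a1 kap dl - dpeval a2 kap (fun=> 0)| <=
  \prod_i (kap i)`!%:R * (lebesgue_cst (N := N) node * (2 * C)) * (t ^+ m * w t).
Proof.
move=> h1 h2 hg t0 t1 tT hdl.
have tw0 : 0 < t ^+ wdeg kap by rewrite exprn_gt0.
have r0 := box_radius_gt0; have r1 := box_radius_le1.
rewrite -{1}(gtr0_norm tw0) -normrM mulrBr -!coefs_peval_affine -mulrBl -coefsB normrM mulrC.
have f0 : 0 <= \prod_i (kap i)`!%:R :> R by rewrite prodr_ge0.
rewrite (ger0_norm f0) -!mulrA; apply: ler_wpM2l => //.
have -> : 2 * (C * (t ^+ m * w t)) = C * (t ^+ m * w t) + C * (t ^+ m * w t) by ring.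
apply: (coefs_le node_inj) => nu.
set u := grid node nu.
have ub := box_grid nu.
(* The displacement is absorbed into the box parameter: dl / t^(wt i) is at most rho / 2, because wt
   i <= p and t <= 1. *)
pose u' i := u i + dl i / t ^+ wt i.
have eu : (fun i => dil t u i + dl i) = dil t u'.
  by apply/funext => i; rewrite /dil /u' mulrDr mulrCA divff ?mulr1// lt0r_neq0// exprn_gt0.
have hd i : `|dl i / t ^+ wt i| <= rho / 2.
  rewrite normrM normfV (gtr0_norm (exprn_gt0 _ t0)) ler_pdivrMr ?exprn_gt0//.
  apply: (le_trans (hdl i)); rewrite ler_wpM2l ?divr_ge0 ?(ltW r0)//.
  by apply: ler_wiXn2l; rewrite ?wt_le// ltW.
have ub' i : box i (u' i).
  have kN : (nu i <= N)%N by rewrite -ltnS.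
  have := hd i; rewrite /box /u' /u /grid; have [il|il] := eqVneq i last => /=.
    rewrite ler_norml => /andP[h3 h4].
    move: kN h3 h4; rewrite il => kN; have [h5 h6] := node_last kN.
    by move=> h3 h4; split; lra.
  have := node_half il kN => h3 h4.
  by apply: (le_trans (ler_normD _ _)); lra.
have H1 := h1 _ _ ub' (ltW t0) tT.
have H2 := h2 _ _ ub (ltW t0) tT.
have e2 : (fun i => dil t u i + 0) = dil t u by apply/funext => i; rewrite addr0.
rewrite e2 eu; rewrite hg in H2.
have ev : vec (dil t u) + vec dl = vec (dil t u').
  by rewrite -eu; apply/matrixP => i j; rewrite !mxE.
rewrite ev in H2; set G := g1 _ in H1 H2.
have -> : peval a1 (dil t u') - peval a2 (dil t u) =
  (G - peval a2 (dil t u)) - (G - peval a1 (dil t u')) by ring.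
apply: (le_trans (ler_normB _ _)); exact: lerD.
Qed.

End Anisotropic.

(** * First and second order Taylor estimates for the derivatives of polynomials *)

Section DpevalTaylor.
Context {R : realType} {d m : nat}.
Local Notation I := 'I_d.+1.
Local Notation N := (3 * m)%N.
Implicit Types (kap : I -> nat) (dl : I -> R) (a : {ffun I -> 'I_N.+1} -> R).

(** The summand is written in this order so that incrementing the multi-index of a tuple is
    convertible to counting in the tuple with j put in front. *)
Definition inc kap (j : I) : I -> nat := fun i => ((j == i) + kap i)%N.

Definition dmonom (mu : I -> nat) kap dl : R := \prod_i (((mu i) ^_ (kap i))%:R * dl i ^+ (mu i - kap i)).

Definition dcst kap : R := \sum_(mu : {ffun I -> 'I_N.+1}) \prod_i ((mu i) ^_ (kap i))%:R.

Lemma dcst_ge0 kap : 0 <= dcst kap.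
Proof. by rewrite sumr_ge0// => mu _; rewrite prodr_ge0. Qed.

Lemma dmonom0 mu kap dl i : (mu i < kap i)%N -> dmonom mu kap dl = 0.
Proof. by move=> h; rewrite /dmonom (bigD1 i)//= ffact_small// !mul0r. Qed.

Lemma dmonom_at0 mu kap i : (kap i < mu i)%N -> dmonom mu kap (fun=> 0) = 0.
Proof.
by move=> h; rewrite /dmonom (bigD1 i)//= expr0n gtn_eqF ?subn_gt0// mulr0 mul0r.
Qed.

Lemma dmonom_le mu kap dl (eta : R) k : 0 <= eta -> eta <= 1 -> (forall i, `|dl i| <= eta) ->
  (k <= \sum_i (mu i - kap i))%N ->
  `|dmonom mu kap dl| <= \prod_i ((mu i) ^_ (kap i))%:R * eta ^+ k.
Proof.
move=> e0 e1 hdl hk; rewrite /dmonom big_split /= normrM ger0_norm ?prodr_ge0//.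
apply: ler_wpM2l; first by rewrite prodr_ge0.
apply: (@le_trans _ _ (eta ^+ \sum_i (mu i - kap i)%N)); last by apply: ler_wiXn2l.
rewrite -prodrXr normr_prod; apply: ler_prod => i _; rewrite normr_ge0 normrX /=.
by apply: lerXn2r; rewrite ?nnegrE.
Qed.

Lemma dmonom_taylor1 mu kap dl (eta : R) : 0 <= eta -> eta <= 1 -> (forall i, `|dl i| <= eta) ->
  `|dmonom mu kap dl - dmonom mu kap (fun=> 0)| <= \prod_i ((mu i) ^_ (kap i))%:R * eta.
Proof.
move=> e0 e1 hdl; have p0 : 0 <= \prod_i ((mu i) ^_ (kap i))%:R * eta by rewrite mulr_ge0// prodr_ge0.
have [[i hi]|H] := pselect (exists i, (mu i < kap i)%N); first by rewrite !(dmonom0 _ hi) subrr normr0.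
have {}H i : (kap i <= mu i)%N by rewrite leqNgt; apply/negP => h; apply: H; exists i.
have [s0|s0] := eqVneq (\sum_i (mu i - kap i))%N 0%N.
  have mk i : (mu i - kap i)%N = 0%N.
    by apply/eqP; move/eqP: s0; rewrite sum_nat_eq0 => /forallP/(_ i).
  have -> : dmonom mu kap dl = dmonom mu kap (fun=> 0) by apply: eq_bigr => i _; rewrite mk !expr0.
  by rewrite subrr normr0.
have [i hi] : exists i, (kap i < mu i)%N.
  apply: contrapT => H2; move/eqP: s0; apply; rewrite big1// => i _; apply/eqP.
  by rewrite subn_eq0 leqNgt; apply/negP => h; apply: H2; exists i.
rewrite (dmonom_at0 hi) subr0 -[X in _ * X]expr1; apply: dmonom_le => //.
by rewrite lt0n.
Qed.

(** After differentiation a monomial of degree 0 or 1 equals its first-order expansion; for degree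
    at least 2 the expansion at 0 is zero and the monomial itself is O(eta^2). *)
Lemma dmonom_taylor2 mu kap dl (eta : R) : 0 <= eta -> eta <= 1 -> (forall i, `|dl i| <= eta) ->
  `|dmonom mu kap dl - dmonom mu kap (fun=> 0) - \sum_j dl j * dmonom mu (inc kap j) (fun=> 0)|
  <= \prod_i ((mu i) ^_ (kap i))%:R * eta ^+ 2.
Proof.
move=> e0 e1 hdl; have p0 : 0 <= \prod_i ((mu i) ^_ (kap i))%:R * eta ^+ 2.
  by rewrite mulr_ge0 ?exprn_ge0// prodr_ge0.
have [[i hi]|H] := pselect (exists i, (mu i < kap i)%N).
  rewrite !(dmonom0 _ hi) subrr sub0r big1 ?oppr0 ?normr0// => j _.
  by rewrite (@dmonom0 _ _ _ i) ?mulr0// /inc; apply: leq_trans hi _; rewrite leq_addl.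
have {}H i : (kap i <= mu i)%N by rewrite leqNgt; apply/negP => h; apply: H; exists i.
have incz j : mu j = kap j -> dmonom mu (inc kap j) (fun=> 0) = 0.
  by move=> h; apply: (@dmonom0 _ _ _ j); rewrite /inc eqxx h add1n.
have [s0|s0] := eqVneq (\sum_i (mu i - kap i))%N 0%N.
  have mk i : (mu i - kap i)%N = 0%N.
    by apply/eqP; move/eqP: s0; rewrite sum_nat_eq0 => /forallP/(_ i).
  have -> : dmonom mu kap dl = dmonom mu kap (fun=> 0) by apply: eq_bigr => i _; rewrite mk !expr0.
  rewrite subrr sub0r big1 ?oppr0 ?normr0// => j _; rewrite incz ?mulr0//.
  by apply/eqP; rewrite eqn_leq H andbT -subn_eq0 mk.
have [i hi] : exists i, (kap i < mu i)%N.
  apply: contrapT => H2; move/eqP: s0; apply; rewrite big1// => i _; apply/eqP.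
  by rewrite subn_eq0 leqNgt; apply/negP => h; apply: H2; exists i.
rewrite (dmonom_at0 hi) subr0.
have [s1|s1] := leqP 2 (\sum_i (mu i - kap i)).
  rewrite big1 ?subr0; first exact: dmonom_le.
  move=> j _; have [h|h] := leqP (mu j) (kap j).
    by rewrite incz ?mulr0//; apply/eqP; rewrite eqn_leq h H.
  have [k hk] : exists k, (inc kap j k < mu k)%N.
    apply: contrapT => H2; move: s1; rewrite ltnNge => /negP; apply.
    have mle k : (mu k - kap k <= (j == k))%N.
      rewrite leq_subLR addnC leqNgt; apply/negP => h'; apply: H2; exists k.
      exact: h'.
    apply: (@leq_trans (\sum_k (j == k))%N); first by apply: leq_sum => k _; exact: mle.
    rewrite (bigD1 j)//= eqxx big1 ?addn0// => k /negPf; by rewrite eq_sym => ->.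
  by rewrite (dmonom_at0 hk) mulr0.
have s1' : (\sum_i (mu i - kap i))%N = 1%N.
  by apply/eqP; rewrite eqn_leq -ltnS s1 lt0n.
have hoth : (mu i - kap i)%N = 1%N /\ forall k, k != i -> mu k = kap k.
  move: s1'; rewrite (bigD1 i)//=; set S := (\sum_(k | _) _)%N => hS.
  have h1 : (0 < mu i - kap i)%N by rewrite subn_gt0.
  have S0 : S = 0%N by lia.
  split; first by lia.
  move=> k ki; apply/eqP; rewrite eqn_leq H andbT -subn_eq0.
  by move/eqP: S0; rewrite sum_nat_eq0 => /forallP/(_ k); rewrite ki.
have [hi1 ho] := hoth.
rewrite (bigD1 i)//= [X in _ - (_ + X)]big1 ?addr0; last by move=> k ki; rewrite incz ?mulr0// ho.
suff -> : dl i * dmonom mu (inc kap i) (fun=> 0) = dmonom mu kap dl by rewrite subrr normr0.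
rewrite /dmonom (bigD1 i)//= [RHS](bigD1 i)//= mulrA; congr (_ * _).
  rewrite /inc eqxx hi1 expr1 add1n ffactnSr hi1 muln1.
  have -> : (mu i - (kap i).+1 = 0)%N by rewrite subnS hi1.
  by rewrite expr0 mulr1 mulrC.
apply: eq_bigr => k ki; rewrite /inc eq_sym (negPf ki) add0n ho// subnn !expr0.
by [].
Qed.

Lemma dpevalE a kap dl : dpeval a kap dl = \sum_mu a mu * dmonom (fun i => mu i) kap dl.
Proof. by []. Qed.

Lemma dpeval_taylor1 a kap dl (A eta : R) : (forall mu, `|a mu| <= A) -> 0 <= eta -> eta <= 1 ->
  (forall i, `|dl i| <= eta) ->
  `|dpeval a kap dl - dpeval a kap (fun=> 0)| <= A * dcst kap * eta.
Proof.
move=> hA e0 e1 hdl; rewrite !dpevalE -sumrB /dcst mulr_sumr mulr_suml.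
apply: (le_trans (ler_norm_sum _ _ _)); apply: ler_sum => mu _.
rewrite -mulrBr normrM -mulrA; apply: ler_pM => //.
exact: dmonom_taylor1.
Qed.

Lemma dpeval_taylor2 a kap dl (A eta : R) : (forall mu, `|a mu| <= A) -> 0 <= eta -> eta <= 1 ->
  (forall i, `|dl i| <= eta) ->
  `|dpeval a kap dl - dpeval a kap (fun=> 0) - \sum_j dl j * dpeval a (inc kap j) (fun=> 0)|
  <= A * dcst kap * eta ^+ 2.
Proof.
move=> hA e0 e1 hdl.
have -> : \sum_j dl j * dpeval a (inc kap j) (fun=> 0) =
    \sum_mu a mu * \sum_j dl j * dmonom (fun i => mu i) (inc kap j) (fun=> 0).
  under eq_bigr do rewrite dpevalE mulr_sumr.
  rewrite exchange_big /=; apply: eq_bigr => mu _; rewrite mulr_sumr.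
  by apply: eq_bigr => j _; rewrite mulrCA.
rewrite !dpevalE -!sumrB /dcst mulr_sumr mulr_suml.
apply: (le_trans (ler_norm_sum _ _ _)); apply: ler_sum => mu _.
rewrite -!mulrBr normrM -mulrA; apply: ler_pM => //.
exact: dmonom_taylor2.
Qed.

Lemma dpeval_le a kap (A : R) : (forall mu, `|a mu| <= A) ->
  `|dpeval a kap (fun=> 0)| <= A * dcst kap.
Proof.
move=> hA; rewrite dpevalE /dcst mulr_sumr.
apply: (le_trans (ler_norm_sum _ _ _)); apply: ler_sum => mu _.
rewrite normrM; apply: ler_pM => //.
have := @dmonom_le (fun i => mu i) kap (fun=> 0) 1 0%N ler01 (lexx _).
by rewrite expr0 mulr1; apply => // i; rewrite normr0.
Qed.

Lemma dpeval_value a : dpeval a (fun=> 0%N) (fun=> 0) = peval a (fun=> 0).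
Proof.
apply: eq_bigr => mu _; congr (_ * _); apply: eq_bigr => i _.
by rewrite ffactn0 mul1r subn0.
Qed.

End DpevalTaylor.

(** * The Euclidean norm *)

Section Enorm.
Context {R : realType}.

Lemma enorm_ge0 n (x : 'cV[R]_n) : 0 <= enorm x.
Proof. exact: sqrtr_ge0. Qed.

Lemma enorm_sq n (x : 'cV[R]_n) : enorm x ^+ 2 = \sum_i x i 0 ^+ 2.
Proof. by rewrite sqr_sqrtr// sumr_ge0// => i _; exact: sqr_ge0. Qed.

Lemma coord_le_enorm n (x : 'cV[R]_n) i : `|x i 0| <= enorm x.
Proof.
rewrite -(sqrtr_sqr (x i 0)) ler_wsqrtr// (bigD1 i)//= lerDl.
by rewrite sumr_ge0// => j _; exact: sqr_ge0.
Qed.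

Lemma enorm_eq0 n (x : 'cV[R]_n) : enorm x = 0 -> x = 0.
Proof.
move=> x0; apply/matrixP => i j; rewrite ord1 mxE; apply/normr0_eq0/le_anti.
by rewrite normr_ge0 andbT -x0 coord_le_enorm.
Qed.

Lemma enormZ n (a : R) (x : 'cV[R]_n) : enorm (a *: x) = `|a| * enorm x.
Proof.
rewrite -(sqrtr_sqr a) /enorm -sqrtrM ?sqr_ge0//; congr Num.sqrt.
by rewrite mulr_sumr; apply: eq_bigr => i _; rewrite mxE exprMn.
Qed.

Lemma enorm_le n (x : 'cV[R]_n) : enorm x <= n%:R * `|x|.
Proof.
rewrite -[leRHS]ger0_norm ?mulr_ge0// -(sqrtr_sqr (n%:R * `|x|)) ler_wsqrtr//.
apply: (@le_trans _ _ (\sum_(i < n) `|x| ^+ 2)).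
  apply: ler_sum => i _; rewrite -real_normK ?num_real//; apply: lerXn2r; rewrite ?nnegrE//.
  exact: coord_le.
rewrite sumr_const card_ord -[leLHS]mulr_natl exprMn ler_wpM2r ?sqr_ge0//.
by rewrite -natrX ler_nat; case: n x => // n _; rewrite expnS expn1 leq_pmulr.
Qed.

Lemma enorm_trmx n (A : 'M[R]_n) (x : 'cV[R]_n) : A *m A^T = 1%:M -> enorm (A^T *m x) = enorm x.
Proof.
move=> AA; congr Num.sqrt.
have H (y : 'cV[R]_n) : \sum_i y i 0 ^+ 2 = (y^T *m y) 0 0.
  by rewrite mxE; apply: eq_bigr => i _; rewrite mxE expr2.
by rewrite !H trmx_mul trmxK -mulmxA (mulmxA A) AA mul1mx.
Qed.

Lemma enormB n (x y : 'cV[R]_n) : enorm (x - y) = enorm (y - x).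
Proof. by congr Num.sqrt; apply: eq_bigr => i _; rewrite !mxE -opprB sqrrN. Qed.

End Enorm.

(** * Derivatives on X *)

Section LocalJets.
Context {R : realType} {d : nat}.
Local Notation E := 'cV[R]_d.+1.
Local Notation I := 'I_d.+1.

(** A modulus cannot decay faster than linearly. This lets the Lipschitz error from recentring a
    polynomial be absorbed into the modulus. *)
Lemma id_le_modulus (w : R -> R) (s : R) : modulus w -> 0 <= s -> s <= 1 -> s * w 1 <= 2 * w s.
Proof.
move=> wm; rewrite le_eqVlt => /orP[/eqP <-|s0] s1; first by rewrite mul0r modulus0 ?mulr0.
have h : w 1 <= (s^-1 + 1) * w s.
  have := modulus_scale wm (ltW (_ : 0 < s^-1)) (ltW s0); rewrite mulVf ?gt_eqF//; apply.
  by rewrite invr_gt0.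
apply: (@le_trans _ _ (s * ((s^-1 + 1) * w s))); first by rewrite ler_pM2l.
rewrite mulrA mulrDr divff ?gt_eqF// mulr1 ler_wpM2r//; last lra.
by apply: (modulus_ge0 wm); exact: ltW.
Qed.

Lemma cancel_power (t x C y : R) (a k m : nat) : 0 < t -> t <= 1 -> 0 <= C -> 0 <= y ->
  (a + k <= m)%N -> t ^+ a * x <= C * (t ^+ m * y) -> x <= C * (t ^+ k * y).
Proof.
move=> t0 t1 C0 y0 akm h; have ta : 0 < t ^+ a by rewrite exprn_gt0.
rewrite -(ler_pM2l ta); apply: (le_trans h).
rewrite [leRHS]mulrCA; apply: ler_wpM2l => //; rewrite mulrA; apply: ler_wpM2r => //.
by rewrite -exprD; apply: ler_wiXn2l => //; exact: ltW.
Qed.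

Lemma wdeg_le p (kap : I -> nat) : (2 <= p)%N -> (wdeg p kap <= p * \sum_i kap i)%N.
Proof.
by move=> p2; rewrite big_distrr /=; apply: leq_sum => i _; rewrite leq_mul2r wt_le// orbT.
Qed.

(** [G y kap] is the derivative of order kap at 0 of the anisotropic polynomial at y, in the
    coordinates of A. A derivative of order j has weight at most p j: for j <= n the comparison of
    two base points leaves w(t), the Hölder estimate; for j < n it leaves t^p w(t), of the order of
    |y - x| w(t), which is differentiability. *)
Lemma local_jets (X Y : set E) (f : E -> R) (n p : nat) (w : R -> R) (x0 : E)
    (A : 'M[R]_d.+1) (c e B : R) :
  (2 <= p)%N -> 0 < c -> 0 < e -> 0 < B -> A *m A^T = 1%:M -> X x0 ->
  cusp_at X p c e B x0 A -> modulus w -> Akw_flat (n * p) w X Y f ->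
  exists (T : R) (G : E -> (I -> nat) -> R), 0 < T /\
  let near_x0 y := X y /\ `|y - x0| <= T in
  let wp x y := w (enorm (y - x) `^ (p%:R^-1)) in
  [/\ forall y, near_x0 y -> G y (fun=> 0%N) = f y,
      forall kap, (\sum_i kap i <= n)%N -> exists2 C : R, 0 < C & forall x y, near_x0 x -> near_x0 y ->
        `|G x kap| <= C /\ `|G y kap - G x kap| <= C * wp x y,
      forall kap, (\sum_i kap i < n)%N -> exists2 C : R, 0 < C & forall x y, near_x0 x -> near_x0 y ->
        `|G y kap - G x kap - \sum_j (A^T *m (y - x)) j 0 * G x (inc kap j)| <=
        C * (enorm (y - x) * wp x y + enorm (y - x) ^+ 2) &
      forall y kap, near_x0 y -> Y y -> G y kap = 0].
Proof.
move=> p2 c0 e_gt0 B0 AA Xx0 XC wm fA; set m := (n * p)%N.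
have p0 : (0 < p)%N by rewrite (leq_trans _ p2).
have [T0 [C0 [T00 C00 UT]]] := uniform_taylor p0 c0 e_gt0 B0 (ler0n R 20) AA Xx0 XC wm fA.
have c40 : 0 < c / 4 by rewrite divr_gt0.
pose g y (h : E) := f (y + A *m h).
have UJ y : X y -> `|y - x0| <= T0 -> uniform_jets m p w (c / 4) 20 T0 C0 (g y) (Y y).
  move=> Xy hy G hG hG0 hc; have [P [sP HP1 HP2 HP3]] := UT y G Xy hy hG hG0 hc.
  by exists P; split => // Yy G0; apply: HP3; rewrite G0 mulmx0 addr0.
have rho0 := @box_radius_gt0 R d (c / 4) c40; have rho1 := @box_radius_le1 R d (c / 4).
set rho := @box_radius R d (c / 4) in rho0 rho1.
pose A0 := lebesgue_cst (N := 3 * m) (@node R d m p (c / 4)) * C0.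
have A00 : 0 <= A0 by rewrite mulr_ge0 ?lebesgue_cst_ge0// ltW.
have /choice[a Ha] : forall y : E, exists a : {ffun I -> 'I_(3 * m).+1} -> R, X y -> `|y - x0| <= T0 ->
    [/\ forall mu, `|a mu| <= A0, tracks p w (c / 4) T0 C0 a (g y) & Y y -> forall mu, a mu = 0].
  move=> y; have [[Xy hy]|H] := pselect (X y /\ `|y - x0| <= T0).
    by have [a Ha] := anisotropic_polynomial p2 c40 T00 C00 wm (UJ y Xy hy); exists a.
  by exists (fun=> 0) => Xy hy; case: H.
pose m1 := Num.min 1 T0.
have m10 : 0 < m1 by rewrite lt_min ltr01.
(* Two points within T of x0 are at Euclidean distance at most 2 (d + 1) T, so t defined by t^p = (2
   / rho) |y - x| is at most min(1, T0). *)
pose T := Num.min T0 (rho * m1 ^+ p / (4 * d.+1%:R)).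
have T_gt0 : 0 < T by rewrite lt_min T00 divr_gt0 ?mulr_gt0 ?exprn_gt0.
have TT0 : T <= T0 by rewrite ge_min lexx.
have TT1 : 4 * d.+1%:R * T <= rho * m1 ^+ p.
  by rewrite mulrC -ler_pdivlMr ?mulr_gt0// ge_min lexx orbT.
(* The ratio of t to |y - x|^(1/p). *)
pose K : R := (2 / rho) `^ (p%:R^-1).
have K0 : 0 <= K by exact: powR_ge0.
exists T, (fun y kap => dpeval (a y) kap (fun=> 0)); split => //=.
have w10 : 0 < w 1 by exact: modulus_gt0.
have eta_le x y : `|x - x0| <= T -> `|y - x0| <= T -> 2 * enorm (y - x) <= rho * m1 ^+ p.
  move=> hx hy; apply: le_trans TT1; apply: (@le_trans _ _ (2 * (d.+1%:R * `|y - x|))).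
    by rewrite ler_pM2l// enorm_le.
  have -> : 4 * d.+1%:R * T = 2 * (d.+1%:R * (T + T)) by ring.
  rewrite ler_pM2l// ler_pM2l//.
  have -> : y - x = (y - x0) - (x - x0) by rewrite opprB addrA subrK.
  by apply: (le_trans (ler_normB _ _)); exact: lerD.
have m1p : m1 ^+ p <= 1 by rewrite exprn_ile1 ?(ltW m10)// ge_min lexx.
have eta1 x y : `|x - x0| <= T -> `|y - x0| <= T -> enorm (y - x) <= 1.
  move=> hx hy; have := eta_le x y hx hy; have : rho * m1 ^+ p <= 1.
    by rewrite mulr_ile1 ?(ltW rho0)// exprn_ge0// ltW.
  lra.
have eta_w x y : `|x - x0| <= T -> `|y - x0| <= T ->
    enorm (y - x) <= 2 / w 1 * w (enorm (y - x) `^ (p%:R^-1)).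
  move=> hx hy; set s := _ `^ _.
  have s1 : s <= 1.
    have -> : 1 = 1 `^ (p%:R^-1) :> R by rewrite powR1.
    apply: ge0_ler_powR; rewrite ?nnegrE ?enorm_ge0 ?invr_ge0 ?ler0n//.
    exact: eta1.
  have sp : s ^+ p = enorm (y - x).
    by rewrite -powR_mulrn ?powR_ge0// -powRrM mulVf ?pnatr_eq0 ?gtn_eqF// powRr1 ?enorm_ge0.
  have := id_le_modulus wm (powR_ge0 _ _) s1.
  rewrite -ler_pdivlMr// mulrAC -/s => h; apply: le_trans _ h.
  by rewrite -sp -[leRHS]expr1; apply: ler_wiXn2l => //; exact: powR_ge0.
have dl_le x y i : `|(A^T *m (y - x)) i 0| <= enorm (y - x).
  by rewrite -(enorm_trmx _ AA); exact: coord_le_enorm.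
have fact0 kap : 0 <= \prod_(i < d.+1) (kap i)`!%:R :> R by rewrite prodr_ge0.
pose CK kap := \prod_(i < d.+1) (kap i)`!%:R * (lebesgue_cst (N := 3 * m) (@node R d m p (c / 4)) * (2 * C0)) : R.
have CK0 kap : 0 <= CK kap by rewrite mulr_ge0// mulr_ge0 ?lebesgue_cst_ge0// mulr_ge0// ltW.
have cmp x y kap k : X x -> X y -> `|x - x0| <= T -> `|y - x0| <= T -> 
    (wdeg p kap + k <= m)%N -> enorm (y - x) != 0 -> exists t, [/\ 0 < t, t <= 1, t ^+ p = 2 / rho * enorm (y - x),
     w t <= (K + 1) * w (enorm (y - x) `^ (p%:R^-1)) &
    `|dpeval (a x) kap (fun i => (A^T *m (y - x)) i 0) - dpeval (a y) kap (fun=> 0)| <=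
     CK kap * (t ^+ k * w t)].
  move=> Xx Xy hx hy km eta0.
  have et0 : 0 < enorm (y - x) by rewrite lt_def eta0 enorm_ge0.
  pose t := (2 / rho * enorm (y - x)) `^ (p%:R^-1).
  have q0 : 0 < 2 / rho * enorm (y - x) by rewrite mulr_gt0 ?divr_gt0.
  have t0 : 0 < t by rewrite powR_gt0.
  have tp : t ^+ p = 2 / rho * enorm (y - x).
    by rewrite -powR_mulrn ?powR_ge0// -powRrM mulVf ?pnatr_eq0 ?gtn_eqF// powRr1 ?ltW.
  have tm : t <= m1.
    rewrite -(@ler_pXn2r _ p) ?nnegrE ?(ltW t0) ?(ltW m10)// tp mulrAC ler_pdivrMr// mulrC [leRHS]mulrC.
    by rewrite mulrC; exact: eta_le.
  have [t1 tT] : t <= 1 /\ t <= T0 by move: tm; rewrite le_min => /andP[].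
  exists t; split => //.
    have -> : t = K * (enorm (y - x) `^ (p%:R^-1)) by rewrite /t powRM ?enorm_ge0// ltW// divr_gt0.
    by apply: (modulus_scale wm); rewrite ?powR_ge0.
  have [_ tx _] := Ha x Xx (le_trans hx TT0).
  have [_ ty _] := Ha y Xy (le_trans hy TT0).
  apply: (cancel_power t0 t1 _ _ km) => //; first by apply: (modulus_ge0 wm); exact: ltW.
  apply: (tracks_compare p2 c40 kap tx ty _ t0 t1 tT).
    move=> h; rewrite /g; congr f.
    have -> : vec (fun i => (A^T *m (y - x)) i 0) = A^T *m (y - x).
      by apply/matrixP => i j; rewrite ord1 mxE.
    by rewrite mulmxDr mulmxA AA mul1mx addrCA [_ + (y - x)]addrC addrA addrA subrK addrC.
  move=> i; rewrite tp -/rho; have -> : rho / 2 * (2 / rho * enorm (y - x)) = enorm (y - x).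
    by field; rewrite gt_eqF.
  exact: dl_le.
split.
- move=> y [Xy hy]; rewrite dpeval_value.
  have [_ ty _] := Ha y Xy (le_trans hy TT0).
  by rewrite (peval0 p2 c40 T00 wm ty) /g mulmx0 addr0.
- move=> kap kn; pose D := A0 * @dcst R d m kap.
  have D0 : 0 <= D by rewrite mulr_ge0// dcst_ge0.
  have S0 : 0 <= D + D * (2 / w 1) + CK kap * (K + 1).
    by rewrite !addr_ge0// mulr_ge0// ?addr_ge0// divr_ge0// ltW.
  exists (1 + (D + D * (2 / w 1) + CK kap * (K + 1))); first by rewrite ltr_pwDl.
  move=> x y [Xx hx] [Xy hy]; have [ax _ _] := Ha x Xx (le_trans hx TT0).
  have h2 : 0 <= D * (2 / w 1) by rewrite mulr_ge0// divr_ge0// ltW.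
  have h3 : 0 <= CK kap * (K + 1) by rewrite mulr_ge0// addr_ge0.
  split; first by apply: (le_trans (dpeval_le kap ax)); rewrite -/D; lra.
  have [eta0|eta0] := eqVneq (enorm (y - x)) 0.
    have -> : y = x by apply/subr0_eq/enorm_eq0.
    rewrite !subrr normr0 mulr_ge0 ?addr_ge0//.
    by apply: (modulus_ge0 wm); exact: powR_ge0.
  have km : (wdeg p kap + 0 <= m)%N.
    by rewrite addn0 (leq_trans (wdeg_le _ p2))// /m mulnC leq_mul2r kn orbT.
  have [t [t0 t1 tp wt h]] := cmp x y kap 0%N Xx Xy hx hy km eta0.
  have h1 := dpeval_taylor1 kap ax (enorm_ge0 (y - x)) (eta1 _ _ hx hy) (dl_le x y).
  rewrite -/D in h1.
  set wv := w (_ `^ _) in wt *.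
  have wv0 : 0 <= wv by apply: (modulus_ge0 wm); exact: powR_ge0.
  have h4 := eta_w x y hx hy; rewrite -/wv in h4.
  set gx := dpeval (a x) kap (fun=> 0) in h1 *.
  set gxd := dpeval (a x) kap _ in h h1.
  have -> : dpeval (a y) kap (fun=> 0) - gx = (gxd - gx) - (gxd - dpeval (a y) kap (fun=> 0)) by ring.
  apply: (le_trans (ler_normB _ _)).
  apply: (@le_trans _ _ (D * (2 / w 1) * wv + CK kap * (K + 1) * wv)).
    apply: lerD; first by apply: (le_trans h1); rewrite -mulrA ler_wpM2l.
    by apply: (le_trans h); rewrite expr0 mul1r -mulrA ler_wpM2l.
  rewrite -mulrDl ler_wpM2r//; move: D0 h2 h3; set P := D * _; set Q := CK kap * _; lra.
- move=> kap kn; pose D := A0 * @dcst R d m kap.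
  have D0 : 0 <= D by rewrite mulr_ge0// dcst_ge0.
  have S1 : 0 <= CK kap * (K + 1) * (2 / rho).
    by rewrite mulr_ge0// ?divr_ge0 ?(ltW rho0)// mulr_ge0// addr_ge0.
  exists (1 + (D + CK kap * (K + 1) * (2 / rho))); first by rewrite ltr_pwDl ?addr_ge0.
  move=> x y [Xx hx] [Xy hy]; have [ax _ _] := Ha x Xx (le_trans hx TT0).
  set wv := w (_ `^ _).
  have wv0 : 0 <= wv by apply: (modulus_ge0 wm); exact: powR_ge0.
  have R0 : 0 <= enorm (y - x) * wv by rewrite mulr_ge0 ?enorm_ge0.
  have R1 : 0 <= enorm (y - x) ^+ 2 by exact: sqr_ge0.
  have P0 : 0 <= (1 + (D + CK kap * (K + 1) * (2 / rho))) * (enorm (y - x) * wv + enorm (y - x) ^+ 2).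
    by rewrite mulr_ge0// !addr_ge0.
  have [eta0|eta0] := eqVneq (enorm (y - x)) 0.
    have yx : y - x = 0 by exact: enorm_eq0.
    move: P0; rewrite (subr0_eq yx) !subrr mulmx0 big1 => [|j _]; last by rewrite mxE mul0r.
    by rewrite subrr normr0.
  have km : (wdeg p kap + p <= m)%N.
    rewrite (@leq_trans (p * (\sum_i kap i).+1))//.
      by rewrite mulnS addnC leq_add2l wdeg_le.
    by rewrite /m mulnC leq_mul2r kn orbT.
  have [t [t0 t1 tp wt h]] := cmp x y kap p Xx Xy hx hy km eta0.
  have h1 := dpeval_taylor2 kap ax (enorm_ge0 (y - x)) (eta1 _ _ hx hy) (dl_le x y).
  rewrite -/D in h1; rewrite -/wv in wt.
  set gx := dpeval (a x) kap (fun=> 0) in h1 *.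
  set gxd := dpeval (a x) kap _ in h h1.
  set Sm := \sum_j _ in h1 *.
  have -> : dpeval (a y) kap (fun=> 0) - gx - Sm =
    (gxd - gx - Sm) - (gxd - dpeval (a y) kap (fun=> 0)) by ring.
  apply: (le_trans (ler_normB _ _)).
  apply: (@le_trans _ _ (D * enorm (y - x) ^+ 2 + CK kap * (K + 1) * (2 / rho) * (enorm (y - x) * wv))).
    apply: lerD => //; apply: (le_trans h); rewrite tp.
    have -> : CK kap * (K + 1) * (2 / rho) * (enorm (y - x) * wv) =
      CK kap * (2 / rho * enorm (y - x) * ((K + 1) * wv)) by ring.
    rewrite ler_wpM2l// ler_wpM2l// mulr_ge0 ?enorm_ge0// divr_ge0// ltW//.
  set P1 := CK kap * _ * _ in S1 *; set Q1 := enorm (y - x) * wv in R0 *; set Q2 := _ ^+ 2 in R1 *.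
  rewrite addrC mulrDr; apply: lerD; apply: ler_wpM2r => //; lra.
- move=> y kap [Xy hy] Yy; have [_ _ H] := Ha y Xy (le_trans hy TT0).
  by rewrite /dpeval big1// => mu _; rewrite (H Yy) mul0r.
Qed.

End LocalJets.

(** * Jets as multilinear forms, and Fréchet differentiability near a point *)

Section JetForms.
Context {R : realType} {d : nat}.
Local Notation E := 'cV[R]_d.+1.
Local Notation I := 'I_d.+1.
Implicit Types (G : (I -> nat) -> R) (A : 'M[R]_d.+1) (x : E).

Definition mult j (phi : j.-tuple I) : I -> nat := fun i => count_mem i phi.

Lemma sum_mult j (phi : j.-tuple I) : (\sum_i mult phi i)%N = j.
Proof.
rewrite /mult -[RHS](size_tuple phi); elim: (phi : seq I) => [|i s IH] /=.
  by rewrite big1.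
rewrite big_split /= IH -[RHS]add1n; congr addn.
by rewrite (bigD1 i)//= eqxx big1 ?addn0// => k /negPf; rewrite eq_sym => ->.
Qed.

Lemma sum_tuple_cons j (F : j.+1.-tuple I -> R) :
  \sum_phi F phi = \sum_i \sum_(psi : j.-tuple I) F [tuple of i :: psi].
Proof.
rewrite pair_bigA /= (reindex (fun u : I * j.-tuple I => [tuple of u.1 :: u.2]))//=.
exists (fun t : j.+1.-tuple I => (thead t, [tuple of behead t])) => [[i psi] _|t _] /=.
  by congr (_, _); apply/val_inj.
by rewrite -tuple_eta.
Qed.

(* The symmetric form with components G kap in the basis of the columns of A. *)
Definition jform A G j (v : j.-tuple E) : R :=
  \sum_(phi : j.-tuple I) G (mult phi) * \prod_l (A^T *m tnth v l) (tnth phi l) 0.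

Lemma jform_multilinear A G j : multilinear (@jform A G j).
Proof.
move=> v i a x y.
have H z : jform A G (tset v i z) = \sum_(phi : j.-tuple I) G (mult phi) *
    ((A^T *m z) (tnth phi i) 0 * \prod_(l | l != i) (A^T *m tnth v l) (tnth phi l) 0).
  apply: eq_bigr => phi _; congr (_ * _); rewrite (bigD1 i)//= tnth_mktuple eqxx; congr (_ * _).
  by apply: eq_bigr => l /negPf li; rewrite tnth_mktuple li.
rewrite !H mulr_sumr -big_split /=; apply: eq_bigr => phi _.
by rewrite mulmxDr -scalemxAr !mxE; ring.
Qed.

Definition jet_mlin A G j : mlin j := MLin (@jform_multilinear A G j).

Lemma jformB A G1 G2 j (v : j.-tuple E) :
  jform A G1 v - jform A G2 v = jform A (fun k => G1 k - G2 k) v.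
Proof. by rewrite /jform -sumrB; apply: eq_bigr => phi _; rewrite mulrBl. Qed.

Lemma jform_cons A G j (h : E) (v : j.-tuple E) :
  jform A G [tuple of h :: v] = jform A (fun k => \sum_i (A^T *m h) i 0 * G (inc k i)) v.
Proof.
rewrite /jform sum_tuple_cons exchange_big /=; apply: eq_bigr => psi _.
rewrite mulr_suml; apply: eq_bigr => i _.
have -> : mult [tuple of i :: psi] = inc (mult psi) i by [].
rewrite big_ord_recl !tnth0 mulrA [G _ * _]mulrC; congr (_ * _).
by apply: eq_bigr => l _; rewrite !tnthS.
Qed.

Lemma near0_enorm (r : R) : 0 < r -> \forall h \near (0 : E), enorm h < r.
Proof.
move=> r0; apply/nbhs_ballP; exists (r / (d.+1%:R + 1)) => /=; first by rewrite divr_gt0// ltr_wpDl.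
move=> h; rewrite -ball_normE /= sub0r normrN ltr_pdivlMr ?ltr_wpDl// => hr.
apply: (le_lt_trans (enorm_le h)); apply: le_lt_trans hr.
by rewrite mulrC ler_wpM2l// lerDl.
Qed.

Lemma near_shift0 (x : E) (P : E -> Prop) : (\forall y \near x, P y) ->
  \forall h \near (0 : E), P (x + h).
Proof.
move=> /nbhs_ballP[r /= r0 Hr]; apply/nbhs_ballP; exists r => // h.
rewrite -ball_normE /= sub0r normrN => hr; apply: Hr; rewrite -ball_normE /=.
by rewrite opprD addrA subrr sub0r normrN.
Qed.

Lemma local_extension (X Y : set E) (f : E -> R) (n p : nat) (w : R -> R) (x0 : E)
    (A : 'M[R]_d.+1) (c e B : R) :
  (2 <= p)%N -> 0 < c -> 0 < e -> 0 < B -> A *m A^T = 1%:M -> X x0 ->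
  cusp_at X p c e B x0 A -> modulus w -> Akw_flat (n * p) w X Y f ->
  exists (T : R) (F : forall j, E -> mlin j), 0 < T /\
  let near_x0 y := X y /\ `|y - x0| <= T in
  [/\ forall y v, near_x0 y -> F 0%N y v = f y,
      forall j x, (j < n)%N -> X° x -> `|x - x0| < T -> is_frechet (F j) x (F j.+1 x),
      forall j, (j <= n)%N -> exists2 C : R, 0 < C & forall x y, near_x0 x -> near_x0 y ->
        opnorm_le (F j x) C /\
        opnorm_le (fun v => F j x v - F j y v) (C * w (enorm (x - y) `^ (p%:R^-1))) &
      forall j y v, near_x0 y -> Y y -> F j y v = 0].
Proof.
move=> p2 c0 e_gt0 B0 AA Xx0 XC wm fA.
have [T [G [T0 /= [G0 G1 G2 GY]]]] := local_jets p2 c0 e_gt0 B0 AA Xx0 XC wm fA.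
exists T, (fun j y => jet_mlin A (G y) j); split => //=; split.
- move=> y v ny /=; rewrite /jform (bigD1 [tuple])//= big_ord0 mulr1 big1 ?addr0.
    by rewrite -(G0 y ny); congr (G y _); apply/funext => i.
  by move=> phi /eqP[]; exact: tuple0.
- move=> j x jn Xx hx eps eps0.
  have /choice[C HC] : forall phi : j.-tuple I, exists C : R, 0 < C /\
     forall x y, X x /\ `|x - x0| <= T -> X y /\ `|y - x0| <= T ->
     `|G y (mult phi) - G x (mult phi) - \sum_i (A^T *m (y - x)) i 0 * G x (inc (mult phi) i)| <=
        C * (enorm (y - x) * w (enorm (y - x) `^ p%:R^-1) + enorm (y - x) ^+ 2).
    by move=> phi; have [|C C0 HC] := G2 (mult phi); [rewrite sum_mult|exists C].
  (* The estimates hold with one constant per tuple of indices; the sum over tuples bounds the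
     operator norm, because A is orthogonal and coordinates are at most the norm. *)
  pose K := 1 + \sum_phi C phi.
  have K0 : 0 < K by rewrite ltr_pwDl// sumr_ge0// => phi _; have [/ltW] := HC phi.
  have e2 : 0 < eps / K / 2 by rewrite !divr_gt0.
  have [T1 T10 HT1] := modulus_small wm e2.
  have nx : X x /\ `|x - x0| <= T by split; [exact: interior_subset|exact: ltW].
  near=> h; move=> v /=.
  have nxh : X (x + h) /\ `|x + h - x0| <= T.
    near: h; apply: near_shift0 (fun y => X y /\ `|y - x0| <= T) _.
    near=> y; split.
      by apply: interior_subset; near: y; apply: open_nbhs_nbhs; split => //; exact: open_interior.
    apply/ltW; near: y; apply/nbhs_ballP; exists (T - `|x - x0|) => /=; first by rewrite subr_gt0.
    move=> y; rewrite -ball_normE /= => hy.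
    have -> : y - x0 = (x - x0) - (x - y) by rewrite opprB [RHS]addrC subrKA.
    by apply: (le_lt_trans (ler_normB _ _)); rewrite -ltrBrDl.
  (* Half of the allowed error goes to |h|^2, controlled here, and half to |h| w(|h|^(1/p)),
     controlled by the next bound. *)
  have hE : enorm h < eps / K / 2 by near: h; exact: near0_enorm.
  have hE2 : enorm h < T1 ^+ p by near: h; apply: near0_enorm; rewrite exprn_gt0.
  rewrite jform_cons !jformB.
  have xh : x + h - x = h by rewrite addrAC subrr add0r.
  pose bd := enorm h * w (enorm h `^ p%:R^-1) + enorm h ^+ 2.
  have bd0 : 0 <= bd.
    by rewrite addr_ge0 ?sqr_ge0// mulr_ge0 ?enorm_ge0// (modulus_ge0 wm)// powR_ge0.
  have bdl : bd <= eps / K * enorm h.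
    have -> : eps / K * enorm h = enorm h * (eps / K / 2) + enorm h * (eps / K / 2) by field; rewrite gt_eqF.
    apply: lerD; last by rewrite expr2 ler_wpM2l ?enorm_ge0// ltW.
    apply: ler_wpM2l; rewrite ?enorm_ge0//; apply: HT1; first exact: powR_ge0.
    have p0 : (0 < p)%N by rewrite (leq_trans _ p2).
    rewrite -(@ler_pXn2r _ p) ?nnegrE ?powR_ge0 ?(ltW T10)//.
    rewrite -powR_mulrn ?powR_ge0// -powRrM mulVf ?pnatr_eq0 ?gtn_eqF// powRr1 ?enorm_ge0//.
    exact: ltW.
  have prod0 : 0 <= \prod_(i < j) enorm (tnth v i) by rewrite prodr_ge0// => i _; exact: enorm_ge0.
  have -> : jform A (fun k => G (x + h) k - G x k - \sum_i (A^T *m h) i 0 * G x (inc k i)) v =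
     \sum_(phi : j.-tuple I) (G (x + h) (mult phi) - G x (mult phi) -
        \sum_i (A^T *m h) i 0 * G x (inc (mult phi) i)) *
       \prod_l (A^T *m tnth v l) (tnth phi l) 0 by [].
  apply: (@le_trans _ _ ((\sum_phi C phi * bd) * \prod_(i < j) enorm (tnth v i))).
    rewrite mulr_suml; apply: (le_trans (ler_norm_sum _ _ _)); apply: ler_sum => phi _.
    rewrite normrM; apply: ler_pM => //.
      by have [_ /(_ _ _ nx nxh)] := HC phi; rewrite xh.
    rewrite normr_prod; apply: ler_prod => l _; rewrite normr_ge0 /=.
    by rewrite -(enorm_trmx _ AA); exact: coord_le_enorm.
  apply: ler_wpM2r => //; rewrite -mulr_suml.
  apply: (@le_trans _ _ (K * bd)); first by rewrite ler_wpM2r// lerDr.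
  by rewrite mulrC -ler_pdivlMr// mulrAC.
- move=> j jn.
  have /choice[C HC] : forall phi : j.-tuple I, exists C : R, 0 < C /\
     forall x y, X x /\ `|x - x0| <= T -> X y /\ `|y - x0| <= T ->
     `|G x (mult phi)| <= C /\
     `|G y (mult phi) - G x (mult phi)| <= C * w (enorm (y - x) `^ p%:R^-1).
    by move=> phi; have [|C C0 HC] := G1 (mult phi); [rewrite sum_mult|exists C].
  have C0 : 0 <= \sum_phi C phi by rewrite sumr_ge0// => phi _; have [/ltW] := HC phi.
  exists (1 + \sum_phi C phi); first by rewrite ltr_pwDl.
  move=> x y nx ny; have key (H : j.-tuple I -> R) (b : R) v : 0 <= b ->
      (forall phi, `|H phi| <= C phi * b) ->
      `|\sum_phi H phi * \prod_l (A^T *m tnth v l) (tnth phi l) 0| <=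
      (1 + \sum_phi C phi) * b * \prod_(i < j) enorm (tnth v i).
    move=> b0 Hb; apply: (le_trans (ler_norm_sum _ _ _)).
    apply: (@le_trans _ _ ((\sum_phi C phi * b) * \prod_(i < j) enorm (tnth v i))).
      rewrite mulr_suml; apply: ler_sum => phi _; rewrite normrM; apply: ler_pM => //.
      rewrite normr_prod; apply: ler_prod => l _; rewrite normr_ge0 /=.
      by rewrite -(enorm_trmx _ AA); exact: coord_le_enorm.
    apply: ler_wpM2r; first by rewrite prodr_ge0// => i _; exact: enorm_ge0.
    by rewrite -mulr_suml ler_wpM2r// lerDr.
  split=> v.
    have := key (fun phi => G x (mult phi)) 1 v ler01; rewrite mulr1; apply => phi.
    by rewrite mulr1; have [_ /(_ _ _ nx ny)[]] := HC phi.
  rewrite /= jformB enormB; apply: (key (fun phi => G x (mult phi) - G y (mult phi))).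
    by apply: (modulus_ge0 wm); exact: powR_ge0.
  by move=> phi; rewrite distrC; have [_ /(_ _ _ nx ny)[]] := HC phi.
- by move=> j y v ny Yy /=; rewrite /jform big1// => phi _; rewrite GY// mul0r.
Unshelve. all: by end_near. Qed.

End JetForms.

(** * The exponents p and q, and the modulus [wtilde] *)

Section Exponents.
Context {R : realType}.
Variable alpha : R.
Hypothesis a01 : 0 < alpha <= 1.

Lemma absz_ceil (x : R) : 0 < x -> (absz (Num.ceil x))%:R = (Num.ceil x)%:~R :> R.
Proof.
move=> x0; rewrite natr_absz ger0_norm//.
by rewrite ceil_ge0 (lt_trans _ x0)// ltrN10.
Qed.

Lemma two_le_p_alpha : 2 <= (p_exp alpha)%:R * alpha.
Proof.
have [/andP[a0 a1]] : 0 < alpha <= 1 := a01.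
by rewrite -ler_pdivrMr// absz_ceil ?divr_gt0// ceil_ge.
Qed.

Lemma p_exp_ge2 : (2 <= p_exp alpha)%N.
Proof.
have /andP[a0 a1] := a01.
rewrite -(ler_nat R); apply: (le_trans two_le_p_alpha).
by rewrite ler_piMr.
Qed.

Lemma q_exp_gt0 : (0 < q_exp alpha)%N.
Proof.
have /andP[a0 a1] := a01.
rewrite -(ltr_nat R) absz_ceil ?divr_gt0//.
by apply: lt_le_trans (ceil_ge _); rewrite divr_gt0.
Qed.

Lemma p_le_2q : (p_exp alpha <= 2 * q_exp alpha)%N.
Proof.
have /andP[a0 a1] := a01.
have h : (Num.ceil (2 / alpha) <= 2 * Num.ceil (1 / alpha))%R.
  have -> : 2 / alpha = 2 * (1 / alpha) by rewrite mul1r.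
  by rewrite ceil_le_int intrM ler_pM2l// ceil_ge.
rewrite -(ler_nat R) natrM absz_ceil ?divr_gt0// absz_ceil ?divr_gt0//.
by rewrite -[2%:R]/(2%:~R) -intrM ler_int.
Qed.

(** As t <= 1, a smaller exponent gives a larger power. Larger distances are handled by compactness
    in [glue_local]. *)
Lemma wtilde_ge (w : R -> R) (t : R) : modulus w -> 0 <= t -> t <= 1 ->
  w (t `^ (p_exp alpha)%:R^-1) <= wtilde alpha w t.
Proof.
move=> wm; have /andP[a0 a1] := a01.
rewrite le_eqVlt => /orP[/eqP <-|t0] t1; rewrite /wtilde.
  have hp : (p_exp alpha)%:R^-1 != 0 :> R.
    by rewrite invr_eq0 pnatr_eq0 gtn_eqF// (leq_trans _ p_exp_ge2).
  by rewrite powR0// (modulus0 wm) (modulus_ge0 wm)// powR_ge0.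
apply: (modulus_le wm); first exact: powR_ge0.
have q0 : 0 < 2 * (q_exp alpha)%:R :> R by rewrite mulr_gt0// ltr0n q_exp_gt0.
have p0 : 0 < (p_exp alpha)%:R :> R by rewrite ltr0n (leq_trans _ p_exp_ge2).
apply: ger_powR; first by rewrite t0 t1.
rewrite ler_pdivrMr// mulrC ler_pdivlMr//.
apply: (@le_trans _ _ (1 * (p_exp alpha)%:R)); first by rewrite ler_pM2r.
by rewrite mul1r -natrM ler_nat p_le_2q.
Qed.

Lemma wtilde_le (w : R -> R) (s t : R) : modulus w -> 0 <= s -> s <= t ->
  wtilde alpha w s <= wtilde alpha w t.
Proof.
move=> wm s0 st; apply: (modulus_le wm); first exact: powR_ge0.
apply: ge0_ler_powR; rewrite ?nnegrE//; last exact: le_trans st.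
by have /andP[/ltW a0 _] := a01; rewrite divr_ge0// mulr_ge0.
Qed.

Lemma wtilde_gt0 (w : R -> R) (t : R) : modulus w -> 0 < t -> 0 < wtilde alpha w t.
Proof. by move=> wm t0; apply: (modulus_gt0 wm); exact: powR_gt0. Qed.

Lemma modulus_powR (beta : R) : 0 < beta <= 1 -> modulus (fun t => t `^ beta).
Proof.
move=> /andP[b0 b1]; split.
- by move=> t _; exact: powR_ge0.
- by move=> s t s0 st; apply: ge0_ler_powR; rewrite ?nnegrE ?(ltW b0)//; exact: le_trans st.
- move=> s t s0 t0; have [st0|st0] := eqVneq (s + t) 0.
    by rewrite st0 powR0 ?gt_eqF// addr_ge0// powR_ge0.
  have stp : 0 < s + t by rewrite lt_def st0 addr_ge0.
  (* A number in [0, 1] is at most its power with exponent beta; applied to s / (s + t) and t / (s +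
     t), which add up to 1, this gives subadditivity. *)
  have key r : 0 <= r -> r <= s + t -> r / (s + t) * (s + t) `^ beta <= r `^ beta.
    rewrite le_eqVlt => /orP[/eqP <-|r0] rst; first by rewrite !mul0r powR_ge0.
    have u0 : 0 < r / (s + t) <= 1 by rewrite divr_gt0//= ler_pdivrMr// mul1r.
    have h : r / (s + t) <= (r / (s + t)) `^ beta.
      by rewrite -[leLHS]powRr1 ?ger_powR//; case/andP: u0 => /ltW.
    apply: (le_trans (ler_wpM2r (powR_ge0 _ _) h)).
    by rewrite -powRM ?(ltW stp)// ?divfK//; case/andP: u0 => /ltW.
  have h1 := key s s0 ltac:(by rewrite lerDl).
  have h2 := key t t0 ltac:(by rewrite lerDr).
  apply: le_trans (lerD h1 h2); rewrite -mulrDl -mulrDl divff ?mul1r//.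
- apply/cvgrPdist_le => e e0; near=> t.
  have t0 : 0 < t by near: t; exact: nbhs_right_gt.
  rewrite sub0r normrN ger0_norm ?powR_ge0//.
  have te : t <= e `^ beta^-1 by near: t; apply: nbhs_right_le; exact: powR_gt0.
  apply: (@le_trans _ _ ((e `^ beta^-1) `^ beta)).
    by apply: ge0_ler_powR; rewrite ?nnegrE ?powR_ge0 ?(ltW b0) ?(ltW t0).
  by rewrite -powRrM mulVf ?gt_eqF// powRr1// ltW.
- by move=> t; exact: powR_gt0.
Unshelve. all: by end_near. Qed.

End Exponents.

(** * Cusps with integer exponent at the points of an alpha-set *)

Section AlphaCusp.
Context {R : realType} {d : nat}.
Local Notation E := 'cV[R]_d.+1.

Lemma norm_le_coord (x : E) (b : R) : 0 <= b -> (forall i, `|x i 0| <= b) -> `|x| <= b.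
Proof.
move=> b0 H; rewrite -[`|x|]/(mx_norm x) /mx_norm.
have -> : b = (NngNum b0)%:num by [].
rewrite num_le; apply/bigmax_leP; split => [|[i j] _ /=].
  by rewrite -num_le /=.
by rewrite -num_le /= ord1.
Qed.

Lemma row'_max_sq (z : E) : enorm (row' ord_max z) ^+ 2 = \sum_(i < d.+1 | i != ord_max) z i 0 ^+ 2.
Proof.
rewrite enorm_sq; apply: (@addrI _ (z ord_max 0 ^+ 2)).
rewrite -[RHS](bigD1 ord_max (F := fun i => z i 0 ^+ 2) (P := xpredT))//= big_ord_recr /= addrC; congr (_ + _).
apply: eq_bigr => i _; rewrite mxE; congr (z _ 0 ^+ 2).
by apply/val_inj; rewrite /= /bump leqNgt ltn_ord add0n.
Qed.

Lemma in_cusp_last0 p (c : R) (z : E) : (0 < p)%N -> in_cusp p c z -> z ord_max 0 = 0 -> z = 0.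
Proof.
move=> p0 [_ H] z0; move: H; rewrite z0 expr0n gtn_eqF// mulr0 => H.
apply/matrixP => i j; rewrite ord1 mxE.
have [->//|im] := eqVneq i ord_max.
apply/eqP; rewrite -sqrf_eq0 eq_le sqr_ge0 andbT; apply: le_trans H.
by rewrite (bigD1 i)//= lerDl sumr_ge0// => k _; exact: sqr_ge0.
Qed.

(** For height at most 1 and p >= 2 each horizontal coordinate is at most the height, so a short
    cusp lies in a ball. *)
Lemma interior_cusp (X : set E) p x0 : (2 <= p)%N -> X° x0 ->
  exists e B : R, [/\ 0 < e, 0 < B & cusp_at X p 1 e B x0 1%:M].
Proof.
move=> p2 /nbhs_ballP[r /= r0 Hr].
exists (r / 4), (Num.min 1 (r / 4)); split; rewrite ?divr_gt0//.
  by rewrite lt_min ltr01 divr_gt0.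
move=> y h Xy hy [h0 hc]; rewrite le_min => /andP[h1 h2]; rewrite mul1mx; apply: Hr.
rewrite -ball_normE /= -normrN opprB.
have hn : `|h| <= r / 4.
  apply: norm_le_coord; first by rewrite divr_ge0// ltW.
  move=> i; apply: le_trans h2; have [->|im] := eqVneq i ord_max; first by rewrite ger0_norm.
  have : h i 0 ^+ 2 <= h ord_max 0 ^+ 2.
    apply: (@le_trans _ _ (\sum_(i < d.+1 | i != ord_max) h i 0 ^+ 2)).
      by rewrite (bigD1 i)//= lerDl sumr_ge0// => k _; exact: sqr_ge0.
    by apply: (le_trans hc); rewrite mul1r; apply: ler_wiXn2l.
  by rewrite -ler_sqrt ?sqr_ge0// !sqrtr_sqr (ger0_norm h0).
have -> : y + h - x0 = (y - x0) + h by rewrite addrAC.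
apply: (le_lt_trans (ler_normD _ _)); move: hy hn; set a := `|_|; set b := `|_|; lra.
Qed.

(** For height t <= 1 the thin cusp gives (|h'| / r)^alpha <= kap^alpha t^(p alpha / 2) <= kap^alpha
    t, as p alpha >= 2. *)
Lemma boundary_cusp (X : set E) p (alpha : R) x0 : (2 <= p)%N -> 0 < alpha -> 2 <= p%:R * alpha ->
  X `<=` closure X° -> uniform_cusp_property alpha X° -> (closure X° `\` X°°) x0 ->
  exists c e B : R, exists A, [/\ 0 < c, 0 < e, 0 < B, A *m A^T = 1%:M & cusp_at X p c e B x0 A].
Proof.
move=> p2 a0 pa Xcl UX bx; have [eps [r [h [A [eps0 r0 h0 AA HA]]]]] := UX _ bx.
have p0 : (0 < p)%N by rewrite (leq_trans _ p2).
(* The first bound gives |h'| < r; the second gives h kap^alpha <= 1/2, so the lower boundary of the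
   alpha-cusp lies at height at most t / 2. *)
pose kap : R := Num.min (1 / 2) ((1 / (2 * h)) `^ alpha^-1).
have h20 : 0 < 1 / (2 * h) by rewrite divr_gt0// mulr_gt0.
have kap0 : 0 < kap by rewrite lt_min divr_gt0//= powR_gt0.
have kap2 : kap <= 1 / 2 by rewrite ge_min lexx.
have kapa : kap `^ alpha <= 1 / (2 * h).
  apply: (@le_trans _ _ (((1 / (2 * h)) `^ alpha^-1) `^ alpha)).
    apply: ge0_ler_powR; rewrite ?nnegrE ?powR_ge0 ?(ltW a0) ?(ltW kap0)//.
    by rewrite ge_min lexx orbT.
  by rewrite -powRrM mulVf ?gt_eqF// powRr1// ltW.
exists ((kap * r) ^+ 2), (eps / (2 * d.+1%:R)), (Num.min 1 (h / 2)), A; split => //.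
- by rewrite exprn_gt0// mulr_gt0.
- by rewrite divr_gt0// mulr_gt0.
- by rewrite lt_min ltr01 divr_gt0.
move=> y z Xy hy zc zB.
(* The open cusp omits its vertex, whereas [cusp_at] includes it; there the point is y itself. *)
have [zl0|zl0] := eqVneq (z ord_max 0) 0.
  by rewrite (in_cusp_last0 p0 zc zl0) mulmx0 addr0.
apply: interior_subset; apply: HA; first exact: Xcl.
  apply: (le_lt_trans (enorm_le _)).
  apply: (@le_lt_trans _ _ (d.+1%:R * (eps / (2 * d.+1%:R)))); first by rewrite ler_pM2l.
  have -> : d.+1%:R * (eps / (2 * d.+1%:R)) = eps / 2.
    have : d.+1%:R != 0 :> R by rewrite pnatr_eq0.
    by set D := d.+1%:R => D0; field.
  by rewrite ltr_pdivrMr// ltr_pMr// ltr1n.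
have [zl zs] := zc.
have zp : 0 < z ord_max 0 by rewrite lt_def zl0.
move: zB; rewrite le_min => /andP[z1 zh].
rewrite /cusp /=; set s := enorm _; have s0 : 0 <= s by exact: enorm_ge0.
set t := z ord_max 0 in zl zs zp z1 zh *.
have tp0 : 0 <= t `^ (p%:R / 2) by exact: powR_ge0.
have tpE : (t `^ (p%:R / 2)) ^+ 2 = t ^+ p.
  rewrite -powR_mulrn// -powRrM divfK ?pnatr_eq0// powR_mulrn//.
have sle : s <= kap * r * t `^ (p%:R / 2).
  rewrite -(@ler_pXn2r _ 2) ?nnegrE ?mulr_ge0 ?(ltW kap0) ?(ltW r0)//.
  by rewrite [leRHS]exprMn tpE row'_max_sq.
have tp1 : t `^ (p%:R / 2) <= 1.
  rewrite -(@ler_pXn2r _ 2) ?nnegrE// tpE expr1n; apply: exprn_ile1 => //.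
have sr : s / r <= kap * t `^ (p%:R / 2).
  by rewrite ler_pdivrMr// mulrAC.
split.
  apply: (le_lt_trans sle); apply: (@le_lt_trans _ _ (kap * r * 1)).
    by rewrite ler_wpM2l// mulr_ge0 ?(ltW kap0) ?(ltW r0).
  by rewrite mulr1 gtr_pMl//; lra.
apply/andP; split; last by move: zh zp h0; lra.
have : (s / r) `^ alpha <= kap `^ alpha * t.
  apply: (@le_trans _ _ ((kap * t `^ (p%:R / 2)) `^ alpha)).
    apply: ge0_ler_powR; rewrite ?nnegrE ?(ltW a0)//.
      by rewrite divr_ge0// ltW.
    by rewrite mulr_ge0// ltW.
  rewrite powRM ?(ltW kap0)//; apply: ler_wpM2l; first exact: powR_ge0.
  rewrite -powRrM -[leRHS](powRr1 zl); apply: ger_powR; first by rewrite zp z1.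
  by rewrite mulrAC ler_pdivlMr// mul1r.
move=> H; apply: (@le_lt_trans _ _ (h * (1 / (2 * h) * t))).
  rewrite ler_pM2l//; apply: (le_trans H); rewrite ler_wpM2r//.
have -> : h * (1 / (2 * h) * t) = t / 2 by field; rewrite gt_eqF.
by rewrite ltr_pdivrMr// ltr_pMr// ltr1n.
Qed.

Lemma alpha_set_cusp (X : set E) (alpha : R) x0 : 0 < alpha <= 1 -> alpha_set alpha X -> X x0 ->
  exists c e B : R, exists A,
    [/\ 0 < c, 0 < e, 0 < B, A *m A^T = 1%:M & cusp_at X (p_exp alpha) c e B x0 A].
Proof.
move=> a01 [cX fX uX] Xx0.
have [xi|xi] := pselect (X° x0).
  have [e [B [e0 B0 H]]] := interior_cusp (p_exp_ge2 a01) xi.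
  by exists 1, e, B, 1%:M; split; rewrite ?mul1mx ?trmx1.
have /andP[a0 _] := a01.
apply: (boundary_cusp (p_exp_ge2 a01) a0 (two_le_p_alpha a01) fX uX).
by split; [exact: fX|move=> /interior_subset].
Qed.

End AlphaCusp.

(** * Uniqueness of Fréchet derivatives *)

Section FrechetUniqueness.
Context {R : realType} {d : nat}.
Local Notation E := 'cV[R]_d.+1.

Lemma tset_cons j (x h : E) (v : j.-tuple E) : tset [tuple of x :: v] ord0 h = [tuple of h :: v].
Proof.
apply: eq_from_tnth => i; rewrite tnth_mktuple.
have [->|] := eqVneq i ord0; first by rewrite tnth0.
by case: (unliftP ord0 i) => [k ->|->]; rewrite ?eqxx// !tnthS.
Qed.

Lemma mlin_scale j (L : mlin j.+1) (a : R) (h : E) (v : j.-tuple E) :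
  L [tuple of a *: h :: v] = a * L [tuple of h :: v].
Proof.
have H b x y : L [tuple of b *: x + y :: v] = b * L [tuple of x :: v] + L [tuple of y :: v].
  by have := mlinP L [tuple of x :: v] ord0 b x y; rewrite !tset_cons.
have L0 : L [tuple of 0 :: v] = 0.
  by have := H 1 0 0; rewrite scaler0 addr0 mul1r => /eqP; rewrite -subr_eq0 opprD addrA subrr sub0r oppr_eq0 => /eqP.
by have := H a h 0; rewrite addr0 L0 addr0.
Qed.

Lemma is_frechet_unique j (G G' : E -> mlin j) (x : E) (L L' : mlin j.+1) :
  is_frechet G x L -> is_frechet G' x L' ->
  (\forall h \near (0 : E), forall v, G (x + h) v = G' (x + h) v) ->
  forall v, L v = L' v.
Proof.
move=> HL HL' HG v; rewrite (tuple_eta v); set h := thead v; set u := [tuple of behead v].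
have GG u' : G x u' = G' x u' by have := nbhs_singleton HG u'; rewrite addr0.
apply/eqP; rewrite -subr_eq0 -normr_le0; apply/ler_addgt0Pl => eps eps0; rewrite addr0.
pose P := \prod_(i < j) enorm (tnth u i).
have P0 : 0 <= P by rewrite prodr_ge0// => i _; exact: enorm_ge0.
pose K := 2 * (enorm h * P + 1).
have K0 : 0 < K by rewrite mulr_gt0// ltr_wpDl// mulr_ge0// enorm_ge0.
have e0 : 0 < eps / K by rewrite divr_gt0.
have H1 := HL _ e0; have H2 := HL' _ e0.
have : \forall h \near (0 : E), [/\ forall v, G (x + h) v = G' (x + h) v,
   opnorm_le (fun v => G (x + h) v - G x v - L [tuple of h :: v]) (eps / K * enorm h) &
   opnorm_le (fun v => G' (x + h) v - G' x v - L' [tuple of h :: v]) (eps / K * enorm h)].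
  by near=> k; split; near: k.
move=> /nbhs_ballP[r /= r0 Hr].
(* The two derivatives are compared on the short vector s h; by linearity in the first argument the
   factor s cancels, so h may be arbitrary. *)
pose s := r / (2 * (`|h| + 1)).
have h1 : 0 < `|h| + 1 by rewrite ltr_wpDl.
have s0 : 0 < s by rewrite divr_gt0// mulr_gt0.
have [E1 E2 E3] : [/\ forall v, G (x + s *: h) v = G' (x + s *: h) v,
   opnorm_le (fun v => G (x + s *: h) v - G x v - L [tuple of s *: h :: v]) (eps / K * enorm (s *: h)) &
   opnorm_le (fun v => G' (x + s *: h) v - G' x v - L' [tuple of s *: h :: v]) (eps / K * enorm (s *: h))].
  apply: Hr; rewrite -ball_normE /= sub0r normrN normrZ (gtr0_norm s0) /s.
  rewrite mulrAC ltr_pdivrMr ?mulr_gt0// ltr_pM2l//; have := normr_ge0 h; lra.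
have := E2 u; have := E3 u; rewrite !mlin_scale E1 GG -/P enormZ (gtr0_norm s0).
set a := _ - G' x u => h3 h2.
have h4 : s * `|L [tuple of h :: u] - L' [tuple of h :: u]| <= s * (2 * (eps / K * (enorm h * P))).
  rewrite -{1}(gtr0_norm s0) -normrM.
  have -> : s * (L [tuple of h :: u] - L' [tuple of h :: u]) =
    (a - s * L' [tuple of h :: u]) - (a - s * L [tuple of h :: u]) by ring.
  apply: (le_trans (ler_normB _ _)); apply: (le_trans (lerD h3 h2)).
  by rewrite le_eqVlt; apply/orP; left; apply/eqP; ring.
rewrite ler_pM2l// in h4; apply: (le_trans h4).
have -> : 2 * (eps / K * (enorm h * P)) = eps * (2 * (enorm h * P) / K) by ring.
rewrite ler_piMr ?(ltW eps0)// ler_pdivrMr// mul1r /K ler_pM2l//.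
by rewrite lerDl.
Unshelve. all: by end_near. Qed.

End FrechetUniqueness.

(** * From local to global derivatives *)

Section Gluing.
Context {R : realType} {d : nat}.
Local Notation E := 'cV[R]_d.+1.

Lemma opnorm_le_trans j (A : j.-tuple E -> R) (c c' : R) : c <= c' -> opnorm_le A c -> opnorm_le A c'.
Proof.
move=> cc H v; apply: (le_trans (H v)); apply: ler_wpM2r => //.
by rewrite prodr_ge0// => i _; exact: enorm_ge0.
Qed.

Lemma near_ball (x x0 : E) (T : R) : `|x - x0| < T -> \forall y \near x, `|y - x0| < T.
Proof.
move=> h; apply/nbhs_ballP; exists (T - `|x - x0|) => /=; first by rewrite subr_gt0.
move=> y; rewrite -ball_normE /= => hy.
have -> : y - x0 = (x - x0) - (x - y) by rewrite opprB [RHS]addrC subrKA.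
by apply: (le_lt_trans (ler_normB _ _)); rewrite -ltrBrDl.
Qed.

Lemma near_modulus (w : R -> R) (p : nat) (x : E) (eps : R) : modulus w -> (0 < p)%N -> 0 < eps ->
  \forall y \near x, w (enorm (y - x) `^ p%:R^-1) <= eps.
Proof.
move=> wm p0 e0; have [T T0 HT] := modulus_small wm e0.
have : \forall h \near (0 : E), enorm h < T ^+ p by apply: near0_enorm; rewrite exprn_gt0.
move=> /nbhs_ballP[r /= r0 Hr]; apply/nbhs_ballP; exists r => // y; rewrite -ball_normE /= => hy.
have {}Hr : enorm (y - x) < T ^+ p by apply: Hr; rewrite -ball_normE /= sub0r opprB.
apply: HT; first exact: powR_ge0.
rewrite -(@ler_pXn2r _ p) ?nnegrE ?powR_ge0 ?(ltW T0)//.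
rewrite -powR_mulrn ?powR_ge0// -powRrM mulVf ?pnatr_eq0 ?gtn_eqF// powRr1 ?enorm_ge0//.
exact: ltW.
Qed.

(** The local families agree on overlaps: at interior points by induction on the order and
    uniqueness of derivatives, at the other points of X by continuity, since X is fat. Hence the
    family centred at y may be used at y itself, which gives a global family. *)
Lemma glue_local (X Y : set E) (f : E -> R) (n p : nat) (w v : R -> R) :
  (0 < p)%N -> modulus w -> X `<=` closure X° -> Y `<=` X ->
  (forall t, 0 <= t -> t <= 1 -> w (t `^ p%:R^-1) <= v t) ->
  (forall s t, 0 <= s -> s <= t -> v s <= v t) -> (forall t, 0 < t -> 0 < v t) ->
  (forall x0, X x0 -> exists (T : R) (F : forall j, E -> mlin j), 0 < T /\
    let near_x0 y := X y /\ `|y - x0| <= T in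
    [/\ forall y u, near_x0 y -> F 0%N y u = f y,
      forall j x, (j < n)%N -> X° x -> `|x - x0| < T -> is_frechet (F j) x (F j.+1 x),
      forall j, (j <= n)%N -> exists2 C : R, 0 < C & forall x y, near_x0 x -> near_x0 y ->
        opnorm_le (F j x) C /\
        opnorm_le (fun u => F j x u - F j y u) (C * w (enorm (x - y) `^ (p%:R^-1))) &
      forall j y u, near_x0 y -> Y y -> F j y u = 0]) ->
  Ckw_flat n v X Y f.
Proof.
move=> p0 wm Xcl YX wv vle v0 Hloc.
have /choice[T0 HT0] : forall x0, exists T : R, X x0 -> exists (F : forall j, E -> mlin j), 0 < T /\
    let near_x0 y := X y /\ `|y - x0| <= T in
    [/\ forall y u, near_x0 y -> F 0%N y u = f y,
      forall j x, (j < n)%N -> X° x -> `|x - x0| < T -> is_frechet (F j) x (F j.+1 x),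
      forall j, (j <= n)%N -> exists2 C : R, 0 < C & forall x y, near_x0 x -> near_x0 y ->
        opnorm_le (F j x) C /\
        opnorm_le (fun u => F j x u - F j y u) (C * w (enorm (x - y) `^ (p%:R^-1))) &
      forall j y u, near_x0 y -> Y y -> F j y u = 0].
  move=> x0; have [Xx0|nX] := pselect (X x0); last by exists 0.
  by have [T [F H]] := Hloc x0 Xx0; exists T => _; exists F.
have zero_mlin j : @multilinear R d j (fun=> 0) by move=> u i a x y; rewrite mulr0 addr0.
have /choice[F0 HF0] : forall x0, exists F : forall j, E -> mlin j, X x0 -> 0 < T0 x0 /\
    let near_x0 y := X y /\ `|y - x0| <= T0 x0 in
    [/\ forall y u, near_x0 y -> F 0%N y u = f y,
      forall j x, (j < n)%N -> X° x -> `|x - x0| < T0 x0 -> is_frechet (F j) x (F j.+1 x),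
      forall j, (j <= n)%N -> exists2 C : R, 0 < C & forall x y, near_x0 x -> near_x0 y ->
        opnorm_le (F j x) C /\
        opnorm_le (fun u => F j x u - F j y u) (C * w (enorm (x - y) `^ (p%:R^-1))) &
      forall j y u, near_x0 y -> Y y -> F j y u = 0].
  move=> x0; have [Xx0|nX] := pselect (X x0); last by exists (fun j _ => MLin (zero_mlin j)).
  by have [F H] := HT0 x0 Xx0; exists F.
clear Hloc HT0.
have T00 x0 : X x0 -> 0 < T0 x0 by move=> /HF0[].
have nearW x0 y : X y -> `|y - x0| < T0 x0 -> X y /\ `|y - x0| <= T0 x0 by move=> Xy /ltW.
have agree_int j : (j <= n)%N -> forall x0 x1 y, X x0 -> X x1 -> X° y ->
    `|y - x0| < T0 x0 -> `|y - x1| < T0 x1 -> forall u, F0 x0 j y u = F0 x1 j y u.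
  elim: j => [|j IH] jn x0 x1 y Xx0 Xx1 Xy h0 h1 u.
    have [_ /= [H0 _ _ _]] := HF0 x0 Xx0; have [_ /= [H1 _ _ _]] := HF0 x1 Xx1.
    have Xy' := interior_subset Xy.
    by rewrite H0 ?H1//; exact: nearW.
  have [_ /= [_ H0 _ _]] := HF0 x0 Xx0; have [_ /= [_ H1 _ _]] := HF0 x1 Xx1.
  apply: (is_frechet_unique (H0 j y jn Xy h0) (H1 j y jn Xy h1)).
  apply: (near_shift0 (P := fun z => forall u, F0 x0 j z u = F0 x1 j z u)).
  near=> z => u'; apply: (IH (ltnW jn)) => //.
  - by near: z; apply: open_nbhs_nbhs; split => //; exact: open_interior.
  - by near: z; exact: near_ball.
  - by near: z; exact: near_ball.
have agree j : (j <= n)%N -> forall x0 x1 y, X x0 -> X x1 -> X y ->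
    `|y - x0| < T0 x0 -> `|y - x1| < T0 x1 -> forall u, F0 x0 j y u = F0 x1 j y u.
  move=> jn x0 x1 y Xx0 Xx1 Xy h0 h1 u.
  apply/eqP; rewrite -subr_eq0 -normr_le0; apply/ler_addgt0Pl => eps eps0; rewrite addr0.
  have [_ /= [_ _ /(_ j jn)[C0 C00 HC0] _]] := HF0 x0 Xx0.
  have [_ /= [_ _ /(_ j jn)[C1 C10 HC1] _]] := HF0 x1 Xx1.
  pose P := \prod_(i < j) enorm (tnth u i).
  have P0 : 0 <= P by rewrite prodr_ge0// => i _; exact: enorm_ge0.
  pose K := (C0 + C1) * P + 1.
  have K0 : 0 < K by rewrite ltr_wpDl// mulr_ge0// addr_ge0// ltW.
  have ek : 0 < eps / K by rewrite divr_gt0.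
  have nb : \forall z \near y, [/\ `|z - x0| < T0 x0, `|z - x1| < T0 x1 & w (enorm (z - y) `^ p%:R^-1) <= eps / K].
    by near=> z; split; near: z; [exact: near_ball|exact: near_ball|exact: near_modulus].
  have [z [Xz [z0 z1 zw]]] := Xcl y Xy _ nb.
  have Xz' := interior_subset Xz.
  have [_ /(_ u) B0] := HC0 z y (nearW _ _ Xz' z0) (nearW _ _ Xy h0).
  have [_ /(_ u) B1] := HC1 z y (nearW _ _ Xz' z1) (nearW _ _ Xy h1).
  have -> : F0 x0 j y u - F0 x1 j y u = (F0 x1 j z u - F0 x1 j y u) - (F0 x0 j z u - F0 x0 j y u).
    by rewrite (agree_int j jn x0 x1 z Xx0 Xx1 Xz z0 z1 u); ring.
  apply: (le_trans (ler_normB _ _)); apply: (le_trans (lerD B1 B0)).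
  rewrite -/P -!mulrA [w _ * P]mulrC !mulrA -mulrDl -mulrDl.
  apply: (@le_trans _ _ (K * (eps / K))); last by rewrite mulrCA divff ?mulr1// gt_eqF.
  apply: ler_pM => //.
  - by rewrite mulr_ge0// addr_ge0// ltW.
  - by apply: (modulus_ge0 wm); exact: powR_ge0.
  - by rewrite /K [C1 + C0]addrC lerDl.
pose F j (y : E) := F0 y j y.
have FE j x y u : (j <= n)%N -> X x -> X y -> `|y - x| < T0 x -> F j y u = F0 x j y u.
  by move=> jn Xx Xy h; apply: (agree j) => //; rewrite subrr normr0 T00.
exists F; split.
- split.
  + by move=> x u Xx; have [T0x /= [H _ _ _]] := HF0 x Xx; apply: H; rewrite subrr normr0 ltW.
  + move=> j x jn Xx eps eps0; have Xx' := interior_subset Xx.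
    have T0x := T00 _ Xx'; have [_ /= [_ H _ _]] := HF0 x Xx'.
    have := H j x jn Xx; rewrite subrr normr0 => /(_ T0x _ eps0) HH.
    near=> h => u.
    have Xh : X (x + h).
      near: h; apply: near_shift0; near=> z; apply: interior_subset; near: z.
      by apply: open_nbhs_nbhs; split => //; exact: open_interior.
    rewrite (FE j x (x + h)) ?(ltnW jn)//; last first.
      near: h; apply: (near_shift0 (P := fun z => `|z - x| < T0 x)).
      by apply: near_ball; rewrite subrr normr0.
    by move: u; near: h; exact: HH.
  + move=> j x jn Xx eps eps0.
    have [T0x /= [_ _ /(_ j jn)[C C0 HC] _]] := HF0 x Xx.
    rewrite near_withinE; near=> y => Xy u.
    have yx : `|y - x| < T0 x by near: y; apply: near_ball; rewrite subrr normr0.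
    rewrite (FE j x y)//.
    have nx : X x /\ `|x - x| <= T0 x by rewrite subrr normr0 ltW.
    have [_ H] := HC y x (nearW _ _ Xy yx) nx.
    apply: (@opnorm_le_trans _ _ _ eps _ H); rewrite mulrC -ler_pdivlMr//.
    by near: y; apply: near_modulus => //; rewrite divr_gt0.
- move=> K cK KX.
  have [M [M0 HM]] : exists M : R, 0 < M /\ forall x, K x -> opnorm_le (F n x) M.
    (* Compactness in near-covering form: a bound M that is valid near each point for all large M is
       valid on all of K for all large M. *)
    have := (compact_near_coveringP K).1 cK R (pinfty_nbhs R) (fun M x => X x -> opnorm_le (F n x) M) _.
    move=> H; have {}H : \forall M \near +oo, K `<=` (fun x => X x -> opnorm_le (F n x) M).
      apply: H => x Kx; have Xx := KX _ Kx.
      have [T0x /= [_ _ /(_ n (leqnn n))[C C0 HC] _]] := HF0 x Xx.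
      have nx : X x /\ `|x - x| <= T0 x by rewrite subrr normr0 ltW.
      exists ([set y | `|y - x| < T0 x], [set M : R | C <= M]).
        split => /=; first by apply: near_ball; rewrite subrr normr0.
        by apply: nbhs_pinfty_ge; exact: num_real.
      move=> [y M] /= [yx CM] Xy u; rewrite (FE n x y)//.
      have [H1 _] := HC y x (nearW _ _ Xy yx) nx.
      exact: (opnorm_le_trans CM H1).
    near (pinfty_nbhs R) => M; exists M; split; first by near: M; by apply: nbhs_pinfty_gt; exact: num_real.
    move=> x Kx; have : K `<=` (fun x => X x -> opnorm_le (F n x) M) by near: M.
    by move=> /(_ x Kx) HH; apply: HH; exact: KX.
  pose good (C : R) x := K x -> forall y, K y -> opnorm_le (fun u => F n x u - F n y u) (C * v (enorm (x - y))).
  have vge0 t : 0 <= t -> 0 <= v t.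
    by move=> t0; apply: (le_trans _ (vle 0 t (lexx _) t0)); apply: le_trans (wv 0 (lexx _) ler01);
      apply: (modulus_ge0 wm); exact: powR_ge0.
  have := (compact_near_coveringP K).1 cK R (pinfty_nbhs R) good _.
  move=> H; have {}H : \forall C \near +oo, K `<=` good C.
    apply: H => x Kx; have Xx := KX _ Kx.
    have [T0x /= [_ _ /(_ n (leqnn n))[C C0 HC] _]] := HF0 x Xx.
    pose r := Num.min 1 (T0 x / 2).
    have r0 : 0 < r by rewrite lt_min ltr01 divr_gt0.
    (* Points at distance less than r lie in one neighbourhood, where C works. Otherwise the
       difference is at most 2 M, which is at most (2 M / v r) v(|z - y|) since v is increasing and
       v r > 0. *)
    exists ([set y | `|y - x| < T0 x / 2], [set B : R | C + 2 * M / v r <= B]).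
      split => /=; first by apply: near_ball; rewrite subrr normr0 divr_gt0.
      by apply: nbhs_pinfty_ge; exact: num_real.
    move=> [z B] /= [zx CB] Kz y Ky.
    have Xz := KX _ Kz; have Xy := KX _ Ky.
    have vr : 0 < v r by exact: v0.
    have Q0 : 0 <= 2 * M / v r by rewrite divr_ge0 ?mulr_ge0// ltW.
    have zx' : `|z - x| < T0 x by move: zx; lra.
    have [rl|rl] := ltP (enorm (z - y)) r.
      have [r1 rT] : enorm (z - y) < 1 /\ enorm (z - y) < T0 x / 2.
        by move: rl; rewrite lt_min => /andP[].
      have yx : `|y - x| < T0 x.
        have -> : y - x = (z - x) - (z - y) by rewrite opprB [RHS]addrC subrKA.
        apply: (le_lt_trans (ler_normB _ _)).
        have : `|z - y| <= enorm (z - y) by apply: norm_le_coord; [exact: enorm_ge0|exact: coord_le_enorm].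
        move: zx rT; set a := `|_|; set b := enorm _; set c := `|z - y|; lra.
      have [_ H] := HC z y (nearW _ _ Xz zx') (nearW _ _ Xy yx).
      move=> u; rewrite (FE n x z)// (FE n x y)//.
      apply: opnorm_le_trans H _; apply: ler_pM.
      - exact: ltW.
      - by apply: (modulus_ge0 wm); exact: powR_ge0.
      - by apply: le_trans CB; rewrite lerDl.
      - by apply: wv; [exact: enorm_ge0|exact: ltW].
    have vv : v r <= v (enorm (z - y)) by apply: vle => //; exact: ltW.
    apply: (@opnorm_le_trans _ _ (M + M)).
      apply: (@le_trans _ _ (2 * M / v r * v (enorm (z - y)))).
        rewrite mulrAC ler_pdivlMr//; have -> : M + M = 2 * M by ring.
        by rewrite ler_wpM2l// mulr_ge0// ltW.
      by apply: ler_wpM2r; [apply: vge0; exact: enorm_ge0|apply: le_trans CB; rewrite lerDr ltW].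
    move=> u; apply: (le_trans (ler_normB _ _)); rewrite mulrDl.
    by apply: lerD; exact: HM.
  near (pinfty_nbhs R) => B; exists B; first by near: B; by apply: nbhs_pinfty_gt; exact: num_real.
  move=> x y Kx Ky; have : K `<=` good B by near: B.
  by move=> /(_ x Kx Kx y Ky).
- move=> j y u jn Yy; have Xy := YX _ Yy.
  have [T0y /= [_ _ _ H]] := HF0 y Xy; apply: H => //.
  by rewrite subrr normr0 ltW.
Unshelve. all: by end_near. Qed.

End Gluing.

Theorem theorem1 (R : realType) (d : nat) (alpha : R) (X : set 'cV[R]_d.+1) :
  0 < alpha <= 1 -> alpha_set alpha X ->
  [/\ forall (beta : R) (n : nat), 0 < beta <= 1 ->
        Akw (n * p_exp alpha) (fun t => t `^ beta) X `<=`
        Ckw n (fun t => t `^ (alpha * beta / (2 * (q_exp alpha)%:R))) X,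
      forall (w : R -> R) (n : nat), modulus w ->
        Akw (n * p_exp alpha) w X `<=` Ckw n (wtilde alpha w) X &
      forall (Y : set 'cV[R]_d.+1), Y `<=` X ->
        forall (w : R -> R) (n : nat), modulus w ->
          Akw_flat (n * p_exp alpha) w X Y `<=`
          Ckw_flat n (wtilde alpha w) X Y].
Proof.
move=> a01 aX.
have p2 := p_exp_ge2 a01.
have flat_case (Y : set 'cV[R]_d.+1) : Y `<=` X -> forall (w : R -> R) (n : nat), modulus w ->
    Akw_flat (n * p_exp alpha) w X Y `<=` Ckw_flat n (wtilde alpha w) X Y.
  move=> YX w n wm f Af.
  have [_ fX _] := aX.
  apply: (@glue_local _ _ X Y f n (p_exp alpha) w) => //.
  - exact: ltnW.
  - by move=> t t0 t1; exact: wtilde_ge.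
  - by move=> s t s0 st; exact: wtilde_le.
  - by move=> t t0; exact: wtilde_gt0.
  move=> x0 Xx0; have [c [e [B [A [c0 e0 B0 AA cX]]]]] := alpha_set_cusp a01 aX Xx0.
  exact: (local_extension p2 c0 e0 B0 AA Xx0 cX wm Af).
have all_case (w : R -> R) (n : nat) : modulus w ->
    Akw (n * p_exp alpha) w X `<=` Ckw n (wtilde alpha w) X.
  move=> wm f Af.
  (* With Y empty the vanishing conditions are void. *)
  have [|F [HF1 HF2 _]] := @flat_case set0 (@sub0set _ X) w n wm f; last by exists F.
  by split.
split => // beta n b01 f Af.
have -> : (fun t => t `^ (alpha * beta / (2 * (q_exp alpha)%:R))) =
    wtilde alpha (fun t => t `^ beta).
  by apply: funext => t; rewrite /wtilde -powRrM mulrAC.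
exact: (all_case _ n (modulus_powR b01)).
Qed.
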